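(* Let $v$ be a flow on a connected compact surface $S$. The following are equivalent: (1) The flow $v$ is recurrent. (2) There are no non-closed proper orbits. (3) Each orbit is closed or locally dense. (4) The orbit class space $S/\hat{v}$ is $T_{1/2}$. (5) The orbit space $S/v$ is $S_{1/2}$.
   Context: A surface is a two-dimensional paracompact manifold, possibly with boundary. A flow on a topological space $X$ is a continuous action $v\colon \mathbb{R}\times X\to X$; write $v_t=v(t,\cdot)$ and $O(x)=\{v_t(x)\mid t\in\mathbb{R}\}$. Let $\omega(x)=\bigcap_{n\in\mathbb{R}}\overline{\{v_t(x)\mid t>n\}}$ and $\alpha(x)=\bigcap_{n\in\mathbb{R}}\overline{\{v_t(x)\mid t<n\}}$. A point $x$ is singular if $v_t(x)=x$ for all $t$, periodic if it is not singular and $v_T(x)=x$ for some $T>0$, and closed if it is singular or periodic; an orbit is closed if it consists of closed points. A point $x$ is recurrent if $x\in\omega(x)\cup\alpha(x)$; the flow is recurrent if every point is recurrent. An orbit is proper if it is embedded, and locally dense if its closure has nonempty interior. The orbit space $S/v$ is the quotient of $S$ by the relation $x\sim y$ iff $O(x)=O(y)$; the orbit class space $S/\hat v$ is the quotient of $S$ by $x\approx y$ iff $\overline{O(x)}=\overline{O(y)}$ (it is the Kolmogorov ($T_0$) quotient of $S/v$). A topological space is $T_{1/2}$ if every singleton is closed or open; it is $S_{1/2}$ if its Kolmogorov quotient (identifying points with the same closure) is $T_{1/2}$. *)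

(* Defs.v *)
From HB Require Import structures.
From mathcomp Require Import all_boot all_order all_algebra.
From mathcomp Require Import all_classical all_reals all_analysis.
Import numFieldNormedType.Exports.
Set Implicit Arguments. Unset Strict Implicit. Unset Printing Implicit Defensive.
Import Order.TTheory GRing.Theory Num.Theory.
Local Open Scope classical_set_scope.
Local Open Scope ring_scope.

Definition half_plane (R : realType) : set (R * R) := [set p | 0 <= p.2].

Definition has_chart (R : realType) (S : topologicalType) (x : S) : Prop :=
  exists (U : set S) (W : set (R * R)) (f : S -> R * R) (g : R * R -> S),
    [/\ open U, U x, open W,
        f @` U `<=` W `&` @half_plane R & g @` (W `&` @half_plane R) `<=` U] /\
    [/\ (forall y, U y -> g (f y) = y),
        (forall p, (W `&` @half_plane R) p -> f (g p) = p),
        {within U, continuous f} &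
        {within W `&` @half_plane R, continuous g}].

(* a surface: Hausdorff, locally homeomorphic to open subsets of the closed
   half-plane.  (Paracompactness is automatic in the compact case used here.) *)
Definition surface (R : realType) (S : topologicalType) : Prop :=
  hausdorff_space S /\ forall x : S, has_chart R x.

Definition flow (R : realType) (S : topologicalType) (v : R -> S -> S) : Prop :=
  [/\ continuous (fun p : R * S => v p.1 p.2),
      (forall x, v 0 x = x) &
      (forall s t x, v (s + t) x = v s (v t x))].

Section FlowNotions.
Context (R : realType) (S : topologicalType) (v : R -> S -> S).

Definition orbit (x : S) : set S := [set v t x | t in [set: R]].

Definition omega_limit (x : S) : set S :=
  \bigcap_(n in [set: R]) closure [set v t x | t in [set t | n < t]].
Definition alpha_limit (x : S) : set S :=
  \bigcap_(n in [set: R]) closure [set v t x | t in [set t | t < n]].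

Definition singular_pt (x : S) : Prop := forall t, v t x = x.
Definition periodic_pt (x : S) : Prop :=
  ~ singular_pt x /\ exists T : R, 0 < T /\ v T x = x.
Definition closed_pt (x : S) : Prop := singular_pt x \/ periodic_pt x.
Definition closed_orbit (x : S) : Prop := forall y, orbit x y -> closed_pt y.

Definition recurrent_pt (x : S) : Prop := (omega_limit x `|` alpha_limit x) x.
Definition recurrent_flow : Prop := forall x : S, recurrent_pt x.

(* O(x) is embedded: the orbit map t |-> v t x, taken modulo its fibres,
   is a homeomorphism onto O(x) with the subspace topology. *)
Definition proper_orbit (x : S) : Prop :=
  forall (t0 e : R), 0 < e -> exists2 W : set S, nbhs (v t0 x) W &
    forall t, W (v t x) -> exists s, v s x = v t x /\ `|s - t0| < e.

Definition locally_dense (x : S) : Prop := interior (closure (orbit x)) !=set0.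

End FlowNotions.

Record space := Space { pts : Type; opens : set (set pts) }.

Definition sp_closure (X : space) (A : set (pts X)) : set (pts X) :=
  [set x | forall U, @opens X U -> U x -> U `&` A !=set0].
Definition sp_closed (X : space) (A : set (pts X)) : Prop :=
  @opens X (~` A).

Definition quotient_space (X : space) (Rel : pts X -> pts X -> Prop) : space :=
  @Space {A : set (pts X) | exists x, A = Rel x}
    (fun U => @opens X [set y | exists2 A, U A & proj1_sig A y]).

Definition kolmogorov (X : space) : space :=
  quotient_space (fun x y : pts X => sp_closure [set x] = sp_closure [set y]).

Definition T_half (X : space) : Prop :=
  forall p : pts X, sp_closed [set p] \/ @opens X [set p].
Definition S_half (X : space) : Prop := T_half (kolmogorov X).

Definition top_space (T : topologicalType) : space := @Space T open.

Definition orbit_space (R : realType) (S : topologicalType) (v : R -> S -> S) :=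
  quotient_space (X := top_space S) (fun x y => orbit v x = orbit v y).
Definition orbit_class_space (R : realType) (S : topologicalType)
    (v : R -> S -> S) :=
  quotient_space (X := top_space S)
    (fun x y => closure (orbit v x) = closure (orbit v y)).

(* Main.v *)
(* A recurrent orbit that is neither closed nor locally dense would have a nowhere dense closure
   K. Cross sections of a continuous flow on a surface are connected and linearly ordered, since
   their points separate them; the order compares winding parities computed in a chart. If all
   points are recurrent, every gap of K in a section is met again by the orbits through it, so it
   contains the ends of a closed curve made of an orbit arc and a piece of the gap. This loop
   misses K, and meets exactly once a small segment of the section joining two points of the
   orbit. Taking smaller and smaller segments gives infinitely many loops whose dual classes in
   H^1(S; Z/2) are pairwise distinct, since they are told apart by closed curves made of an orbit
   arc in K and one of these segments; but H^1(S; Z/2) is finite as S is compact. Classes in H^1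
   are represented by torsors given by local potentials. Near a periodic orbit the return map is
   monotone, which traps every nearby non-closed orbit; hence the orbit class of a non-closed
   recurrent orbit is open. *)

Require Import Defs.
From HB Require Import structures.
From mathcomp Require Import all_boot all_order all_algebra.
From mathcomp Require Import all_classical all_reals all_analysis.
From mathcomp Require Import lra.
Import numFieldNormedType.Exports.
Set Implicit Arguments. Unset Strict Implicit. Unset Printing Implicit Defensive.
Import Order.TTheory GRing.Theory Num.Theory.
Local Open Scope classical_set_scope.
Local Open Scope ring_scope.
(* [orbit] is shadowed by the one of fingraph. *)
Local Notation orbit := Defs.orbit.

(** * Locally constant functions and torsors *)

Definition locally_constant (T : topologicalType) (U : Type) (A : set T) (f : T -> U) : Prop :=
  forall x, A x -> \forall y \near x, A y -> f y = f x.

Section LocallyConstant.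
Variable T : topologicalType.
Implicit Types A B C : set T.

Lemma locally_constantS (U : Type) A B (f : T -> U) :
  A `<=` B -> locally_constant B f -> locally_constant A f.
Proof. by move=> AB lf x /AB Bx; apply: filterS (lf x Bx) => y fy /AB. Qed.

Lemma locally_constant_addb A (f g : T -> bool) : locally_constant A f ->
  locally_constant A g -> locally_constant A (fun x => f x (+) g x).
Proof.
move=> lf lg x Ax; apply: filterS2 (lf x Ax) (lg x Ax) => y fy gy Ay.
by rewrite fy// gy.
Qed.

Lemma locally_constant_comp (T' : topologicalType) (U : Type) A (B : set T')
    (f : T' -> U) (g : T -> T') :
  {within A, continuous g} -> (forall x, A x -> B (g x)) -> locally_constant B f ->
  locally_constant A (f \o g).
Proof.
move=> /subspace_continuousP cg AB lf x Ax.
have near_fg : \forall y \near x, A y -> B (g y) -> f (g y) = f (g x).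
  exact: cg (lf _ (AB _ Ax)).
by apply: filterS near_fg => y fgy Ay; apply: (fgy Ay); exact: AB.
Qed.

Lemma connected_locally_constant (U : Type) C (f : T -> U) : connected C ->
  locally_constant C f -> forall x y, C x -> C y -> f x = f y.
Proof.
move=> cC lf x y Cx Cy; apply: contrapT => fxy; move: cC; apply/connectedPn.
pose E b := C `&` [set z | `[< f z = f x >] = b].
have far b : E b `&` closure (E (~~ b)) = set0.
  apply/seteqP; split => // z [[Cz zb]] /(_ _ (lf z Cz))[w [[Cw wb] fw]].
  by move: wb; rewrite /= fw// zb; case: (b).
exists E; split.
- by case; [exists x; split => //; exact/asboolP|exists y; split => //; exact/asboolPn/nesym].
- apply/seteqP; split => [z Cz|z [[]|[]]//].
  by case fzx : `[< f z = f x >]; [right|left].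
- by split; [rewrite setIC; exact: (far true)|exact: (far false)].
Qed.

Lemma locally_constant_connected C :
  (forall f : T -> bool, locally_constant C f -> forall x y, C x -> C y -> f x = f y) ->
  connected C.
Proof.
move=> constC; apply: contrapT => /connectedPn[E [E0 CE sepE]].
have [[x Ex] [y Ey]] := (E0 true, E0 false).
have disj z : E false z -> ~ E true z.
  by move=> Efz Etz; have : (E false `&` E true) z by []; rewrite separated_disjoint.
have far b z : E b z -> nbhs z (~` E (~~ b)).
  move=> Ebz; apply: contrapT => nfar; suff : set0 z by [].
  have cz : closure (E (~~ b)) z.
    move=> N Nz; apply: contrapT => /set0P/negP; rewrite negbK => /eqP EN.
    by apply: nfar; apply: filterS Nz => w Nw Ew; have : (E (~~ b) `&` N) w by []; rewrite EN.
  by case: b Ebz nfar cz => Ez _ cz; case: sepE => s1 s2; [rewrite -s1|rewrite -s2]; split.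
have : `[< E true x >] = `[< E true y >].
  apply: (constC (fun z => `[< E true z >])).
  - move=> z; rewrite {1}CE => -[Ez|Ez]; apply: filterS (far _ _ Ez) => w Ew; rewrite CE.
      by case=> [Ew'|/Ew//]; rewrite !asboolF//; exact: disj.
    by case=> [/Ew//|Ew']; rewrite !asboolT.
  - by rewrite CE; right.
  - by rewrite CE; left.
by rewrite asboolT// asboolF//; exact: disj Ey.
Qed.

End LocallyConstant.

(* A Z/2-torsor on A, given by local potentials: [c.1] is the domain of the
   potential [c.2], and two potentials differ by a locally constant function. *)
Record torsor_on (T : topologicalType) (A : set T) (F : set (set T * (T -> bool))) : Prop :=
  TorsorOn {
    torsor_open : forall c a, F c -> A a -> c.1 a -> \forall b \near a, A b -> c.1 b;
    torsor_cover : forall a, A a -> exists2 c, F c & c.1 a;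
    torsor_compat : forall c c', F c -> F c' ->
      locally_constant (A `&` c.1 `&` c'.1) (fun a => c.2 a (+) c'.2 a) }.

Definition potential_on (T : topologicalType) (A : set T)
    (F : set (set T * (T -> bool))) (phi : T -> bool) : Prop :=
  forall c, F c -> locally_constant (A `&` c.1) (fun a => phi a (+) c.2 a).

Definition torsor_isomorphism (T : topologicalType) (F G : set (set T * (T -> bool)))
    (Phi : T -> bool) : Prop :=
  forall c c', F c -> G c' ->
    locally_constant (c.1 `&` c'.1) (fun a => Phi a (+) c.2 a (+) c'.2 a).

Lemma potential_on_unique (T : topologicalType) (A : set T) F (phi psi : T -> bool) :
  torsor_on A F -> potential_on A F phi -> potential_on A F psi ->
  locally_constant A (fun a => phi a (+) psi a).
Proof.
move=> torF pphi ppsi a Aa; have [c Fc ca] := torsor_cover torF Aa.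
have := locally_constant_addb (pphi c Fc) (ppsi c Fc) (conj Aa ca).
apply: filterS2 (torsor_open torF Fc Aa ca) => b cb eq_b Ab.
have := eq_b (conj Ab (cb Ab)).
by rewrite addbACA addbb addbF addbACA addbb addbF.
Qed.

Lemma torsor_onS (T : topologicalType) (A B : set T) F :
  A `<=` B -> torsor_on B F -> torsor_on A F.
Proof.
move=> AB torF; split.
- move=> c a Fc /AB Ba ca.
  by apply: filterS (torsor_open torF Fc Ba ca) => b cb /AB.
- by move=> a /AB; exact: torsor_cover.
- move=> c c' Fc Fc'; apply: locally_constantS (torsor_compat torF Fc Fc') => a [[/AB Ba ca] c'a].
  by split.
Qed.

Lemma potential_onS (T : topologicalType) (A B : set T) F phi :
  A `<=` B -> potential_on B F phi -> potential_on A F phi.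
Proof.
by move=> AB pphi c /pphi; apply: locally_constantS => a [/AB].
Qed.

Definition pullback_torsor (T U : Type) (g : U -> T) (F : set (set T * (T -> bool))) :
    set (set U * (U -> bool)) :=
  [set (g @^-1` c.1, c.2 \o g) | c in F].

Section Pullback.
Variables (T U : topologicalType) (A : set T) (B : set U) (g : U -> T).

Lemma pullback_torsor_on F : {within B, continuous g} -> (forall b, B b -> A (g b)) ->
  torsor_on A F -> torsor_on B (pullback_torsor g F).
Proof.
move=> cg BA torF; split.
- move=> _ b [c Fc <-] Bb /= cb; have /subspace_continuousP cg' := cg.
  have near_c : \forall b' \near b, B b' -> A (g b') -> c.1 (g b').
    exact: cg' (torsor_open torF Fc (BA _ Bb) cb).
  by apply: filterS near_c => b' cb' Bb'; apply: (cb' Bb'); exact: BA.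
- move=> b /BA/(torsor_cover torF)[c Fc cgb].
  by exists (g @^-1` c.1, c.2 \o g) => //; exists c.
- move=> _ _ [c Fc <-] [c' Fc' <-] /=.
  apply: (locally_constant_comp _ _ (torsor_compat torF Fc Fc')).
    by apply: continuous_subspaceW cg => b [[]].
  by move=> b [[/BA Agb cb] c'b].
Qed.

Lemma pullback_potential F (f : T -> U) phi : {within A, continuous f} ->
  (forall a, A a -> B (f a)) -> (forall a, A a -> g (f a) = a) ->
  potential_on B (pullback_torsor g F) phi -> potential_on A F (phi \o f).
Proof.
move=> cf AB fK pphi c Fc a [Aa ca].
have /pphi lphi : pullback_torsor g F (g @^-1` c.1, c.2 \o g) by exists c.
have cgf : {within A `&` c.1, continuous f} by apply: continuous_subspaceW cf => b [].
have maps b : (A `&` c.1) b -> (B `&` g @^-1` c.1) (f b).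
  by move=> [Ab cb]; split; [exact: AB|rewrite /= fK].
apply: filterS (locally_constant_comp cgf maps lphi (conj Aa ca)) => b phib [Ab cb].
by move: (phib (conj Ab cb)); rewrite /= !fK.
Qed.

End Pullback.

(** * Convex sets carry no nontrivial torsor *)

Section ConvexSets.
Variables (R : realType) (V : normedModType R).
Implicit Types (A : set V) (a b c : V).

Lemma convex_setP A : convex_set (A : set (convex_lmodType V)) <->
  (forall a b (t : R), A a -> A b -> 0 <= t <= 1 -> A ((1 - t) *: a + t *: b)).
Proof.
split=> cA a b t => [Aa Ab /andP[t0 t1]|].
  have := cA b a (Itv01 t0 t1); rewrite !inE => /(_ Ab Aa).
  by rewrite addrC.
rewrite !inE => Aa Ab; have := cA b a t%:num Ab Aa; rewrite addrC.
by apply; rewrite ge0 le1.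
Qed.

Lemma subr_convex_combination a b c (t : R) :
  c - ((1 - t) *: a + t *: b) = (1 - t) *: (c - a) + t *: (c - b).
Proof. by rewrite !scalerBr addrACA -scalerDl subrK scale1r opprD. Qed.

Definition line_segment a b : set V := [set (1 - t) *: a + t *: b | t in `[0, 1] : set R].

Lemma line_segmentl a b : line_segment a b a.
Proof. by exists 0; rewrite /= ?in_itv/= ?lexx ?ler01// subr0 scale1r scale0r addr0. Qed.

Lemma line_segmentr a b : line_segment a b b.
Proof. by exists 1; rewrite /= ?in_itv/= ?lexx ?ler01// subrr scale0r scale1r add0r. Qed.

Lemma line_segment_connected a b : connected (line_segment a b).
Proof.
apply: connected_continuous_connected; first exact: segment_connected.
apply: continuous_subspaceT => t; apply: cvgD; apply: cvgZr_tmp; last exact: cvg_id.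
by apply: cvgB; [exact: cvg_cst|exact: cvg_id].
Qed.

Lemma convex_line_segment A a b :
  convex_set (A : set (convex_lmodType V)) -> A a -> A b -> line_segment a b `<=` A.
Proof.
by move=> /convex_setP cA Aa Ab _ [t /= t01 <-]; apply: cA; rewrite in_itv in t01.
Qed.

Lemma convex_connected A : convex_set (A : set (convex_lmodType V)) -> connected A.
Proof.
move=> cA; apply: locally_constant_connected => f lf x y Ax Ay.
apply: (connected_locally_constant (@line_segment_connected x y)).
- exact: locally_constantS (convex_line_segment cA Ax Ay) lf.
- exact: line_segmentl.
- exact: line_segmentr.
Qed.

Lemma convex_setI_ball A c (r : R) : convex_set (A : set (convex_lmodType V)) ->
  convex_set (A `&` ball c r : set (convex_lmodType V)).
Proof.
move=> /convex_setP cA; apply/convex_setP => a b t [Aa ca] [Ab cb] t01.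
split; first exact: cA.
move: ca cb t01; rewrite -ball_normE /= => ca cb /andP[t0 t1].
rewrite subr_convex_combination (le_lt_trans (ler_normD _ _))// !normrZ !ger0_norm ?subr_ge0//.
have [->|tn0] := eqVneq t 0; first by rewrite subr0 mul1r mul0r addr0.
have -> : r = (1 - t) * r + t * r by rewrite -mulrDl subrK mul1r.
rewrite ler_ltD//.
  by rewrite ler_wpM2l ?subr_ge0// ltW.
by rewrite ltr_pM2l// lt_neqAle eq_sym tn0.
Qed.

Lemma lebesgue_number A (F : set (set V)) : compact A ->
  (forall a, A a -> exists2 N, F N & \forall b \near a, A b -> N b) ->
  exists2 r : R, 0 < r & forall a, A a -> exists2 N, F N & A `&` ball a r `<=` N.
Proof.
move=> cA cov; pose good (r : R) a := exists2 N, F N & A `&` ball a r `<=` N.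
have := (compact_near_coveringP A).1 cA R 0^'+ good _.
have /[swap]/[apply] : forall x : V, A x -> \forall x' \near x & r \near 0^'+, good r x'.
  move=> a Aa; have [N FN /nbhs_ballP[r /= r0 arN]] := cov a Aa.
  exists (ball a (r / 2), [set e | e < r / 2]) => /=.
    split; first by apply: nbhsx_ballx; rewrite divr_gt0.
    by apply: nbhs_right_lt; rewrite divr_gt0.
  move=> [a' e] /= [aa' er]; exists N => // b [Ab a'b]; apply: arN => //.
  by rewrite [r]splitr; apply: ball_triangle aa' _; exact: le_ball (ltW er) _ a'b.
move=> near_good.
have [r [goodA r0]] := @filter_ex _ _ (at_right_proper_filter (0 : R)) _
  (filterI near_good (nbhs_right_gt 0)).
by exists r.
Qed.

Lemma convex_subdivision A o (e : R) : convex_set (A : set (convex_lmodType V)) ->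
  bounded_set A -> A o -> 0 < e -> exists n (node : V -> nat -> V),
    [/\ forall a, node a 0%N = o /\ node a n = a,
        forall a k, A a -> (k <= n)%N -> A (node a k),
        forall a k, A a -> `|node a k - node a k.+1| < e &
        forall a b k, (k <= n)%N -> `|node a k - node b k| <= `|a - b|].
Proof.
move=> /convex_setP cA [M [_ bdA]] Ao e0.
have [D D0 bdD] : exists2 D : R, 0 < D & forall a, A a -> `|a - o| <= D.
  exists (`|M| + 1 + `|o|) => [|a Aa]; first by rewrite ltr_wpDr// ltr_pwDr.
  rewrite (le_trans (ler_normB _ _))// lerD2r; apply: bdA => //.
  by rewrite (le_lt_trans (ler_norm _))// ltrDl.
pose n := (Num.bound (D / e)).+1.
have n0 : 0 < n%:R :> R by rewrite ltr0n.
have De : D / n%:R < e.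
  rewrite ltr_pdivrMr// mulrC -ltr_pdivrMr//.
  have /archi_boundP De : 0 <= D / e by rewrite divr_ge0// ltW.
  by rewrite (lt_le_trans De)// ler_nat.
pose step k : R := k%:R / n%:R.
have step01 k : (k <= n)%N -> 0 <= step k <= 1.
  by move=> kn; rewrite divr_ge0//= ler_pdivrMr// mul1r ler_nat.
exists n, (fun a k => (1 - step k) *: o + step k *: a); split.
- move=> a; rewrite /step mul0r subr0 scale1r !scale0r addr0 divff ?gt_eqF//.
  by rewrite subrr scale0r add0r scale1r.
- by move=> a k Aa /step01; exact: cA.
- move=> a k Aa.
  have -> : (1 - step k) *: o + step k *: a - ((1 - step k.+1) *: o + step k.+1 *: a) =
      n%:R^-1 *: (o - a).
    have -> : step k.+1 = step k + n%:R^-1 by rewrite /step -natr1 mulrDl mul1r.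
    rewrite opprD addrACA -!scalerBl scalerBr -scaleNr.
    by congr (_ *: _ + _ *: _); lra.
  rewrite normrZ gtr0_norm ?invr_gt0// distrC mulrC (le_lt_trans _ De)//.
  by rewrite ler_pM2r ?invr_gt0 ?bdD.
- move=> a b k /step01/andP[k0 k1].
  by rewrite opprD addrACA subrr add0r -scalerBr normrZ ger0_norm// ler_piMl.
Qed.

(* phi is the sum of rho along a subdivided segment from a base point; the ladder between
   the subdivisions for two close endpoints is crossed with the cocycle relation. *)
Lemma convex_cocycle_coboundary A (rho : V -> V -> bool) (l : R) :
  convex_set (A : set (convex_lmodType V)) -> bounded_set A -> 0 < l ->
  (forall a b c, A a -> A b -> A c -> `|a - b| < l -> `|a - c| < l -> `|b - c| < l ->
     rho a b (+) rho b c = rho a c) ->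
  exists phi : V -> bool, forall a b, A a -> A b -> `|a - b| < l / 2 ->
    phi a (+) phi b = rho a b.
Proof.
move=> cA bdA l0 cocycle.
have [[a0 Aa0]|A0] := pselect (A !=set0); last by exists xpredT => a b Aa; case: A0; exists a.
have l20 : 0 < l / 2 by rewrite divr_gt0.
have [n [node [node_ends Anode nodeS node_dist]]] := convex_subdivision cA bdA Aa0 l20.
have rho_refl a : A a -> rho a a = false.
  by move=> Aa; have := cocycle a a a Aa Aa Aa; rewrite subrr normr0 addbb => /(_ l0 l0 l0) <-.
exists (fun a => \big[addb/false]_(k < n) rho (node a k) (node a k.+1)) => a b Aa Ab ab.
have ladder k : (k <= n)%N ->
    \big[addb/false]_(i < k) rho (node a i) (node a i.+1) (+)
    \big[addb/false]_(i < k) rho (node b i) (node b i.+1) = rho (node a k) (node b k).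
  elim: k => [_|k IH kn].
    by have [-> _] := node_ends a; have [-> _] := node_ends b; rewrite !big_ord0 rho_refl.
  have kn' := ltnW kn; rewrite !big_ord_recr/= addbACA IH//.
  have rung i : (i <= n)%N -> `|node a i - node b i| < l.
    by move=> /(node_dist a b) abi; rewrite (le_lt_trans abi)// (lt_trans ab)//; lra.
  have edge c : A c -> `|node c k - node c k.+1| < l.
    by move=> Ac; rewrite (lt_trans (nodeS _ _ Ac))//; lra.
  have diag : `|node a k - node b k.+1| < l.
    rewrite (le_lt_trans (ler_distD (node a k.+1) _ _))// [ltRHS]splitr.
    by rewrite ltrD ?nodeS// (le_lt_trans (node_dist _ _ _ kn)).
  have := cocycle _ _ _ (Anode _ _ Aa kn') (Anode _ _ Ab kn') (Anode _ _ Ab kn)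
    (rung _ kn') diag (edge _ Ab).
  rewrite -(cocycle _ _ _ (Anode _ _ Aa kn') (Anode _ _ Aa kn) (Anode _ _ Ab kn)
    (edge _ Aa) diag (rung _ kn)) => upper.
  by rewrite addbCA upper addbA addbb addFb.
by rewrite ladder//; have [_ ->] := node_ends a; have [_ ->] := node_ends b.
Qed.

Lemma convex_torsor_potential A F : compact A ->
  convex_set (A : set (convex_lmodType V)) -> torsor_on A F ->
  exists phi, potential_on A F phi.
Proof.
move=> kA cA torF.
have [|l l0 lF] := @lebesgue_number A (fst @` F) kA.
  move=> a Aa; have [c Fc ca] := torsor_cover torF Aa.
  by exists c.1; [exists c|exact: (torsor_open torF Fc Aa ca)].
have /choice[ch chP] a : exists c : set V * (V -> bool), A a -> F c /\ A `&` ball a l `<=` c.1.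
  have [Aa|nAa] := pselect (A a); last by exists (set0, xpredT).
  by have [_ [c Fc <-] cl] := lF a Aa; exists c.
pose rho a b := (ch a).2 a (+) (ch a).2 b.
have [||phi phiP] := @convex_cocycle_coboundary A rho l cA _ l0.
- exact: compact_bounded.
- move=> a b c Aa Ab Ac ab ac bc.
  have [Fa cha] := chP a Aa; have [Fb chb] := chP b Ab.
  have : (ch a).2 b (+) (ch b).2 b = (ch a).2 c (+) (ch b).2 c.
    have conv := convex_setI_ball (c := b) (r := l) (convex_setI_ball (c := a) (r := l) cA).
    apply: (connected_locally_constant (convex_connected conv)
      (f := fun z => (ch a).2 z (+) (ch b).2 z)).
    - apply: locally_constantS (torsor_compat torF Fa Fb) => z [[Az az] bz].
      by split; [split => //; exact: cha|exact: chb].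
    - by rewrite -ball_normE /=; split; [split|rewrite /= subrr normr0].
    - by rewrite -ball_normE.
  rewrite /rho; move: ((ch a).2 a) ((ch a).2 b) ((ch b).2 b) ((ch a).2 c) ((ch b).2 c).
  by do 5!case.
exists phi => c Fc a [Aa ca]; have [Fa cha] := chP a Aa.
have caa : (ch a).1 a by apply: cha; split => //; exact: ballxx.
have a_near_a : \forall b \near a, `|a - b| < l / 2.
  by apply: cvgr_dist_lt; rewrite ?divr_gt0//; exact: cvg_id.
have := torsor_compat torF Fc Fa (conj (conj Aa ca) caa).
apply: filterS3 a_near_a (torsor_open torF Fa Aa caa) => b ab cab compat [Ab cb].
move: (phiP a b Aa Ab ab) (compat (conj (conj Ab cb) (cab Ab))); rewrite /rho.
move: (phi a) (phi b) ((ch a).2 a) ((ch a).2 b) (c.2 a) (c.2 b).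
by do 6!case.
Qed.

End ConvexSets.

(** * Charts and finiteness *)

Section Charts.
Variables (R : realType) (S : topologicalType).

Definition half_disc (c : R * R) (r : R) : set (R * R) :=
  @half_plane R `&` [set p | `|c - p| <= r].

Lemma half_disc_center c r : @half_plane R c -> 0 <= r -> half_disc c r c.
Proof. by move=> c0 r0; split => //=; rewrite subrr normr0. Qed.

Lemma half_discS c r s : r <= s -> half_disc c r `<=` half_disc c s.
Proof. by move=> rs p [p0 /= pr]; split => //=; rewrite (le_trans pr). Qed.

Lemma half_plane_convex : convex_set (@half_plane R : set (convex_lmodType (R * R)%type)).
Proof.
apply/convex_setP => a b t /= a0 b0 /andP[t0 t1].
by rewrite /half_plane /= addr_ge0// mulr_ge0// subr_ge0.
Qed.

Lemma half_disc_convex c r : convex_set (half_disc c r : set (convex_lmodType (R * R)%type)).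
Proof.
apply/convex_setP => a b t [a0 /= ar] [b0 /= br] t01.
split; first by have /convex_setP := half_plane_convex; apply.
move: t01 => /andP[t0 t1] /=.
rewrite subr_convex_combination (le_trans (ler_normD _ _))// !normrZ !ger0_norm ?subr_ge0//.
have -> : r = (1 - t) * r + t * r by rewrite -mulrDl subrK mul1r.
by rewrite lerD// ler_wpM2l// subr_ge0.
Qed.

Lemma normB_pair_le (c p : R * R) (r : R) :
  (`|c - p| <= r) = (`|c.1 - p.1| <= r) && (`|c.2 - p.2| <= r).
Proof. by rewrite /Num.norm/= ge_max. Qed.

Lemma half_disc_compact c r : compact (half_disc c r).
Proof.
have -> : half_disc c r = (`[c.1 - r, c.1 + r] `*` `[c.2 - r, c.2 + r]) `&` @half_plane R.
  rewrite /half_disc setIC; congr (_ `&` _); apply/seteqP.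
  by split=> p; rewrite /= normB_pair_le !ler_distlC !in_itv/= => /andP.
apply: compact_closedI; first by apply: compact_setX; exact: segment_compact.
apply: (@preimage_closed _ _ (snd : R * R -> R) [set x | 0 <= x]); last exact: closed_ge.
by move=> p _; exact: cvg_snd.
Qed.

Definition chart_disc (g : R * R -> S) (c : R * R) (r : R) : set S :=
  g @` (@half_plane R `&` ball c r).

Record disc_chart (x : S) (f : S -> R * R) (g : R * R -> S) (r : R) : Prop := DiscChart {
  chart_radius_gt0 : 0 < r;
  chart_center_half_plane : @half_plane R (f x);
  chart_centerK : g (f x) = x;
  chartK : forall p, half_disc (f x) r p -> f (g p) = p;
  chart_inv_continuous : {within half_disc (f x) r, continuous g};
  chart_disc_open : forall r', r' <= r -> open (chart_disc g (f x) r');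
  chart_continuous : forall y, chart_disc g (f x) r y -> f @ y --> f y }.

Lemma disc_chart_exists (x : S) : has_chart R x -> exists f g r, disc_chart x f g r.
Proof.
move=> [U [W [f [g [[oU Ux oW fUW gWU] [gK fK cf cg]]]]]].
have [Wfx fx0] : (W `&` @half_plane R) (f x) by apply: fUW; exists x.
have /nbhs_ballP[r' /= r'0 r'W] : nbhs (f x) W by exact: open_nbhs_nbhs.
pose r := r' / 2; have r0 : 0 < r by rewrite divr_gt0.
have discW : half_disc (f x) r `<=` W `&` @half_plane R.
  move=> p [p0 /= pr]; split => //; apply: r'W; rewrite -ball_normE /=.
  by rewrite (le_lt_trans pr)// /r; lra.
have ball_disc s p : s <= r -> (@half_plane R `&` ball (f x) s) p -> half_disc (f x) r p.
  by move=> sr [p0]; rewrite -ball_normE => /= ps; split => //=; rewrite ltW// (lt_le_trans ps).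
have discU s y : s <= r -> chart_disc g (f x) s y -> U y.
  by move=> sr [p /(ball_disc _ _ sr)/discW Wp <-]; apply: gWU; exists p.
have cfU y : U y -> f @ y --> f y.
  move=> Uy N Ny; have /subspace_continuousP cf' := cf.
  by apply: filterS2 (open_nbhs_nbhs (conj oU Uy)) (cf' y Uy N Ny) => z Uz; exact.
exists f, g, r; split => //.
- exact: gK.
- by move=> p /discW; exact: fK.
- by apply: continuous_subspaceW cg; exact: discW.
- move=> s sr; rewrite openE => y sy; have Uy := discU _ _ sr sy.
  have : nbhs (f y) (ball (f x) s).
    have [p [p0 ps] <-] := sy; rewrite fK; last exact/discW/(ball_disc s).
    exact: open_nbhs_nbhs (conj (ball_open _ _) ps).
  move=> /(cfU _ Uy); apply: filterS2 (open_nbhs_nbhs (conj oU Uy)) => z Uz fz.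
  exists (f z); last exact: gK.
  by split => //; have [] : (W `&` @half_plane R) (f z) by apply: fUW; exists z.
- by move=> y /discU Uy; exact/cfU/Uy.
Qed.

Variables (x : S) (f : S -> R * R) (g : R * R -> S) (r : R).
Hypothesis dc : disc_chart x f g r.

Lemma chart_disc_in y r' : r' <= r -> chart_disc g (f x) r' y ->
  g (f y) = y /\ (half_disc (f x) r `&` ball (f x) r') (f y).
Proof.
move=> rr [p [p0 pr] <-].
have discp : half_disc (f x) r p.
  by split => //; move: pr; rewrite -ball_normE /= => pr; rewrite ltW// (lt_le_trans pr).
by rewrite (chartK dc discp).
Qed.

Lemma chart_disc_inj y z : chart_disc g (f x) r y -> chart_disc g (f x) r z ->
  f y = f z -> y = z.
Proof.
by move=> /(chart_disc_in (lexx r))[fy _] /(chart_disc_in (lexx r))[fz _] E; rewrite -fy E.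
Qed.

Lemma chart_disc_center r' : 0 < r' -> chart_disc g (f x) r' x.
Proof.
move=> r0; exists (f x); last exact: (chart_centerK dc).
by split; [exact: (chart_center_half_plane dc)|exact: ballxx].
Qed.

Lemma chart_disc_connected r' : r' <= r -> connected (chart_disc g (f x) r').
Proof.
move=> rr; apply: connected_continuous_connected.
  by apply: convex_connected; apply: convex_setI_ball; exact: half_plane_convex.
apply: continuous_subspaceW (chart_inv_continuous dc) => p [p0].
by rewrite -ball_normE => /= pr; split => //=; rewrite ltW// (lt_le_trans pr).
Qed.

Lemma chart_disc_small N : nbhs x N ->
  exists2 r', 0 < r' <= r & g @` half_disc (f x) r' `<=` N.
Proof.
move=> Nx; have r0 := chart_radius_gt0 dc.
have discx := half_disc_center (chart_center_half_plane dc) (ltW r0).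
have /subspace_continuousP cg := chart_inv_continuous dc.
have Ngfx : nbhs (g (f x)) N by rewrite (chart_centerK dc).
have /nbhs_ballP[e /= e0 eN] : \forall p \near f x, half_disc (f x) r p -> N (g p).
  exact: cg discx N Ngfx.
pose r' := Num.min (e / 2) r.
have [r'0 r'r r'e] : [/\ 0 < r', r' <= r & r' < e].
  by rewrite /r' lt_min !ge_min gt_min lexx r0 divr_gt0// ?orbT; split => //; apply/orP; left; lra.
exists r'; first by rewrite r'0.
move=> _ [p discp <-]; apply: eN; last exact: half_discS discp.
by rewrite -ball_normE /=; case: discp => _ /= pr; exact: le_lt_trans pr r'e.
Qed.

Lemma chart_disc_subset r' : chart_disc g (f x) r' `<=` g @` half_disc (f x) r'.
Proof.
move=> _ [p [p0 pr] <-]; exists p => //; split => //=.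
by move: pr; rewrite -ball_normE /= => /ltW.
Qed.

Lemma closure_chart_disc r' : hausdorff_space S -> r' < r ->
  closure (chart_disc g (f x) r') `<=` chart_disc g (f x) r.
Proof.
move=> hT r'r; have gK : closed (g @` half_disc (f x) r').
  apply: compact_closed => //; apply: continuous_compact; last exact: half_disc_compact.
  by apply: continuous_subspaceW (chart_inv_continuous dc); exact/half_discS/ltW.
apply: subset_trans (_ : g @` half_disc (f x) r' `<=` _).
  by rewrite [X in _ `<=` X](closure_id _).1//; exact/closureS/chart_disc_subset.
move=> _ [p [p0 pr] <-]; exists p => //; split => //.
by rewrite -ball_normE /=; exact: le_lt_trans pr r'r.
Qed.

Lemma chart_disc_potential F : torsor_on setT F ->
  exists phi, potential_on (chart_disc g (f x) r) F phi.
Proof.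
move=> torF; have cg := chart_inv_continuous dc.
have [phi pphi] := convex_torsor_potential (@half_disc_compact (f x) r)
  (@half_disc_convex (f x) r) (pullback_torsor_on cg (fun _ _ => Logic.I) torF).
exists (phi \o f); apply: pullback_potential pphi.
- by apply: continuous_in_subspaceT => y /set_mem; exact: (chart_continuous dc).
- by move=> y /(chart_disc_in (lexx r))[_ []].
- by move=> y /(chart_disc_in (lexx r))[].
Qed.

End Charts.

Lemma finite_subcover (T : topologicalType) (N : T -> set T) :
  compact [set: T] -> (forall x, nbhs x (N x)) ->
  exists s : seq T, forall x, exists y : seq_sub s, N (val y) x.
Proof.
move=> /compact_near_coveringP covT Nx.
pose F : set_system (seq T) :=
  filter_from [set: seq T] (fun s => [set s' | {subset s <= s'}]).
have FF : Filter F.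
  apply: filter_from_filter; first by exists nil.
  move=> s s' _ _; exists (s ++ s') => // s'' /= sub.
  by split => x xs; apply: sub; rewrite mem_cat xs ?orbT.
have [] := covT _ F (fun s x => exists y : seq_sub s, N (val y) x) FF.
  move=> x _; exists (N x, [set s | {subset [:: x] <= s}]).
    by split => //=; exists [:: x].
  move=> [x' s] /= [Nx' xs].
  by have s_x : x \in s by [apply: xs; rewrite inE]; exists (SeqSub s_x).
by move=> s _ /(_ s (fun _ => id)) covs; exists s => x; exact: covs.
Qed.

Lemma nat_finType_collision (T : finType) (h : nat -> T) :
  exists k l, (k < l)%N /\ h k = h l.
Proof.
have : ~ injective (fun i : 'I_#|T|.+1 => h i).
  by move=> /leq_card; rewrite card_ord ltnn.
move=> /existsNP[i /existsNP[j /not_implyP[hij ij]]].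
have [lij|lji|/val_inj//] := ltngtP i j; first by exists i, j.
by exists j, i.
Qed.

Section CompactSurfaces.
Variables (R : realType) (S : topologicalType).
Hypotheses (hS : surface R S) (hcpt : compact [set: S]).

Lemma surface_locally_connected (x : S) N : nbhs x N ->
  exists C, [/\ open C, C x, connected C & C `<=` N].
Proof.
move=> Nx; have [f [g [r dc]]] := disc_chart_exists (hS.2 x).
have [r' /andP[r'0 rr] r'N] := chart_disc_small dc Nx.
exists (chart_disc g (f x) r'); split.
- exact: (chart_disc_open dc).
- exact: (chart_disc_center dc).
- exact: (chart_disc_connected dc).
- exact: subset_trans (@chart_disc_subset _ _ _ _ _ _) r'N.
Qed.

Lemma connected_nbhd_shrinking (I : finType) (D D' : I -> set S) (y : S) :
  (forall a, open (D a)) -> (forall a, closure (D' a) `<=` D a) ->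
  exists Q, [/\ open Q, Q y, connected Q & forall a, Q `<=` D a \/ Q `&` D' a = set0].
Proof.
move=> oD clD'; have : \forall z \near y, forall a,
    (D a y -> D a z) /\ (~ closure (D' a) y -> ~ D' a z).
  apply: filter_forall => a; apply: filterI.
    have [Dy|nDy] := pselect (D a y); last exact: nearW.
    by apply: filterS (open_nbhs_nbhs (conj (oD _) Dy)) => z Dz.
  have [cy|ncy] := pselect (closure (D' a) y); first exact: nearW.
  have oC : open (~` closure (D' a)) by exact/closed_openC/closed_closure.
  apply: filterS (open_nbhs_nbhs (conj oC ncy)) => z nz _ D'z.
  by apply: nz; exact: subset_closure.
move=> /surface_locally_connected[Q [oQ Qy cQ QN]].
exists Q; split => // a; have [Dy|nDy] := pselect (D a y).
  by left => z /QN/(_ a)[/(_ Dy)].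
right; apply/seteqP; split => // z [/QN/(_ a)[_ far] D'z].
by apply: far => // /clD'.
Qed.

(* The D's carry no nontrivial torsor, and i z is the index of one of them that contains
   every Q containing z. *)
Lemma surface_star_refinement : exists (I J : finType) (D : I -> set S)
    (Q : J -> set S) (pt : J -> S) (i : S -> I),
  [/\ forall a F, torsor_on setT F -> exists phi, potential_on (D a) F phi,
      forall b, [/\ open (Q b), Q b (pt b) & connected (Q b)],
      forall z, exists b, Q b z &
      forall b z, Q b z -> Q b `<=` D (i z)].
Proof.
have /choice[f /choice[g /choice[r dc]]] :
    forall x : S, exists f g r, disc_chart x f g (r : R).
  by move=> x; exact: disc_chart_exists (hS.2 x).
pose D x := chart_disc (g x) (f x x) (r x).
pose D' x := chart_disc (g x) (f x x) (r x / 2).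
have [r20 r2r] : (forall x, 0 < r x / 2) /\ (forall x, r x / 2 < r x).
  by split=> x; have := chart_radius_gt0 (dc x); lra.
have oD x : open (D x) by exact: (chart_disc_open (dc x)).
have nD' x : nbhs x (D' x).
  apply: open_nbhs_nbhs; split; last exact: (chart_disc_center (dc x)).
  by apply: (chart_disc_open (dc x)); exact: ltW.
have clD' x : closure (D' x) `<=` D x by exact: (closure_chart_disc (dc x) hS.1).
have [s cov_s] := finite_subcover hcpt nD'.
have /choice[Q QP] y : exists Q, [/\ open Q, Q y, connected Q &
    forall a : seq_sub s, Q `<=` D (val a) \/ Q `&` D' (val a) = set0] :=
  connected_nbhd_shrinking y (fun a => oD (val a)) (fun a => clD' (val a)).
have [t cov_t] := finite_subcover hcpt (N := Q) (fun y =>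
  let: And4 oQ Qy _ _ := QP y in open_nbhs_nbhs (conj oQ Qy)).
have [i iP] := choice cov_s.
exists (seq_sub s), (seq_sub t), (D \o val), (Q \o val), val, i; split.
- by move=> a F torF; exact: (chart_disc_potential (dc _)).
- by move=> b; have [] := QP (val b).
- exact: cov_t.
- move=> b z Qz; have [_ _ _ /(_ (i z))[//|Q0]] := QP (val b).
  by have : (Q (val b) `&` D' (val (i z))) z by []; rewrite Q0.
Qed.

(* This is finiteness of H^1(S; Z/2). *)
Lemma torsor_finiteness (F : nat -> set (set S * (S -> bool))) :
  (forall n, torsor_on setT (F n)) ->
  exists k l, (k < l)%N /\ exists Phi, torsor_isomorphism (F k) (F l) Phi.
Proof.
move=> torF; have [I [J [D [Q [pt [i [potD Qtop covQ QD]]]]]]] := surface_star_refinement.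
have /choice[phi phiP] (na : nat * I) : exists phi, potential_on (D na.2) (F na.1) phi.
  exact: potD.
have diff_const n b z z' : Q b z -> Q b z' -> forall w, Q b w ->
    phi (n, i z) w (+) phi (n, i z') w = phi (n, i z) (pt b) (+) phi (n, i z') (pt b).
  move=> Qz Qz' w Qw; have [_ Qo cQ] := Qtop b.
  apply: (connected_locally_constant cQ
    (f := fun w => phi (n, i z) w (+) phi (n, i z') w)) => //.
  apply: (potential_on_unique (F := F n)); first exact: torsor_onS (torF n).
    exact: potential_onS (QD b z Qz) (phiP (n, i z)).
  exact: potential_onS (QD b z' Qz') (phiP (n, i z')).
have [k [l [kl holonomy]]] := nat_finType_collision (fun n =>
  [ffun u : J * (I * I) => phi (n, u.2.1) (pt u.1) (+) phi (n, u.2.2) (pt u.1)]).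
exists k, l; split => //; exists (fun z => phi (k, i z) z (+) phi (l, i z) z).
have PhiE b a z : Q b a -> Q b z ->
    phi (k, i z) z (+) phi (l, i z) z = phi (k, i a) z (+) phi (l, i a) z.
  move=> Qa Qz; have /ffunP/(_ (b, (i z, i a))) := holonomy.
  rewrite !ffunE /= -!(diff_const _ _ _ _ Qz Qa _ Qz).
  by move: (phi _ z) (phi _ z) (phi _ z) (phi _ z); do 4!case.
move=> c c' Fc Fc' a [ca c'a]; have [b Qa] := covQ a.
have [oQ _ _] := Qtop b; have Da := QD b a Qa a Qa.
have lk := phiP (k, i a) c Fc _ (conj Da ca).
have ll := phiP (l, i a) c' Fc' _ (conj Da c'a).
apply: filterS3 (open_nbhs_nbhs (conj oQ Qa)) lk ll => z Qz lk ll [cz c'z].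
have Dz := QD b a Qa z Qz.
rewrite (PhiE b a z)// -addbA addbACA (lk (conj Dz cz)) (ll (conj Dz c'z)).
by rewrite addbACA addbA.
Qed.

End CompactSurfaces.

(** * Flows and recurrence *)

Lemma compact_near_forall (T X : topologicalType) (K : set T) (x : X) (P : T -> X -> Prop) :
  compact K -> (forall t, K t -> \forall s \near t & y \near x, P s y) ->
  \forall y \near x, forall t, K t -> P t y.
Proof.
move=> /compact_near_coveringP covK nearP.
have near_all := covK X (nbhs x) (fun y t => P t y) (nbhs_filter x) nearP.
by apply: filterS near_all => y Py t; exact: Py.
Qed.

Lemma hausdorff_separation (T : topologicalType) (a b : T) : hausdorff_space T -> a <> b ->
  exists A B : set T, [/\ nbhs a A, nbhs b B & A `&` B = set0].
Proof.
rewrite open_hausdorff => sep /eqP/sep[[A B] [/set_mem Aa /set_mem Bb] [oA oB /eqP AB0]].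
by exists A, B; split => //; exact: open_nbhs_nbhs.
Qed.

Lemma hausdorff_near_neq (T : topologicalType) (a b : T) :
  hausdorff_space T -> a <> b -> \forall c \near a, c <> b.
Proof.
move=> hT ab; have [A [B [Aa Bb AB]]] := hausdorff_separation hT ab.
apply: filterS Aa => c Ac cb; have : (A `&` B) c by split => //; rewrite cb; exact: nbhs_singleton.
by rewrite AB.
Qed.

Section FlowBasics.
Variables (R : realType) (S : topologicalType) (v : R -> S -> S).
Hypothesis hv : flow v.
Implicit Types (x y : S) (s t T : R) (N : set S).

Lemma flow0 x : v 0 x = x. Proof. by case: hv. Qed.

Lemma flowD s t x : v (s + t) x = v s (v t x). Proof. by case: hv. Qed.

Lemma flowC s t x : v s (v t x) = v t (v s x). Proof. by rewrite -!flowD addrC. Qed.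

Lemma flowK t x : v (- t) (v t x) = x. Proof. by rewrite -flowD addNr flow0. Qed.

Lemma flowNK t x : v t (v (- t) x) = x. Proof. by rewrite -flowD subrr flow0. Qed.

Lemma flow_eqB s t x y : v s x = v t y -> v (s - t) x = y.
Proof. by move=> E; rewrite addrC flowD E flowK. Qed.

Lemma flow_near2 t x N : nbhs (v t x) N -> \forall s \near t & y \near x, N (v s y).
Proof.
have [cv _ _] := hv => /(cv (t, x))[[A B] /= [At Bx] ABN].
by exists (A, B).
Qed.

Lemma flow_near_small_time x N : nbhs x N ->
  exists2 e, 0 < e & \forall y \near x, forall t, `|t| <= e -> N (v t y).
Proof.
rewrite -{1}(flow0 x) => /flow_near2[[A B] /= [/nbhs_ballP[r /= r0 ballA] Bx] ABN].
exists (r / 2); first by rewrite divr_gt0.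
apply: filterS Bx => y By t te; apply: (ABN (t, y)); split => //.
by apply: ballA; rewrite -ball_normE /= sub0r normrN; move: te r0; lra.
Qed.

Lemma flow_near t x N : nbhs (v t x) N -> \forall y \near x, N (v t y).
Proof.
move=> /flow_near2[[A B] /= [At Bx] ABN]; apply: filterS Bx => y By.
by apply: (ABN (t, y)); split => //; exact: nbhs_singleton.
Qed.

Lemma flow_continuous t : continuous (v t).
Proof. by move=> x N; exact: flow_near. Qed.

Lemma flow_near_time t x N : nbhs (v t x) N -> \forall s \near t, N (v s x).
Proof.
move=> /flow_near2[[A B] /= [At Bx] ABN]; apply: filterS At => s As.
by apply: (ABN (s, x)); split => //; exact: nbhs_singleton.
Qed.

Lemma orbit_map_continuous x : continuous (v^~ x).
Proof. by move=> t N; exact: flow_near_time. Qed.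

Lemma orbit_image_compact x (K : set R) : compact K -> compact [set v t x | t in K].
Proof.
move=> cK; apply: continuous_compact => //.
by apply: continuous_subspaceT; exact: orbit_map_continuous.
Qed.

Lemma orbit_image_closed x (K : set R) : hausdorff_space S -> compact K ->
  closed [set v t x | t in K].
Proof. by move=> hT cK; apply: compact_closed => //; exact: orbit_image_compact. Qed.

Lemma flow_image_nbhs t x N : nbhs x N -> nbhs (v t x) [set y | N (v (- t) y)].
Proof. by rewrite -{1}(flowK t x) => /flow_near. Qed.

Lemma open_flow_image t U : open U -> open [set v t y | y in U].
Proof.
move=> oU; rewrite openE => _ [y Uy <-].
apply: filterS (flow_image_nbhs t (open_nbhs_nbhs (conj oU Uy))) => z Uz.
by exists (v (- t) z) => //; rewrite flowNK.
Qed.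

Lemma flow_rev : flow (fun t => v (- t)).
Proof.
split=> [[t x] N /= /flow_near2[[A B] /= [At Bx] ABN]|x|s t x].
- exists ([set s | A (- s)], B) => /=.
    by split => //; have /(_ _ At) := @opp_continuous R t.
  by move=> [s y] /= [As By]; exact: (ABN (- s, y)).
- by rewrite oppr0 flow0.
- by rewrite opprD flowD.
Qed.

Lemma orbit_refl x : orbit v x x.
Proof. by exists 0 => //; rewrite flow0. Qed.

Lemma orbit_flow x y t : orbit v x y -> orbit v x (v t y).
Proof. by move=> [s _ <-]; exists (t + s) => //; rewrite flowD. Qed.

Lemma orbit_eq x y : orbit v x y -> orbit v x = orbit v y.
Proof.
move=> [t _ <-]; apply/seteqP; split => _ [s _ <-].
  by exists (s - t) => //; rewrite -flowD subrK.
by exists (s + t) => //; rewrite flowD.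
Qed.

Lemma orbit_connected x : connected (orbit v x).
Proof.
apply: connected_continuous_connected; first exact/connected_intervalP.
by apply: continuous_subspaceT; exact: orbit_map_continuous.
Qed.

Lemma orbit_closure_refl x : closure (orbit v x) x.
Proof. by apply: subset_closure; exact: orbit_refl. Qed.

Lemma orbit_closure_flow x y t : closure (orbit v x) y -> closure (orbit v x) (v t y).
Proof.
move=> cy N /flow_near/cy[z [oz Nz]].
by exists (v t z); split => //; exact: orbit_flow.
Qed.

Lemma orbit_closureN_flow x y t : ~ closure (orbit v x) y -> ~ closure (orbit v x) (v t y).
Proof. by move=> ny /(@orbit_closure_flow _ _ (- t)); rewrite flowK. Qed.

Lemma orbit_closure_sub x y :
  closure (orbit v x) y -> closure (orbit v y) `<=` closure (orbit v x).
Proof.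
move=> cy; rewrite [X in _ `<=` X](closure_id _).1; last exact: closed_closure.
by apply: closureS => _ [t _ <-]; exact: orbit_closure_flow.
Qed.

Lemma orbit_closure_interior x : interior (closure (orbit v x)) !=set0 ->
  interior (closure (orbit v x)) x.
Proof.
move=> [y iy]; have [_ [[t _ <-] it]] := interior_subset iy _ (nbhs_interior iy).
apply: filterS (flow_near it) => w cw.
by rewrite -(flowK t w); exact: orbit_closure_flow.
Qed.

Lemma nonsingular_time x : ~ singular_pt v x -> exists2 T, 0 < T & v T x <> x.
Proof.
move=> /existsNP[t vt]; have [t0|t0|t0] := ltgtP t 0.
- exists (- t); first by rewrite oppr_gt0.
  by move=> E; apply: vt; rewrite -{1}E flowNK.
- by exists t.
- by rewrite t0 flow0 in vt.
Qed.

Lemma period_closed_pt x t : t != 0 -> v t x = x -> closed_pt v x.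
Proof.
move=> t0 E; have [sx|nsx] := pselect (singular_pt v x); first by left.
right; split => //; move: t0; rewrite neq_lt => /orP[t0|t0]; last by exists t.
by exists (- t); rewrite oppr_gt0 -{1}E flowK.
Qed.

Lemma closed_pt_period x : closed_pt v x -> exists2 T, 0 < T & v T x = x.
Proof. by move=> [sx|[_ [T [T0 E]]]]; [exists 1|exists T]. Qed.

Lemma flow_natmul_period x T (k : nat) : v T x = x -> v (k%:R * T) x = x.
Proof.
move=> E; elim: k => [|k IH]; first by rewrite mul0r flow0.
by rewrite -natr1 mulrDl mul1r flowD E.
Qed.

Lemma flow_intmul_period x T (k : int) : v T x = x -> v (k%:~R * T) x = x.
Proof.
move=> E; case: k => n; first exact: flow_natmul_period.
by rewrite NegzE mulrNz mulNr -{1}(flow_natmul_period n.+1 E) flowK.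
Qed.

Lemma closed_pt_flow x t : closed_pt v x -> closed_pt v (v t x).
Proof.
move=> /closed_pt_period[T T0 E]; apply: (@period_closed_pt _ T); first by rewrite gt_eqF.
by rewrite flowC E.
Qed.

Lemma closed_orbitP x : closed_orbit v x <-> closed_pt v x.
Proof.
split; first by apply; exact: orbit_refl.
by move=> cx _ [t _ <-]; exact: closed_pt_flow.
Qed.

Lemma closed_pt_orbit_closed x : hausdorff_space S -> closed_pt v x -> closed (orbit v x).
Proof.
move=> hT /closed_pt_period[T T0 E].
have -> : orbit v x = [set v t x | t in `[0, T]].
  apply/seteqP; split => _ [t tI <-]; last by exists t.
  pose k := Num.floor (t / T); exists (t - k%:~R * T); last first.
    by rewrite -[in RHS](subrK (k%:~R * T) t) (flowD (t - _)) flow_intmul_period.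
  have := floor_le (t / T); have := floorD1_gt (t / T).
  by rewrite -/k intrD ltr_pdivrMr// ler_pdivlMr// mulrDl mul1r /= in_itv/=; lra.
by apply: orbit_image_closed => //; exact: segment_compact.
Qed.

Definition returns x : Prop :=
  forall (n : R) (U : set S), nbhs x U -> exists2 t, n < `|t| & U (v t x).

Lemma returnsPn x : ~ returns x -> exists (M : R) (U : set S),
  [/\ 0 < M, nbhs x U & forall t, M < `|t| -> ~ U (v t x)].
Proof.
move=> /existsNP[n /existsNP[U /not_implyP[Ux far]]].
exists (`|n| + 1), U; split => //.
move=> t nt Ut; apply: far; exists t => //.
by rewrite (le_lt_trans (ler_norm n))// (lt_trans _ nt)// ltrDl.
Qed.

Lemma recurrent_returns x : recurrent_pt v x <-> returns x.
Proof.
split=> [[ox|ax] n U Ux|rx].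
- have [_ [[t /= nt <-] Ut]] := ox `|n| Logic.I _ Ux.
  by exists t => //; rewrite (le_lt_trans (ler_norm n))// (lt_le_trans nt)// ler_norm.
- have [_ [[t /= nt <-] Ut]] := ax (- `|n|) Logic.I _ Ux.
  by exists t => //; have := ler_norm n; have := ler_norm (- t); rewrite normrN; lra.
apply: contrapT => /not_orP[/existsNP[m /not_implyP[_ /existsNP[U /not_implyP[Ux nU]]]]].
move=> /existsNP[n /not_implyP[_ /existsNP[V /not_implyP[Vx nV]]]].
have [t mnt [Ut Vt]] := rx (`|m| + `|n|) _ (filterI Ux Vx).
have [m0 n0] := (ler_norm m, ler_norm (- n)); rewrite normrN in n0.
have [t0|t0] := leP 0 t.
  apply: nU; exists (v t x); split => //; exists t => //=.
  by rewrite (ger0_norm t0) in mnt; have := normr_ge0 n; lra.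
apply: nV; exists (v t x); split => //; exists t => //=.
by rewrite (ltr0_norm t0) in mnt; have := normr_ge0 m; lra.
Qed.

Lemma returns_flow x s : returns x -> returns (v s x).
Proof.
move=> rx n U /flow_near/(rx n)[t nt Ut].
by exists t => //; rewrite flowC.
Qed.

Lemma closed_pt_returns x : closed_pt v x -> returns x.
Proof.
move=> /closed_pt_period[T T0 E] n U Ux.
exists ((Num.bound (`|n| / T))%:R * T).
  have /archi_boundP : 0 <= `|n| / T by rewrite divr_ge0// ltW.
  rewrite ltr_pdivrMr// => nT.
  by rewrite (le_lt_trans (ler_norm n))// (lt_le_trans nT)// ler_norm.
by rewrite flow_natmul_period//; exact: nbhs_singleton.
Qed.

Lemma not_returns_proper x : hausdorff_space S -> ~ returns x -> proper_orbit v x.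
Proof.
move=> hT nrx t0 e e0; have [M [U [M0 Ux far]]] := returnsPn nrx.
pose K : set R := `[t0 - M, t0 - e] `|` `[t0 + e, t0 + M].
have KP t : e <= `|t - t0| <= M -> K t.
  rewrite /K /= !in_itv/=; have [t0t|tt0] := leP 0 (t - t0).
    by rewrite (ger0_norm t0t) => tI; right; lra.
  by rewrite (ltr0_norm tt0) => tI; left; lra.
have clK : closed [set v t x | t in K].
  by apply: orbit_image_closed => //; apply: compactU; exact: segment_compact.
have nK : ~ [set v t x | t in K] (v t0 x).
  move=> [t Kt] /flow_eqB E; apply: nrx; apply: closed_pt_returns; apply: period_closed_pt E.
  rewrite subr_eq0; apply/eqP => tt0.
  by move: Kt; rewrite tt0 /K /= !in_itv/=; lra.
exists ([set y | U (v (- t0) y)] `&` ~` [set v t x | t in K]).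
  apply: filterI; first exact: flow_image_nbhs.
  by apply: open_nbhs_nbhs; split => //; exact: closed_openC.
move=> t [/= Ut nKt]; exists t; split => //; rewrite ltNge; apply/negP => et.
apply: nKt; exists t => //; apply: KP; rewrite et /= leNgt.
by apply/negP => /far; apply; rewrite addrC flowD.
Qed.

Lemma proper_returns_closed x : proper_orbit v x -> returns x -> closed_pt v x.
Proof.
move=> px rx; have [W Wx near0] := px 0 1 ltr01.
rewrite flow0 in Wx.
have [t t1 Wt] := rx 1 _ Wx; have [s [/esym/flow_eqB E]] := near0 t Wt; rewrite subr0 => s1.
apply: period_closed_pt E; rewrite subr_eq0; apply/eqP => ts.
by have := lt_trans t1 _; rewrite ts => /(_ _ s1); rewrite ltxx.
Qed.

Lemma not_returns_orbit_not_closed x : compact [set: S] -> ~ returns x -> ~ closed (orbit v x).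
Proof.
move=> cS nrx clo; have [M [U [M0 Ux far]]] := returnsPn nrx.
pose u (n : nat) := v n%:R x.
have [c [_ clu]] : exists c, [set: S] c /\ cluster (u @ \oo) c.
  by apply: cS; exact: filterT.
have [s _ E] : orbit v x c.
  rewrite ((closure_id _).1 clo) => N Nc; apply: clu => //.
  by exists 0%N => // n _ /=; exists n%:R.
have Nc : nbhs c [set y | U (v (- s) y)] by rewrite -E; exact: flow_image_nbhs.
pose m := Num.bound (M + `|s|).
have mP : M + `|s| < m%:R by apply: archi_boundP; rewrite addr_ge0// ltW.
have : (u @ \oo) [set y | exists2 n, (m <= n)%N & y = u n].
  by exists m => // n /= mn; exists n.
move=> /clu/(_ Nc)[_ [[n mn ->]]] /=; rewrite /u -flowD; apply: far.
have nm : (m%:R : R) <= n%:R by rewrite ler_nat.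
by rewrite ltr_normr; apply/orP; left; have := ler_norm s; lra.
Qed.

End FlowBasics.

Lemma returns_rev (R : realType) (S : topologicalType) (v : R -> S -> S) x :
  returns v x -> returns (fun t => v (- t)) x.
Proof. by move=> rx n U /(rx n)[t nt Ut]; exists (- t); rewrite ?normrN ?opprK. Qed.

(** * Local sections *)

Lemma antiderivative_exists (R : realType) (phi : R -> R) (M : R) : continuous phi ->
  exists A : R -> R, forall t, - M < t < M -> is_derive t 1 A (phi t).
Proof.
move=> cphi; exists (fun x => \int[lebesgue_measure]_(t in `[- M, x]) phi t)%R.
move=> t /andP[Mt tM].
have [|drv <-] := continuous_FTC1_closed tM _ Mt (cphi t).
  apply: continuous_compact_integrable; first exact: segment_compact.
  exact: continuous_subspaceT.
by rewrite derive1E; exact: DeriveDef.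
Qed.

Lemma MVT_is_derive (R : realType) (f df : R -> R) (a b : R) : a <= b ->
  (forall x, a <= x <= b -> is_derive x 1 f (df x)) ->
  exists2 c, a <= c <= b & f b - f a = df c * (b - a).
Proof.
move=> ab drv; have [||c] := @MVT_segment R f df a b ab.
- by move=> x; rewrite in_itv /= => /andP[ax xb]; apply: drv; rewrite !ltW.
- apply: derivable_within_continuous => x; rewrite in_itv /= => xab.
  by have [] := drv x xab.
by rewrite in_itv => cab ->; exists c.
Qed.

Lemma compact_separating_function (R : realType) (S : topologicalType) (a b : S) :
  hausdorff_space S -> compact [set: S] -> a <> b ->
  exists g : S -> R, [/\ continuous g, g a = 0 & g b = 1].
Proof.
move=> hT hcpt ab.
have closed1 y : closed [set y : S] by exact/accessible_closed_set1/hausdorff_accessible.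
have disj : [set a] `&` [set b] = set0 by apply/seteqP; split => // y [/= -> /ab].
have := normal_uniform_separator (compact_normal hT hcpt) (closed1 a) (closed1 b) disj.
move=> /(@uniform_separatorP _ R)[g [cg _ g0 g1]]; exists g; split => //.
  by apply: g0; exists a.
by apply: g1; exists b.
Qed.

Section OrbitAverage.
Variables (R : realType) (S : topologicalType) (v : R -> S -> S).
Hypothesis hv : flow v.
Variables (g : S -> R) (T : R) (A : S -> R -> R).
Hypotheses (cg : continuous g) (T0 : 0 < T).
Implicit Types (y : S) (s t : R).
Hypothesis primA : forall y t, - (T + 2) < t < T + 2 -> is_derive t 1 (A y) (g (v t y)).

Definition orbit_average (y : S) : R := A y T - A y 0.

Lemma is_derive_primitive_shift y t s : - (T + 2) < s + t < T + 2 ->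
  is_derive s 1 (A y \o shift t) (g (v (s + t) y)).
Proof.
move=> st; rewrite -[g _]mulr1; apply: is_derive1_comp; first exact: primA.
exact: is_derive_shift.
Qed.

Lemma orbit_average_flow y t : -1 < t < 1 -> orbit_average (v t y) = A y (T + t) - A y t.
Proof.
move=> /andP[t1 t2].
have [||c _] := @MVT_is_derive R (A (v t y) - (A y \o shift t)) (fun=> 0) 0 T.
- exact: ltW.
- move=> s /andP[s0 sT].
  have drv1 : is_derive s 1 (A (v t y)) (g (v s (v t y))) by apply: primA; lra.
  have drv2 : is_derive s 1 (A y \o shift t) (g (v (s + t) y)).
    by apply: is_derive_primitive_shift; lra.
  by have := is_deriveB drv1 drv2; rewrite (flowD hv) subrr.
have E s : (A (v t y) - (A y \o shift t)) s = A (v t y) s - A y (s + t) by [].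
by rewrite mul0r !E add0r /orbit_average; lra.
Qed.

Lemma orbit_average_continuous : continuous orbit_average.
Proof.
move=> y0; apply/cvgrPdist_lt => e e0.
pose e' := e / (T + 1); have e'0 : 0 < e' by rewrite divr_gt0// addr_gt0.
have : \forall y \near y0, forall s, `[0, T]%classic s -> `|g (v s y0) - g (v s y)| < e'.
  apply: compact_near_forall; first exact: segment_compact.
  move=> t _.
  have : nbhs (v t y0) [set z | `|g (v t y0) - g z| < e' / 2].
    by have /cvgrPdist_lt := @cg (v t y0); apply; rewrite divr_gt0.
  move=> /[dup]/(flow_near2 hv)[[B C] /= [Bt Cy] nearBC] /(flow_near_time hv) near_t.
  exists (B `&` [set s | `|g (v t y0) - g (v s y0)| < e' / 2], C) => /=.
    by split => //; exact: filterI.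
  move=> [s y] /= [[Bs gs] Cy'].
  rewrite (le_lt_trans (ler_distD (g (v t y0)) _ _))// [ltRHS]splitr distrC ltrD//.
  exact: (nearBC (s, y)).
apply: filterS => y near_y.
have [||c /andP[c0 cT]] :=
  @MVT_is_derive R (A y0 - A y) (fun s => g (v s y0) - g (v s y)) 0 T.
- exact: ltW.
- by move=> s /andP[s0 sT]; apply: is_deriveB; apply: primA; lra.
rewrite subr0 => mvt.
have -> : orbit_average y0 - orbit_average y = (A y0 - A y) T - (A y0 - A y) 0.
  have E s : (A y0 - A y) s = A y0 s - A y s by [].
  by rewrite !E /orbit_average; lra.
rewrite mvt normrM (gtr0_norm T0) (@le_lt_trans _ _ (e' * T))//.
  by rewrite ler_pM2r// ltW// near_y//= in_itv /= c0.
by rewrite /e' mulrAC ltr_pdivrMr ?addr_gt0// ltr_pM2l// ltrDl.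
Qed.

Lemma orbit_average_increment y s t : -1 < s -> s <= t -> t < 1 ->
  exists2 c, s <= c <= t &
    orbit_average (v t y) - orbit_average (v s y) = (g (v (c + T) y) - g (v c y)) * (t - s).
Proof.
move=> s1 st t1.
have [//|r /andP[sr rt]|c cst] := @MVT_is_derive R ((A y \o shift T) - A y)
  (fun r => g (v (r + T) y) - g (v r y)) s t.
  apply: is_deriveB; last by apply: primA; move: T0; lra.
  by apply: is_derive_primitive_shift; move: T0; lra.
have E r : ((A y \o shift T) - A y) r = A y (T + r) - A y r by rewrite [T + r]addrC.
by move=> mvt; exists c => //; rewrite -mvt !E !orbit_average_flow//; lra.
Qed.

End OrbitAverage.

(* The average of a function over a piece of orbit of length T increases along
   the flow wherever the function is larger at v T y than at y. *)
Lemma function_increasing_along_flow (R : realType) (S : topologicalType) (v : R -> S -> S) x :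
  flow v -> hausdorff_space S -> compact [set: S] -> ~ singular_pt v x ->
  exists2 F : S -> R, continuous F & exists2 d : R, 0 < d &
    \forall y \near x, forall s t : R, - d <= s -> s < t -> t <= d -> F (v s y) < F (v t y).
Proof.
move=> hv hT hcpt /(nonsingular_time hv)[T T0 /nesym vT].
have [g [cg gx gT]] := compact_separating_function R hT hcpt vT.
have cgv y : continuous (fun s => g (v s y)).
  by move=> s; apply: (@continuous_comp _ _ _ (v^~ y) g); [exact: orbit_map_continuous|exact: cg].
have /choice[A primA] := fun y => antiderivative_exists (T + 2) (cgv y).
exists (orbit_average T A); first exact: (orbit_average_continuous hv cg T0 primA).
have [[B1 C1] /= [B1t C1x] small] : \forall s \near (0 : R) & y \near x, g (v s y) < 1 / 2.
  apply: (@flow_near2 _ _ _ hv 0 x [set z | g z < 1 / 2]).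
  by rewrite (flow0 hv); have /cvgr_lt := cg x; apply; rewrite gx; lra.
have [[B2 C2] /= [B2t C2x] large] : \forall s \near T & y \near x, 1 / 2 < g (v s y).
  apply: (@flow_near2 _ _ _ hv T x [set z | 1 / 2 < g z]).
  by have /cvgr_gt := cg (v T x); apply; rewrite gT; lra.
move: B1t B2t => /nbhs_ballP[r1 /= r10 ballB1] /nbhs_ballP[r2 /= r20 ballB2].
pose d := Num.min (1 / 2) (Num.min (r1 / 2) (r2 / 2)).
have [d0 [d1 [dr1 dr2]]] : 0 < d /\ d <= 1 / 2 /\ d <= r1 / 2 /\ d <= r2 / 2.
  by rewrite /d !lt_min !ge_min !lexx !orbT !divr_gt0.
exists d => //; apply: filterS2 C1x C2x => y C1y C2y s t ds st td.
have [|||c /andP[sc ct] incr] := @orbit_average_increment _ _ _ hv _ _ _ T0 primA y s t.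
- by lra.
- exact: ltW.
- by lra.
rewrite -subr_gt0 incr mulr_gt0 ?subr_gt0//.
apply: (@lt_trans _ _ (1 / 2)).
  apply: (small (c, y)); split => //; apply: ballB1.
  by rewrite -ball_normE /= sub0r normrN ltr_norml; lra.
apply: (large (c + T, y)); split => //; apply: ballB2.
by rewrite -ball_normE /= opprD addrCA subrr addr0 normrN ltr_norml; lra.
Qed.

Section LocalSections.
Variables (R : realType) (S : topologicalType) (v : R -> S -> S).
Hypothesis hv : flow v.

Definition flow_box (Z U : set S) (e : R) : set S :=
  [set b | exists u t, [/\ Z u, U u, `|t| < e & v t u = b]].

Record local_section (x : S) (Z : set S) (d : R) : Prop := LocalSection {
  section_base : Z x;
  section_connected : connected Z;
  section_radius_gt0 : 0 < d;
  section_transverse : forall u w t, Z u -> Z w -> `|t| < 2 * d -> v t w = u -> t = 0;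
  flow_box_open : forall U e, open U -> 0 < e <= d -> open (flow_box Z U e) }.

Section LevelSections.
Implicit Types (y : S) (s t : R).
Variables (F : S -> R) (c d e : R) (D : set S).
Hypotheses (cF : continuous F) (e0 : 0 < e) (ed : e <= d) (oD : open D).
Hypothesis F_increasing : forall y, D y ->
  forall s t, - (4 * d) <= s -> s < t -> t <= 4 * d -> F (v s y) < F (v t y).
Hypothesis F_crosses : forall y, D y -> F (v (- e) y) < c < F (v e y).

Definition hitting_time (y : S) : R := xget 0 [set t | `|t| < e /\ F (v t y) = c].

Definition level_proj (y : S) : S := v (hitting_time y) y.

Lemma hitting_timeP y : D y -> `|hitting_time y| < e /\ F (v (hitting_time y) y) = c.
Proof.
move=> Dy; have /andP[Fe Fe'] := F_crosses Dy.
suff hits : exists t, [set t | `|t| < e /\ F (v t y) = c] t by exact: (xgetPex 0 hits).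
have [|||t] := @IVT R (fun t => F (v t y)) (- e) e c.
- by move: e0; lra.
- apply: continuous_subspaceT => t.
  by apply: (@continuous_comp _ _ _ (v^~ y) F); [exact: orbit_map_continuous|exact: cF].
- by rewrite ge_min le_max (ltW Fe) (ltW Fe') orbT.
rewrite in_itv /= => /andP[t1 t2] Ft; exists t; split => //.
rewrite ltr_norml !lt_neqAle t1 t2 !andbT; apply/andP; split; apply/eqP.
  by move=> te; rewrite -te in Ft; lra.
by move=> te; rewrite te in Ft; lra.
Qed.

Lemma level_ltE y s t : D y -> `|s| <= 4 * d -> `|t| <= 4 * d ->
  (F (v s y) < F (v t y)) = (s < t).
Proof.
move=> Dy; rewrite !ler_norml => /andP[s1 s2] /andP[t1 t2].
have [st|ts|->] := ltgtP s t; last by rewrite ltxx.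
  exact: F_increasing.
by apply: lt_gtF; exact: F_increasing.
Qed.

Lemma hitting_time_uniq y t : D y -> `|t| <= 4 * d -> F (v t y) = c -> t = hitting_time y.
Proof.
move=> Dy td Ft; have [te Fte] := hitting_timeP Dy.
have ted : `|hitting_time y| <= 4 * d by move: e0 ed; lra.
by apply/eqP; rewrite eq_le !leNgt -(level_ltE Dy td ted) -(level_ltE Dy ted td) Ft Fte ltxx.
Qed.

Lemma hitting_time_continuous y : D y -> hitting_time @ y --> hitting_time y.
Proof.
move=> Dy; apply/cvgrPdist_lt => r r0; have [te Ft] := hitting_timeP Dy.
pose q := Num.min r d; have [q0 qr qd] : [/\ 0 < q, q <= r & q <= d].
  by rewrite lt_min r0 !ge_min !lexx orbT (lt_le_trans e0 ed).
have cFv t : continuous (F \o v t).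
  by move=> z; apply: continuous_comp; [exact: flow_continuous|exact: cF].
have early : \forall z \near y, F (v (hitting_time y - q) z) < c.
  have /cvgr_lt := cFv (hitting_time y - q) y; apply.
  by rewrite -Ft level_ltE//; move: te e0 ed; rewrite ?ltr_norml ?ler_norml; lra.
have late : \forall z \near y, c < F (v (hitting_time y + q) z).
  have /cvgr_gt := cFv (hitting_time y + q) y; apply.
  by rewrite -Ft level_ltE//; move: te e0 ed; rewrite ?ltr_norml ?ler_norml; lra.
apply: filterS3 early late (open_nbhs_nbhs (conj oD Dy)) => z early late Dz.
have [tez Ftz] := hitting_timeP Dz; move: early late; rewrite -Ftz !level_ltE//.
- by rewrite ltr_norml; lra.
- by move: e0 ed; lra.
- by move: te e0 ed; rewrite ltr_norml ler_norml; lra.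
- by move: te e0 ed; rewrite ltr_norml ler_norml; lra.
- by move: e0 ed; lra.
Qed.

Lemma level_proj_continuous y : D y -> level_proj @ y --> level_proj y.
Proof.
move=> Dy N /(flow_near2 hv)[[A B] /= [At By] ABN].
have near_A : \forall z \near y, A (hitting_time z) := hitting_time_continuous Dy At.
by apply: filterS2 By near_A => z Bz Az; exact: (ABN (hitting_time z, z)).
Qed.

Lemma level_proj_within C : C `<=` D -> {within C, continuous level_proj}.
Proof. by move=> CD; apply: continuous_in_subspaceT => y /set_mem/CD/level_proj_continuous. Qed.

Lemma level_box_open C U r : open C -> C `<=` D -> open U -> 0 < r <= d ->
  open (flow_box (level_proj @` C) U r).
Proof.
move=> oC CD oU /andP[r0 rd]; rewrite openE => _ [_ [t [[n Cn <-] Un tr <-]]].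
pose q := t + hitting_time n; have Dn := CD _ Cn.
have near_U : \forall m \near n, U (level_proj m).
  by have /(level_proj_continuous Dn) := open_nbhs_nbhs (conj oU Un).
have near_q : \forall m \near n, `|q - hitting_time m| < r.
  have rt : 0 < r - `|t| by rewrite subr_gt0.
  have /cvgrPdist_lt/(_ _ rt) := hitting_time_continuous Dn.
  by apply: filterS => m nm; rewrite /q -addrA (le_lt_trans (ler_normD _ _))//; lra.
have near_n : \forall m \near n, [/\ C m, U (level_proj m) & `|q - hitting_time m| < r].
  by apply: filterS3 (open_nbhs_nbhs (conj oC Cn)) near_U near_q.
have -> : v t (level_proj n) = v q n by rewrite (flowD hv).
apply: filterS (flow_image_nbhs hv q near_n) => b [Cb Ub qb].
exists (level_proj (v (- q) b)), (q - hitting_time (v (- q) b)); split => //.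
by rewrite /level_proj -!(flowD hv) subrK subrr (flow0 hv).
Qed.

Lemma level_local_section x C : F x = c -> open C -> connected C -> C x -> C `<=` D ->
  local_section x (level_proj @` C) d.
Proof.
move=> Fx oC cC Cx CD; split.
- exists x => //; rewrite /level_proj -(hitting_time_uniq (t := 0)) ?(flow0 hv)//.
  + exact: CD.
  + by rewrite normr0; move: e0 ed; lra.
- by apply: connected_continuous_connected => //; exact: level_proj_within.
- exact: lt_le_trans e0 ed.
- move=> _ _ t [m /CD Dm <-] [n /CD Dn <-] td E.
  have [[te Ft] [_ Ftm]] := (hitting_timeP Dn, hitting_timeP Dm).
  suff : t + hitting_time n = hitting_time n by lra.
  apply: hitting_time_uniq => //.
    by rewrite (le_trans (ler_normD _ _))//; move: e0 ed; lra.
  by rewrite (flowD hv) -/(level_proj n) E.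
- by move=> U r; exact: level_box_open.
Qed.

End LevelSections.

Hypotheses (hS : surface R S) (hcpt : compact [set: S]).

Lemma surface_regular_connected (x : S) (N : set S) : nbhs x N ->
  exists C, [/\ open C, C x, connected C & closure C `<=` N].
Proof.
move=> Nx; have [V Vx VN] := compact_regular hS.1 hcpt (@filterT _ (nbhs x) _) Nx.
have [C [oC Cx cC CV]] := surface_locally_connected hS Vx.
by exists C; split => //; apply: subset_trans VN; exact: closureS.
Qed.

Lemma near_level_crossing (F : S -> R) (c e : R) x : continuous F ->
  F (v (- e) x) < c < F (v e x) -> \forall y \near x, F (v (- e) y) < c < F (v e y).
Proof.
move=> cF /andP[Fxe Fxe']; have cFv t : continuous (F \o v t).
  by move=> z; apply: continuous_comp; [exact: flow_continuous|exact: cF].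
have near_lt : \forall y \near x, F (v (- e) y) < c by have /cvgr_lt := cFv (- e) x; apply.
have near_gt : \forall y \near x, c < F (v e y) by have /cvgr_gt := cFv e x; apply.
by apply: filterS2 near_lt near_gt => y -> ->.
Qed.

Lemma local_section_exists x (e0 : R) : ~ singular_pt v x -> 0 < e0 ->
  exists2 d, 0 < d <= e0 & forall M : set S, nbhs x M -> exists Z1 Z2,
    [/\ local_section x Z1 d, local_section x Z2 d, Z1 `<=` Z2, Z2 `<=` M & closure Z1 `<=` Z2].
Proof.
move=> nsx e00.
have [F cF [d1 d10 Fincr]] := function_increasing_along_flow hv hS.1 hcpt nsx.
pose d := Num.min (d1 / 4) e0.
have d0 : 0 < d by rewrite lt_min e00 divr_gt0.
have [dd1 de0] : d <= d1 / 4 /\ d <= e0 by rewrite !ge_min !lexx orbT.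
exists d => [|M Mx]; first by rewrite d0.
have [e' e'0 Me'] := flow_near_small_time hv Mx; pose e := Num.min d e'.
have e1 : 0 < e by rewrite lt_min d0.
have [ed ee'] : e <= d /\ e <= e' by split; rewrite ge_min lexx ?orbT.
have Me : \forall y \near x, forall t, `|t| <= e -> M (v t y).
  by apply: filterS Me' => y My t te; apply: My; exact: le_trans ee'.
have Fe : \forall y \near x, F (v (- e) y) < F x < F (v e y).
  apply: near_level_crossing => //.
  by rewrite -{2 3}(flow0 hv x); apply/andP; split; apply: (nbhs_singleton Fincr); lra.
have [C2 [oC2 C2x cC2 C2N]] := surface_locally_connected hS (filterI Fincr (filterI Me Fe)).
have Fincr' y : C2 y -> forall s t, - (4 * d) <= s -> s < t -> t <= 4 * d ->
    F (v s y) < F (v t y).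
  by move=> /C2N[incr _] s t ds st td; apply: incr; lra.
have Fe' y : C2 y -> F (v (- e) y) < F x < F (v e y) by move=> /C2N[_ []].
have [C1 [oC1 C1x cC1 C12]] := surface_regular_connected (open_nbhs_nbhs (conj oC2 C2x)).
have sub12 : C1 `<=` C2 := subset_trans (@subset_closure _ C1) C12.
pose pr := level_proj F (F x) e.
have prM : pr @` C2 `<=` M.
  move=> _ [y C2y <-]; have [_ [My _]] := C2N y C2y; apply: My.
  by have [/ltW] := hitting_timeP cF e1 Fe' C2y.
exists (pr @` C1), (pr @` C2); split => //.
- exact: (level_local_section cF e1 ed oC2).
- exact: (level_local_section cF e1 ed oC2).
- exact: image_subset.
- have cK : compact (pr @` closure C1).
    apply: continuous_compact; first exact: (level_proj_within cF e1 ed oC2).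
    by apply: (subclosed_compact _ hcpt) => //; exact: closed_closure.
  apply: subset_trans (image_subset pr C12).
  rewrite [X in _ `<=` X]((closure_id _).1 (compact_closed hS.1 cK)).
  exact/closureS/image_subset/subset_closure.
Qed.

End LocalSections.

(** * Separating orders *)

(* Transitivity is automatic when Z is connected, see [sep_trans]. *)
Record separating_order (T : topologicalType) (Z : set T) (lt : rel T) : Prop :=
  SeparatingOrder {
    sep_irr : forall u, Z u -> lt u u = false;
    sep_neg : forall u w, Z u -> Z w -> u <> w -> lt w u = ~~ lt u w;
    sep_nearl : forall u w, Z u -> Z w -> u <> w ->
      \forall u' \near u, Z u' -> lt u' w = lt u w;
    sep_nearr : forall u w, Z u -> Z w -> u <> w ->
      \forall w' \near w, Z w' -> lt u w' = lt u w }.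

Definition flip_rel (T : Type) (lt : rel T) : rel T := fun u w => lt w u.

Definition seg (T : Type) (Z : set T) (lt : rel T) (u w : T) : set T :=
  [set y | [/\ Z y, ~~ lt y u & ~~ lt w y]].

Definition hull (T : Type) (Z : set T) (lt : rel T) (u w : T) : set T :=
  seg Z lt u w `|` seg Z lt w u.

Lemma hullC (T : Type) (Z : set T) lt (u w : T) : hull Z lt u w = hull Z lt w u.
Proof. exact: setUC. Qed.

Lemma seg_flip (T : Type) (Z : set T) lt (u w : T) : seg Z (flip_rel lt) u w = seg Z lt w u.
Proof. by apply/seteqP; split => y [Zy ? ?]. Qed.

Section SeparatingOrders.
Variables (T : topologicalType) (Z : set T) (lt : rel T).
Hypothesis so : separating_order Z lt.
Implicit Types (C : set T) (a b c u w y : T).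

Lemma separating_order_flip : separating_order Z (flip_rel lt).
Proof.
split=> [u|u w|u w|u w]; rewrite /flip_rel.
- exact: (sep_irr so).
- by move=> Zu Zw /nesym; exact: (sep_neg so).
- by move=> Zu Zw /nesym; exact: (sep_nearr so).
- by move=> Zu Zw /nesym; exact: (sep_nearl so).
Qed.

Lemma separating_orderS C : C `<=` Z -> separating_order C lt.
Proof.
move=> CZ; split=> [u|u w|u w|u w].
- by move=> /CZ; exact: (sep_irr so).
- by move=> /CZ Zu /CZ Zw; exact: (sep_neg so).
- move=> /CZ Zu /CZ Zw uw; apply: filterS (sep_nearl so Zu Zw uw) => z + /CZ Zz.
  by apply.
- move=> /CZ Zu /CZ Zw uw; apply: filterS (sep_nearr so Zu Zw uw) => z + /CZ Zz.
  by apply.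
Qed.

Lemma sep_neq u w : Z u -> lt u w -> u <> w.
Proof. by move=> Zu + uw; rewrite -uw (sep_irr so). Qed.

Lemma sep_asym u w : Z u -> Z w -> lt u w -> lt w u = false.
Proof. by move=> Zu Zw uw; rewrite (sep_neg so Zu Zw (sep_neq Zu uw)) uw. Qed.

Lemma sep_antisym u w : Z u -> Z w -> ~~ lt u w -> ~~ lt w u -> u = w.
Proof.
by move=> Zu Zw uw wu; apply: contrapT => neq; rewrite (sep_neg so Zu Zw neq) uw in wu.
Qed.

Lemma sep_neq_le_lt u w : Z u -> Z w -> u <> w -> ~~ lt w u -> lt u w.
Proof. by move=> Zu Zw uw; rewrite (sep_neg so Zu Zw uw) negbK. Qed.

Lemma connected_same_side (X : topologicalType) (D : set X) (f : X -> T) w (x y : X) :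
  connected D -> {within D, continuous f} -> (forall z, D z -> Z (f z)) -> Z w ->
  (forall z, D z -> f z <> w) -> D x -> D y -> lt (f x) w = lt (f y) w.
Proof.
move=> cD cf DZ Zw fw Dx Dy.
apply: (connected_locally_constant (f := fun z => lt (f z) w) cD) => //.
apply: (locally_constant_comp (B := Z `\` [set w]) (f := lt^~ w) cf) => z.
  by move=> Dz; split; [exact: DZ|exact: fw].
by move=> [Zz zw]; apply: filterS (sep_nearl so Zz Zw zw) => z' z'w [/z'w].
Qed.

Lemma segl u w : Z u -> ~~ lt w u -> seg Z lt u w u.
Proof. by move=> Zu wu; split => //; rewrite (sep_irr so). Qed.

Lemma segr u w : Z w -> ~~ lt w u -> seg Z lt u w w.
Proof. by move=> Zw wu; split => //; rewrite (sep_irr so). Qed.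

Lemma hulll u w : Z u -> Z w -> hull Z lt u w u.
Proof.
move=> Zu Zw; have [wu|wu] := boolP (lt w u); last by left; exact: segl.
by right; apply: segr => //; rewrite (sep_asym Zw Zu wu).
Qed.

Lemma hullr u w : Z u -> Z w -> hull Z lt u w w.
Proof. by move=> Zu Zw; rewrite hullC; exact: hulll. Qed.

Lemma hull_side u w y : Z u -> Z w -> Z y -> ~ hull Z lt u w y -> lt y u = lt y w.
Proof.
move=> Zu Zw Zy nhull; have [yu|yu] := boolP (lt y u); have [yw|yw] := boolP (lt y w) => //.
  by case: nhull; right; split => //; rewrite (sep_asym Zy Zu yu).
by case: nhull; left; split => //; rewrite (sep_asym Zy Zw yw).
Qed.

Lemma hull_sub u w : hull Z lt u w `<=` Z.
Proof. by move=> y [] []. Qed.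

Lemma connected_seg_sub C u w : connected C -> C `<=` Z -> C u -> C w -> seg Z lt u w `<=` C.
Proof.
move=> cC CZ Cu Cw y [Zy yu wy]; apply: contrapT => nCy.
have Cy z : C z -> z <> y by move=> Cz zy; rewrite -zy in nCy.
have uy : lt u y by apply: sep_neq_le_lt => //; [exact: CZ|exact: Cy].
have : lt u y = lt w y.
  apply: (connected_same_side (f := id) cC) => //.
  by apply: continuous_subspaceT => z; exact: cvg_id.
by rewrite uy (negbTE wy).
Qed.

Lemma connected_hull_sub C u w : connected C -> C `<=` Z -> C u -> C w -> hull Z lt u w `<=` C.
Proof. by move=> cC CZ Cu Cw; rewrite subUset; split; exact: connected_seg_sub. Qed.

Hypothesis cZ : connected Z.

Lemma initial_segment_connected b : Z b -> connected [set u | Z u /\ ~~ lt b u].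
Proof.
move=> Zb; apply: locally_constant_connected => f lf x y [Zx bx] [Zy yb].
pose f' u := if lt b u then f b else f u.
have lf' : locally_constant Z f'.
  move=> u Zu; rewrite /f'; have [->|/nesym bu] := pselect (u = b).
    have := lf b (conj Zb _); rewrite (sep_irr so Zb) => /(_ isT).
    by apply: filterS => w fw Zw; have [//|bw] := boolP (lt b w); exact: fw.
  have [blu|blu] := boolP (lt b u).
    by apply: filterS (sep_nearr so Zb Zu bu) => w + Zw; rewrite blu => ->.
  apply: filterS2 (lf u (conj Zu blu)) (sep_nearr so Zb Zu bu) => w fw bw Zw.
  by rewrite bw// (negbTE blu); apply: fw; split => //; rewrite bw.
have := connected_locally_constant cZ lf' Zx Zy.
by rewrite /f' (negbTE bx) (negbTE yb).
Qed.

(* Eilenberg: a connected set that is separated at each of its points, in an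
   antisymmetric way, is linearly ordered. *)
Lemma sep_trans a b c : Z a -> Z b -> Z c -> lt a b -> lt b c -> lt a c.
Proof.
move=> Za Zb Zc ab bc.
have cL := initial_segment_connected Zb.
suff -> : lt a c = lt b c by [].
apply: (connected_same_side (f := id) cL).
- by apply: continuous_subspaceT => z; exact: cvg_id.
- by move=> z [].
- by [].
- by move=> z [Zz bz] zc; rewrite zc bc in bz.
- by split => //=; rewrite (sep_asym Za Zb ab).
- by split => //=; rewrite (sep_irr so).
Qed.

Lemma sep_le_lt_trans a b c : Z a -> Z b -> Z c -> ~~ lt b a -> lt b c -> lt a c.
Proof.
move=> Za Zb Zc ba bc; have [->//|ab] := pselect (a = b).
exact: sep_trans (sep_neq_le_lt Za Zb ab ba) bc.
Qed.

Lemma sep_lt_le_trans a b c : Z a -> Z b -> Z c -> lt a b -> ~~ lt c b -> lt a c.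
Proof.
move=> Za Zb Zc ab cb; have [<-//|bc] := pselect (b = c).
exact: sep_trans ab (sep_neq_le_lt Zb Zc bc cb).
Qed.

Lemma sep_le_trans a b c : Z a -> Z b -> Z c -> ~~ lt b a -> ~~ lt c b -> ~~ lt c a.
Proof.
move=> Za Zb Zc ba cb; apply/negP => ca.
by move: cb; rewrite (sep_lt_le_trans Zc Za Zb ca ba).
Qed.

Lemma seg_subset u w u' w' : Z u -> Z w -> Z u' -> Z w' -> ~~ lt u u' -> ~~ lt w' w ->
  seg Z lt u w `<=` seg Z lt u' w'.
Proof.
move=> Zu Zw Zu' Zw' uu' w'w y [Zy yu wy]; split => //.
  exact: sep_le_trans uu' yu.
exact: sep_le_trans wy w'w.
Qed.

End SeparatingOrders.

Section SegmentConnectedness.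
Variables (T : topologicalType) (Z : set T) (lt : rel T).
Hypotheses (so : separating_order Z lt) (cZ : connected Z).

Lemma seg_connected u w : Z u -> Z w -> connected (seg Z lt u w).
Proof.
move=> Zu Zw; pose L := [set y | Z y /\ ~~ lt w y].
have [wu|wu] := boolP (lt w u).
  suff -> : seg Z lt u w = set0 by exact: connected0.
  apply/seteqP; split => // y [Zy yu wy].
  by move: wy; rewrite (sep_lt_le_trans so cZ Zw Zu Zy wu yu).
have LZ : L `<=` Z by move=> y [].
have -> : seg Z lt u w = [set y | L y /\ ~~ flip_rel lt u y].
  by apply/seteqP; split => y; [move=> []|move=> [[]]]; split.
apply: (initial_segment_connected (separating_order_flip (separating_orderS so LZ))) => //.
exact: (initial_segment_connected so).
Qed.

Lemma sep_dense u w : Z u -> Z w -> lt u w -> exists y, [/\ Z y, lt u y & lt y w].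
Proof.
move=> Zu Zw uw; apply: contrapT => no_between.
have wu : ~~ lt w u by rewrite (sep_asym so Zu Zw uw).
have only_ends y : seg Z lt u w y -> y <> w -> y = u.
  move=> [Zy yu wy] yw; apply: contrapT => yu'; apply: no_between; exists y; split => //.
    by apply: (sep_neq_le_lt so) => //; exact/nesym.
  exact: (sep_neq_le_lt so).
have : lt u w = lt w w.
  apply: (connected_locally_constant (f := lt^~ w) (seg_connected Zu Zw)).
  - move=> y uyw; have Zy : Z y by case: uyw.
    have [->|yw] := pselect (y = w).
      have := sep_nearr so Zu Zw (sep_neq so Zu uw); apply: filterS => z + uzw.
      have Zz : Z z by case: uzw.
      rewrite uw => /(_ Zz) uz; have [->//|zw] := pselect (z = w).
      by rewrite (only_ends z uzw zw) (sep_irr so) in uz.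
    by apply: filterS (sep_nearl so Zy Zw yw) => z + [Zz _ _]; exact.
  - exact: (segl so).
  - exact: (segr so).
by rewrite uw (sep_irr so).
Qed.

Lemma hullE u w : Z u -> Z w -> ~~ lt w u -> hull Z lt u w = seg Z lt u w.
Proof.
move=> Zu Zw wu; rewrite /hull; have [<-|uw] := pselect (u = w); first exact: setUid.
suff -> : seg Z lt w u = set0 by rewrite setU0.
apply/seteqP; split => // y [Zy yw uy].
by move: uy; rewrite (sep_lt_le_trans so cZ Zu Zw Zy (sep_neq_le_lt so Zu Zw uw wu) yw).
Qed.

Lemma hull_connected u w : Z u -> Z w -> connected (hull Z lt u w).
Proof.
move=> Zu Zw; have [wu|wu] := boolP (lt w u).
  by rewrite hullC hullE ?(sep_asym so Zw Zu wu)//; exact: seg_connected.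
by rewrite hullE//; exact: seg_connected.
Qed.

Lemma hull_subset u w y : Z u -> Z w -> hull Z lt u w y -> hull Z lt u y `<=` hull Z lt u w.
Proof.
move=> Zu Zw uwy; apply: (connected_hull_sub so) => //; first exact: hull_connected.
- exact: hull_sub.
- exact: (hulll so).
Qed.

End SegmentConnectedness.

Lemma seg_closed (T : topologicalType) (Z1 Z2 : set T) lt u w :
  separating_order Z2 lt -> connected Z1 -> Z1 `<=` Z2 -> closure Z1 `<=` Z2 ->
  Z1 u -> Z1 w -> closed (seg Z1 lt u w).
Proof.
move=> so cZ1 Z12 clZ1 Z1u Z1w; have [Zu Zw] := (Z12 _ Z1u, Z12 _ Z1w).
apply/closure_id/seteqP; split; first exact: subset_closure.
move=> y cy; have Zy : Z2 y by apply: clZ1; apply: closureS cy => z [].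
have yu : ~~ lt y u.
  apply/negP => yu; have [z [[Z1z zu _]]] := cy _ (sep_nearl so Zy Zu (sep_neq so Zy yu)).
  by move=> /(_ (Z12 _ Z1z)); rewrite yu (negbTE zu).
have wy : ~~ lt w y.
  apply/negP => wy; have [z [[Z1z _ wz]]] := cy _ (sep_nearr so Zw Zy (sep_neq so Zw wy)).
  by move=> /(_ (Z12 _ Z1z)); rewrite wy (negbTE wz).
by split => //; exact: (connected_seg_sub so cZ1 Z12 Z1u Z1w).
Qed.

Section MonotoneMaps.
Variables (T T' : topologicalType) (Z : set T) (Z' : set T') (lt : rel T) (lt' : rel T').
Hypotheses (so : separating_order Z lt) (so' : separating_order Z' lt') (cZ : connected Z).
Variables (C : set T) (f : T -> T').
Hypotheses (cC : connected C) (CZ : C `<=` Z) (fZ' : forall u, C u -> Z' (f u)).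
Hypothesis cf : {within C, continuous f}.
Hypothesis f_inj : forall u w, C u -> C w -> f u = f w -> u = w.

Lemma injective_between u y w : C u -> C y -> C w -> lt u y -> lt y w ->
  lt' (f u) (f y) = lt' (f u) (f w) /\ lt' (f u) (f w) = lt' (f y) (f w).
Proof.
move=> Cu Cy Cw uy yw; have [[Zu Zy] Zw] := (CZ Cu, CZ Cy, CZ Cw).
have yu : ~~ lt y u by rewrite (sep_asym so Zu Zy uy).
have wy : ~~ lt w y by rewrite (sep_asym so Zy Zw yw).
have segC a b : C a -> C b -> seg Z lt a b `<=` C by exact: (connected_seg_sub so).
have cfseg a b : C a -> C b -> {within seg Z lt a b, continuous f}.
  by move=> Ca Cb; apply: continuous_subspaceW cf; exact: segC.
split.
  apply: (connected_same_side (separating_order_flip so') (seg_connected so cZ Zy Zw)).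
  - exact: cfseg.
  - by move=> z /(segC _ _ Cy Cw)/fZ'.
  - exact: fZ'.
  - move=> z yzw /f_inj zu; case: (yzw) => _ zy _; move: zy.
    by rewrite (zu (segC _ _ Cy Cw _ yzw) Cu) uy.
  - exact: (segl so).
  - exact: (segr so).
apply: (connected_same_side so' (seg_connected so cZ Zu Zy)).
- exact: cfseg.
- by move=> z /(segC _ _ Cu Cy)/fZ'.
- exact: fZ'.
- move=> z uzy /f_inj zw; case: (uzy) => _ _; rewrite (zw (segC _ _ Cu Cy _ uzy) Cw).
  by rewrite yw.
- exact: (segl so).
- exact: (segr so).
Qed.

Lemma injective_monotone : exists e : bool,
  forall u w, C u -> C w -> u <> w -> lt' (f u) (f w) = lt u w (+) e.
Proof.
pose g u w := lt' (f u) (f w) (+) lt u w.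
have gC u w : C u -> C w -> u <> w -> g u w = g w u.
  move=> Cu Cw uw; rewrite /g (sep_neg so (CZ Cu) (CZ Cw) uw).
  rewrite (sep_neg so' (fZ' Cu) (fZ' Cw) (fun E => uw (f_inj Cu Cw E))).
  by rewrite addbN addNb negbK.
have sorted a b c : C a -> C b -> C c -> lt a b -> lt b c -> g a b = g a c /\ g a c = g b c.
  move=> Ca Cb Cc ab bc; rewrite /g ab bc (sep_trans so cZ (CZ Ca) (CZ Cb) (CZ Cc) ab bc).
  by have [-> ->] := injective_between Ca Cb Cc ab bc.
have g_const u w w' : C u -> C w -> C w' -> u <> w -> u <> w' -> g u w = g u w'.
  move=> Cu Cw Cw' uw uw'; have [->//|ww'] := pselect (w = w').
  wlog lww' : w w' Cw Cw' uw uw' ww' / lt w w'.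
    move=> gww'; have [|w'w] := boolP (lt w w'); first exact: gww'.
    apply/esym/gww' => //; first exact/nesym.
    by apply: (sep_neq_le_lt so) => //; [exact: CZ|exact: CZ|exact/nesym].
  have [luw|wu] := boolP (lt u w); first by have [] := sorted u w w' Cu Cw Cw' luw lww'.
  have {}wu : lt w u by apply: (sep_neq_le_lt so) => //; [exact: CZ|exact: CZ|exact/nesym].
  have [luw'|w'u] := boolP (lt u w').
    by rewrite (gC u w)//; have [-> ->] := sorted w u w' Cw Cu Cw' wu luw'.
  have {}w'u : lt w' u by apply: (sep_neq_le_lt so) => //; [exact: CZ|exact: CZ|exact/nesym].
  rewrite (gC u w)// (gC u w')//.
  by have [_ ->] := sorted w w' u Cw Cw' Cu lww' w'u.
have [[a [b [Ca Cb ab]]]|C1] := pselect (exists a b, [/\ C a, C b & a <> b]); last first.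
  by exists false => u w Cu Cw uw; case: C1; exists u, w.
exists (g a b) => u w Cu Cw uw; suff <- : g u w = g a b by rewrite /g addbCA addbb addbF.
have [ua|/nesym au] := pselect (u = a); first by rewrite ua in Cu uw *; exact: g_const.
have [wa|/nesym aw] := pselect (w = a).
  by rewrite (gC u w)// wa; exact: g_const.
by rewrite (g_const u w a)// ?(gC u a)//; [apply: g_const|exact/nesym|exact/nesym].
Qed.

End MonotoneMaps.

(** * The winding order of a section *)

Section Signs.
Variables (R : realType) (T : topologicalType) (A : set T) (l : T -> R).
Hypothesis cl : {within A, continuous l}.

Lemma within_near_gt0 a : A a -> 0 < l a -> \forall b \near a, A b -> 0 < l b.
Proof.
by move=> Aa la; have /subspace_continuousP cl' := cl; exact: cl' Aa _ (lt_nbhsr la).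
Qed.

Lemma within_near_lt0 a : A a -> l a < 0 -> \forall b \near a, A b -> l b < 0.
Proof.
by move=> Aa la; have /subspace_continuousP cl' := cl; exact: cl' Aa _ (lt_nbhsl la).
Qed.

Lemma within_near_sign a : A a -> l a != 0 ->
  \forall b \near a, A b -> (0 < l b) = (0 < l a) /\ l b != 0.
Proof.
move=> Aa; rewrite neq_lt => /orP[la|la].
  apply: filterS (within_near_lt0 Aa la) => b lb /lb {}lb.
  by rewrite (lt_gtF la) (lt_gtF lb) lt_eqF.
by apply: filterS (within_near_gt0 Aa la) => b lb /lb {}lb; rewrite la lb gt_eqF.
Qed.

End Signs.

Lemma within_continuousN (R : realType) (T : topologicalType) (A : set T) (h : T -> R) :
  {within A, continuous h} -> {within A, continuous (\- h)}.
Proof. by move=> ch t; apply: cvgN; exact: ch. Qed.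

Section Crossing.
Variable R : realType.

(* The pullback, along (l, m), of the double cover of the punctured plane,
   trivialised off the ray l = 0 < m. *)
Definition crossing (T : Type) (l m : T -> R) : set (set T * (T -> bool)) :=
  [set c | c = ([set a | 0 < m a], fun a => 0 < l a) \/
           c = ([set a | l a != 0 \/ m a < 0], fun=> false)].

Section CrossingPotential.
Variables (T : topologicalType) (A : set T) (l m : T -> R).
Hypotheses (cl : {within A, continuous l}) (cm : {within A, continuous m}).

Lemma near_off_ray a : A a -> l a != 0 \/ m a < 0 ->
  \forall b \near a, A b -> l b != 0 \/ m b < 0.
Proof.
move=> Aa [la|ma].
  by apply: filterS (within_near_sign cl Aa la) => b lb /lb[]; left.
by apply: filterS (within_near_lt0 cm Aa ma) => b mb /mb; right.
Qed.

Lemma crossing_torsor : (forall a, A a -> l a != 0 \/ m a != 0) -> torsor_on A (crossing l m).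
Proof.
move=> lm0; split.
- by move=> c a [->|->] Aa /= ca; [exact: (within_near_gt0 cm Aa ca)|exact: near_off_ray].
- move=> a Aa; have [ma|ma] := ltP 0 (m a).
    by exists ([set a | 0 < m a], fun a => 0 < l a) => //; left.
  exists ([set a | l a != 0 \/ m a < 0], fun=> false); first by right.
  by have [la|ma0] := lm0 a Aa; [left|right; rewrite lt_neqAle ma0].
have lc0 B : locally_constant B (fun a => 0 < l a) ->
    locally_constant B (fun a => (0 < l a) (+) false).
  by move=> lc a Ba; apply: filterS (lc a Ba) => b lb /lb ->.
have mixed : locally_constant (A `&` [set a | 0 < m a] `&` [set a | l a != 0 \/ m a < 0])
    (fun a => 0 < l a).
  move=> a [[Aa /= ma] [la|/(lt_trans ma)]]; last by rewrite ltxx.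
  by apply: filterS (within_near_sign cl Aa la) => b lb [[/lb[]]].
move=> c c' [->|->] [->|->] a aP /=.
- by apply: nearW => b _; rewrite !addbb.
- by apply: filterS (mixed a aP) => b lb /lb ->.
- have aP' : (A `&` [set a | 0 < m a] `&` [set a | l a != 0 \/ m a < 0]) a.
    by case: aP => [[]].
  by apply: filterS (mixed a aP') => b lb [[Ab lmb] mb]; rewrite lb.
- exact: nearW.
Qed.

Lemma crossing_potentialP phi : potential_on A (crossing l m) phi <->
  (forall a, A a -> 0 < m a ->
     \forall b \near a, A b -> phi b (+) (0 < l b) = phi a (+) (0 < l a)) /\
  (forall a, A a -> l a != 0 \/ m a < 0 -> \forall b \near a, A b -> phi b = phi a).
Proof.
split=> [pphi|[pphi1 pphi2] c [->|->] a [Aa /= ca]].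
- split=> a Aa ca.
    have := pphi ([set a | 0 < m a], fun a => 0 < l a) (or_introl erefl) a (conj Aa ca).
    by apply: filterS2 (within_near_gt0 cm Aa ca) => b mb lb Ab; apply: lb; split => //; exact: mb.
  have := pphi ([set a | l a != 0 \/ m a < 0], fun=> false) (or_intror erefl) a (conj Aa ca).
  apply: filterS2 (near_off_ray Aa ca) => b lmb phib Ab.
  by have := phib (conj Ab (lmb Ab)); rewrite /= !addbF.
- by apply: filterS (pphi1 a Aa ca) => b phib [/phib].
- by apply: filterS (pphi2 a Aa ca) => b phib [/phib ->].
Qed.

End CrossingPotential.

(* b is the parity of the number of crossings of the ray l = 0 < m by the path (l, m). *)
Definition crosses (l m : R -> R) (d : R) (b : bool) : Prop :=
  exists2 phi : R -> bool, potential_on `[- d, d] (crossing l m) phi & phi d (+) phi (- d) = b.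

Section CrossingParity.
Variables (d : R) (l m : R -> R).
Hypotheses (cl : {within `[- d, d], continuous l}) (cm : {within `[- d, d], continuous m}).
Hypothesis d0 : 0 < d.

Let end_right : `[- d, d]%classic d. Proof. by rewrite /= in_itv/= lexx andbT; move: d0; lra. Qed.
Let end_left : `[- d, d]%classic (- d). Proof. by rewrite /= in_itv/= lexx /=; move: d0; lra. Qed.

Lemma crosses_exists : (forall t, `[- d, d]%classic t -> l t != 0 \/ m t != 0) ->
  exists b, crosses l m d b.
Proof.
move=> lm0.
have cI : convex_set (`[- d, d]%classic : set (convex_lmodType R^o)).
  apply/(@convex_setP R R^o) => a b t /=.
  rewrite !in_itv/= => /andP[a1 a2] /andP[b1 b2] /andP[t0 t1].
  have t'0 : 0 <= 1 - t by lra.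
  have := ler_wpM2l t'0 a1; have := ler_wpM2l t'0 a2.
  have := ler_wpM2l t0 b1; have := ler_wpM2l t0 b2.
  by rewrite /GRing.scale /=; lra.
have torI : torsor_on `[- d, d] (crossing l m).
  exact: crossing_torsor.
have [phi pphi] := @convex_torsor_potential R R^o _ _ (@segment_compact R (- d) d) cI torI.
by exists (phi d (+) phi (- d)); exists phi.
Qed.

Lemma crosses_uniq b b' : (forall t, `[- d, d]%classic t -> l t != 0 \/ m t != 0) ->
  crosses l m d b -> crosses l m d b' -> b = b'.
Proof.
move=> lm0 [phi pphi <-] [phi' pphi' <-].
have torI : torsor_on `[- d, d] (crossing l m).
  exact: crossing_torsor.
have := connected_locally_constant (@segment_connected R (- d) d)
  (potential_on_unique torI pphi pphi') end_right end_left.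
by move: (phi d) (phi (- d)) (phi' d) (phi' (- d)); do 4!case.
Qed.

(* Taking opposites exchanges the two rays l = 0; half-open half-planes bounded by
   the line l = 0 are the sets whose boundary consists of these two rays. *)
Lemma crosses_opp b : l (- d) < 0 < l d ->
  crosses l m d b -> crosses (\- l) (\- m) d (~~ b).
Proof.
move=> /andP[lNd ld] [phi /(crossing_potentialP cl cm)[phi_right phi_off] phib].
pose upper t := (0 < l t) || ((l t == 0) && (m t < 0)).
exists (fun t => phi t (+) upper t); last first.
  rewrite /upper ld (lt_gtF lNd) (lt_eqF lNd) /= addbF -phib.
  by rewrite addbAC addbT.
apply/crossing_potentialP; [exact: within_continuousN|exact: within_continuousN|split=> t It].
- rewrite /= oppr_gt0 => mt.
  apply: filterS2 (phi_off t It (or_intror mt)) (within_near_lt0 cm It mt) => s phis ms Is.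
  rewrite phis// /upper mt (ms Is) /= !oppr_gt0 !andbT -!addbA; congr (_ (+) _).
  by case: (ltgtP (l s) 0); case: (ltgtP (l t) 0).
- rewrite /= oppr_eq0 oppr_lt0 => lmt; have [mt|mt] := ltP 0 (m t).
    apply: filterS2 (phi_right t It mt) (within_near_gt0 cm It mt) => s phis ms Is.
    by rewrite /upper (lt_gtF mt) (lt_gtF (ms Is)) !andbF !orbF phis.
  have lt0 : l t != 0 by case: lmt; rewrite // ltNge mt.
  apply: filterS2 (phi_off t It (or_introl lt0)) (within_near_sign cl It lt0) => s phis ls Is.
  have [ls_t ls0] := ls Is.
  by rewrite phis// /upper ls_t (negbTE ls0) (negbTE lt0).
Qed.

Lemma crosses_rev b : crosses l m d b -> crosses (l \o -%R) (m \o -%R) d b.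
Proof.
move=> [phi /(crossing_potentialP cl cm)[phi_right phi_off] phib].
exists (phi \o -%R); last by rewrite /= opprK addbC.
have maps t : `[- d, d]%classic t -> `[- d, d]%classic (- t).
  by rewrite /= !in_itv/=; lra.
have nearN (t : R) (P : R -> Prop) : (\forall s \near - t, `[- d, d]%classic s -> P s) ->
    \forall s \near t, `[- d, d]%classic s -> P (- s).
  move=> nearP; have near_t : \forall s \near t, `[- d, d]%classic (- s) -> P (- s).
    exact: (@opp_continuous R t _ nearP).
  by apply: filterS near_t => s Ps /maps; exact: Ps.
have cN (h : R -> R) : {within `[- d, d], continuous h} ->
    {within `[- d, d], continuous (h \o -%R)}.
  move=> /subspace_continuousP ch; apply/subspace_continuousP => t It N Nt.
  exact: (nearN t (N \o h) (ch (- t) (maps _ It) N Nt)).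
apply/crossing_potentialP; [exact: cN|exact: cN|split=> t It tP].
- exact: (nearN t (fun s => phi s (+) _ = _) (phi_right (- t) (maps _ It) tP)).
- exact: (nearN t (fun s => phi s = _) (phi_off (- t) (maps _ It) tP)).
Qed.

End CrossingParity.

Lemma mulr_gt0_sign (x y : R) : 0 < x * y -> [/\ x != 0, y != 0 & (0 < x) = (0 < y)].
Proof.
move=> xy; have := gt_eqF xy; rewrite mulf_eq0 => /norP[x0 y0].
split => //; have [xgt0|xlt0|x0'] := ltgtP 0 x.
- by rewrite -(pmulr_rgt0 _ xgt0) xy.
- by rewrite (nmulr_rgt0 _ xlt0) in xy; rewrite lt_gtF.
- by rewrite -x0' eqxx in x0.
Qed.

(* Two paths in the punctured plane are compared that stay at all times in a common
   half-plane l < 0, l > 0, m < 0 or m > 0; [ray_jump] says whether the segment between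
   their positions crosses the ray l = 0 < m. *)
Section SameSign.
Variables (d : R) (l m l' m' : R -> R).
Hypotheses (cl : {within `[- d, d], continuous l}) (cm : {within `[- d, d], continuous m}).
Hypotheses (cl' : {within `[- d, d], continuous l'}) (cm' : {within `[- d, d], continuous m'}).
Hypothesis same_sign :
  forall t, `[- d, d]%classic t -> 0 < l t * l' t \/ 0 < m t * m' t.

Definition ray_jump (t : R) : bool := [&& 0 < m t, 0 < m' t & (0 < l t) (+) (0 < l' t)].

Lemma ray_jump_same_sign t : 0 < l t * l' t -> ray_jump t = false.
Proof. by move=> /mulr_gt0_sign[_ _ E]; rewrite /ray_jump E addbb !andbF. Qed.

Variable phi : R -> bool.
Hypothesis pphi : potential_on `[- d, d] (crossing l m) phi.

Lemma near_ray_jump_upper t : `[- d, d]%classic t -> 0 < m t -> 0 < m' t ->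
  \forall s \near t, `[- d, d]%classic s ->
    phi s (+) ray_jump s = phi t (+) (0 < l t) (+) (0 < l' s).
Proof.
move=> It mt m't; have [phi_right _] := (crossing_potentialP cl cm phi).1 pphi.
apply: filterS3 (phi_right t It mt) (within_near_gt0 cm It mt)
  (within_near_gt0 cm' It m't) => s phis ms m's Is.
by rewrite /ray_jump (ms Is) (m's Is) /= addbA phis.
Qed.

Lemma near_ray_jump_off t : `[- d, d]%classic t -> ~~ ((0 < m t) && (0 < m' t)) ->
  \forall s \near t, `[- d, d]%classic s -> phi s (+) ray_jump s = phi t.
Proof.
move=> It mt; have [_ phi_off] := (crossing_potentialP cl cm phi).1 pphi.
have [lt|mmt] := same_sign It.
  have [lt0 l't0 lE] := mulr_gt0_sign lt.
  apply: filterS3 (phi_off t It (or_introl lt0)) (within_near_sign cl It lt0)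
    (within_near_sign cl' It l't0) => s phis ls l's Is.
  have [[lsE _] [l'sE _]] := (ls Is, l's Is).
  by rewrite /ray_jump lsE l'sE lE addbb !andbF addbF phis.
have mt0 : m t < 0.
  have [mt0 _ mE] := mulr_gt0_sign mmt.
  by rewrite lt_neqAle mt0 leNgt; move: mt; rewrite -mE andbb.
apply: filterS2 (phi_off t It (or_intror mt0)) (within_near_lt0 cm It mt0) => s phis ms Is.
by rewrite /ray_jump (lt_gtF (ms Is)) addbF phis.
Qed.

Lemma ray_jump_potential :
  potential_on `[- d, d] (crossing l' m') (fun t => phi t (+) ray_jump t).
Proof.
apply/crossing_potentialP => //; split=> t It => [m't|lm't].
- have [mt|mt] := boolP (0 < m t).
    have near_t := near_ray_jump_upper It mt m't; rewrite (nbhs_singleton near_t It).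
    by apply: filterS near_t => s jumps Is; rewrite jumps// -!addbA !addbb.
  have near_t := near_ray_jump_off It; rewrite (negbTE mt) in near_t.
  have l't0 : l' t != 0.
    have [/mulr_gt0_sign[]//|/mulr_gt0_sign[_ _]] := same_sign It.
    by rewrite m't (negbTE mt).
  rewrite (nbhs_singleton (near_t isT) It).
  apply: filterS2 (near_t isT) (within_near_sign cl' It l't0) => s jumps l's Is.
  by have [-> _] := l's Is; rewrite jumps.
- have [/andP[mt m't]|mt] := boolP ((0 < m t) && (0 < m' t)); last first.
    have near_t := near_ray_jump_off It mt; rewrite (nbhs_singleton near_t It).
    exact: near_t.
  have l't0 : l' t != 0 by case: lm't => // /(lt_trans m't); rewrite ltxx.
  have near_t := near_ray_jump_upper It mt m't; rewrite (nbhs_singleton near_t It).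
  apply: filterS2 near_t (within_near_sign cl' It l't0) => s jumps l's Is.
  by have [<- _] := l's Is; rewrite jumps.
Qed.

End SameSign.

Lemma crosses_same_sign (d : R) (l m l' m' : R -> R) b :
  {within `[- d, d], continuous l} -> {within `[- d, d], continuous m} ->
  {within `[- d, d], continuous l'} -> {within `[- d, d], continuous m'} ->
  (forall t, `[- d, d]%classic t -> 0 < l t * l' t \/ 0 < m t * m' t) ->
  0 < l d * l' d -> 0 < l (- d) * l' (- d) -> crosses l m d b -> crosses l' m' d b.
Proof.
move=> cl cm cl' cm' same_sign ld lNd [phi pphi <-].
exists (fun t => phi t (+) ray_jump l m l' m' t); first exact: ray_jump_potential.
by rewrite !ray_jump_same_sign// !addbF.
Qed.

End Crossing.

(* Each point u of Z flows up from time -d to d in D while w flows down; the order compares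
   u and w by the parity of the number of times the vector from [v (- t) w] to [v t u], read
   in the coordinates (L, M), crosses a fixed ray. *)
Section WindingOrder.
Variables (R : realType) (S : topologicalType) (v : R -> S -> S).
Hypotheses (hv : flow v) (hT : hausdorff_space S).
Variables (D : set S) (L M : S -> R) (d : R).
Hypotheses (cL : forall y, D y -> L @ y --> L y) (cM : forall y, D y -> M @ y --> M y).
Hypothesis LM_inj : forall y y', D y -> D y' -> L y = L y' -> M y = M y' -> y = y'.
Variable Z : set S.
Hypothesis d0 : 0 < d.
Hypothesis ZD : forall u t, Z u -> `[- d, d]%classic t -> D (v t u).
Hypothesis Z_separated :
  forall u w t, Z u -> Z w -> u <> w -> `[- d, d]%classic t -> v t u <> v (- t) w.
Hypothesis Z_rises : forall u w, Z u -> Z w -> L (v (- d) u) < L (v d w).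

Definition flow_diff (H : S -> R) (u w : S) (t : R) : R := H (v t u) - H (v (- t) w).

Definition winding_lt : rel S := fun u w =>
  (u != w) && `[< crosses (flow_diff L u w) (flow_diff M u w) d true >].

Let opp_mem t : `[- d, d]%classic t -> `[- d, d]%classic (- t).
Proof. by rewrite /= !in_itv/=; lra. Qed.

Lemma flow_diffC H u w : flow_diff H w u = \- (flow_diff H u w \o -%R).
Proof. by apply/funext => t; rewrite /flow_diff /= opprK opprB. Qed.

Lemma flow_diff_cvg (H : S -> R) u w t : (forall y, D y -> H @ y --> H y) ->
  D (v t u) -> D (v (- t) w) ->
  (fun p : R * S => flow_diff H p.2 w p.1) @ (t, u) --> flow_diff H u w t.
Proof.
move=> cH Du Dw; apply: cvgB => N.
  by move=> /(cH _ Du)/(flow_near2 hv)[[A B] /= [At Bx] ABN]; exists (A, B).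
move=> /(cH _ Dw)/(flow_near_time hv) near_Nt.
have near_t : \forall s \near t, N (H (v (- s) w)) := @opp_continuous R t _ near_Nt.
by exists ([set s | N (H (v (- s) w))], setT); [split => //; exact: filterT|move=> [s y] /= []].
Qed.

Lemma flow_diff_within (H : S -> R) u w : (forall y, D y -> H @ y --> H y) -> Z u -> Z w ->
  {within `[- d, d], continuous (flow_diff H u w)}.
Proof.
move=> cH Zu Zw; apply/subspace_continuousP => t It N Nt.
have [[A B] /= [At Bu] ABN] := flow_diff_cvg cH (ZD Zu It) (ZD Zw (opp_mem It)) Nt.
by apply: filterS At => s As _; apply: (ABN (s, u)); split => //; exact: nbhs_singleton.
Qed.

Lemma flow_diff_neq0 u w t : Z u -> Z w -> u <> w -> `[- d, d]%classic t ->
  flow_diff L u w t != 0 \/ flow_diff M u w t != 0.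
Proof.
move=> Zu Zw uw It; have [/eqP|] := eqVneq (flow_diff L u w t) 0; last by left.
rewrite subr_eq0 => /eqP Luw; right; apply/eqP => /eqP; rewrite subr_eq0 => /eqP Muw.
by apply: (Z_separated Zu Zw uw It); apply: LM_inj => //; apply: ZD => //; exact: opp_mem.
Qed.

Lemma flow_diff_ends u w : Z u -> Z w -> flow_diff L u w (- d) < 0 < flow_diff L u w d.
Proof. by move=> Zu Zw; rewrite /flow_diff opprK subr_lt0 subr_gt0 !Z_rises. Qed.

Lemma near_flow_diff_same_sign u w : Z u -> Z w -> u <> w ->
  \forall u' \near u, forall t, `[- d, d]%classic t ->
    0 < flow_diff L u w t * flow_diff L u' w t \/ 0 < flow_diff M u w t * flow_diff M u' w t.
Proof.
move=> Zu Zw uw; apply: compact_near_forall; first exact: segment_compact.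
move=> t It; have [Du Dw] := (ZD Zu It, ZD Zw (opp_mem It)).
have near_pos (H : S -> R) : (forall y, D y -> H @ y --> H y) -> flow_diff H u w t != 0 ->
    \forall s \near t & u' \near u, 0 < flow_diff H u w s * flow_diff H u' w s.
  move=> cH Huw; have cdiff := flow_diff_cvg cH Du Dw.
  have pos : 0 < flow_diff H u w t * flow_diff H u w t by rewrite -expr2 exprn_even_gt0.
  have cdiff_u : (fun p : R * S => flow_diff H u w p.1) @ (t, u) --> flow_diff H u w t.
    move=> N /cdiff[[A B] /= [At Bu] ABN]; exists (A, setT); first by split => //; exact: filterT.
    by move=> [s y] /= [As _]; apply: (ABN (s, u)); split => //; exact: nbhs_singleton.
  exact: (cvgM cdiff_u cdiff) (lt_nbhsr pos).
have [Luw|Muw] := flow_diff_neq0 Zu Zw uw It.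
  by apply: filterS (near_pos L cL Luw) => p; left.
by apply: filterS (near_pos M cM Muw) => p; right.
Qed.

Lemma winding_exists u w : Z u -> Z w -> u <> w ->
  exists b, crosses (flow_diff L u w) (flow_diff M u w) d b.
Proof.
move=> Zu Zw uw; apply: crosses_exists; [exact: flow_diff_within|exact: flow_diff_within|].
by move=> t; exact: flow_diff_neq0.
Qed.

Lemma winding_ltE u w b : Z u -> Z w -> u <> w ->
  crosses (flow_diff L u w) (flow_diff M u w) d b -> winding_lt u w = b.
Proof.
move=> Zu Zw uw crossb; rewrite /winding_lt; have /eqP -> /= := uw.
case: b crossb => crossb; first exact/asboolP.
have [cl cm] := (flow_diff_within cL Zu Zw, flow_diff_within cM Zu Zw).
apply/asboolPn => /(crosses_uniq cl cm d0 _ crossb) uniq.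
by have := uniq (fun t => @flow_diff_neq0 u w t Zu Zw uw).
Qed.

Lemma winding_ltN u w : Z u -> Z w -> u <> w -> winding_lt w u = ~~ winding_lt u w.
Proof.
move=> Zu Zw uw; have [b crossb] := winding_exists Zu Zw uw.
rewrite (winding_ltE Zu Zw uw crossb); apply: (winding_ltE Zw Zu (nesym uw)).
have cL' := flow_diff_within cL Zu Zw; have cM' := flow_diff_within cM Zu Zw.
rewrite (flow_diffC L u w) (flow_diffC M u w).
apply: (crosses_rev (l := \- flow_diff L u w) (within_continuousN cL') (within_continuousN cM')).
exact: (crosses_opp cL' cM' (flow_diff_ends Zu Zw)).
Qed.

Lemma winding_lt_nearl u w : Z u -> Z w -> u <> w ->
  \forall u' \near u, Z u' -> winding_lt u' w = winding_lt u w.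
Proof.
move=> Zu Zw uw; have [b crossb] := winding_exists Zu Zw uw.
rewrite (winding_ltE Zu Zw uw crossb).
apply: filterS2 (hausdorff_near_neq hT uw) (near_flow_diff_same_sign Zu Zw uw).
move=> u' u'w same_sign Zu'; have [ends ends'] := (flow_diff_ends Zu Zw, flow_diff_ends Zu' Zw).
apply: winding_ltE => //.
apply: crosses_same_sign crossb; [exact: flow_diff_within|exact: flow_diff_within|
  exact: flow_diff_within|exact: flow_diff_within|exact: same_sign| |].
  by have [/andP[_ pos] /andP[_ pos']] := (ends, ends'); rewrite mulr_gt0.
by have [/andP[neg _] /andP[neg' _]] := (ends, ends'); rewrite nmulr_rgt0.
Qed.

Lemma winding_separating_order : separating_order Z winding_lt.
Proof.
split; [|exact: winding_ltN|exact: winding_lt_nearl|].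
  by move=> u _; rewrite /winding_lt eqxx.
move=> u w Zu Zw uw.
apply: filterS2 (hausdorff_near_neq hT (nesym uw)) (winding_lt_nearl Zw Zu (nesym uw)).
by move=> w' w'u ltw' Zw'; rewrite (winding_ltN Zw' Zu w'u) ltw'// -(winding_ltN Zw Zu (nesym uw)).
Qed.

End WindingOrder.

Lemma separating_coordinates (R : realType) (S : topologicalType) (x p q : S)
    (f : S -> R * R) (g : R * R -> S) (r : R) (D := chart_disc g (f x) r) :
  disc_chart x f g r -> D p -> D q -> p <> q ->
  exists L M : S -> R, [/\ L q < L p, forall y, D y -> L @ y --> L y,
    forall y, D y -> M @ y --> M y &
    forall y y', D y -> D y' -> L y = L y' -> M y = M y' -> y = y'].
Proof.
move=> dc Dp Dq pq; pose e := f p - f q.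
have e_gt0 : 0 < e.1 ^+ 2 + e.2 ^+ 2.
  rewrite lt_neqAle addr_ge0 ?sqr_ge0// andbT eq_sym paddr_eq0 ?sqr_ge0// !sqrf_eq0.
  apply/negP => /andP[/eqP e1 /eqP e2]; apply: pq; apply: (chart_disc_inj dc) => //.
  by apply/eqP; rewrite -subr_eq0 -/e (surjective_pairing e) e1 e2.
have cf1 y : D y -> (fun z => (f z).1) @ y --> (f y).1.
  by move=> Dy; apply: (cvg_comp _ _ (chart_continuous dc Dy)); exact: cvg_fst.
have cf2 y : D y -> (fun z => (f z).2) @ y --> (f y).2.
  by move=> Dy; apply: (cvg_comp _ _ (chart_continuous dc Dy)); exact: cvg_snd.
pose L y := e.1 * (f y).1 + e.2 * (f y).2; pose M y := e.1 * (f y).2 - e.2 * (f y).1.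
exists L, M; split.
- rewrite -subr_gt0; suff -> : L p - L q = e.1 ^+ 2 + e.2 ^+ 2 by [].
  by rewrite /L /e /=; lra.
- by move=> y Dy; apply: cvgD; apply: cvgMl_tmp; [exact: cf1|exact: cf2].
- by move=> y Dy; apply: cvgB; apply: cvgMl_tmp; [exact: cf2|exact: cf1].
move=> y y' Dy Dy' EL EM; apply: (chart_disc_inj dc) => //.
have e_neq0 : e.1 ^+ 2 + e.2 ^+ 2 != 0 by rewrite gt_eqF.
have f1E z : (e.1 ^+ 2 + e.2 ^+ 2) * (f z).1 = e.1 * L z - e.2 * M z by rewrite /L /M; lra.
have f2E z : (e.1 ^+ 2 + e.2 ^+ 2) * (f z).2 = e.2 * L z + e.1 * M z by rewrite /L /M; lra.
rewrite (surjective_pairing (f y)) (surjective_pairing (f y')).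
by congr (_, _); apply: (mulfI e_neq0); rewrite ?f1E ?f2E EL EM.
Qed.

Section OrderedSections.
Variables (R : realType) (S : topologicalType) (v : R -> S -> S).

Record ordered_section (x : S) (Z : set S) (d : R) (lt : rel S) : Prop := OrderedSection {
  ordered_local_section : local_section v x Z d;
  ordered_order : separating_order Z lt;
  ordered_seg_closed : forall u w, Z u -> Z w -> closed (seg Z lt u w) }.

Hypotheses (hv : flow v) (hS : surface R S) (hcpt : compact [set: S]).

Lemma near_flow_strip (D : set S) (L : S -> R) (d k : R) (x : S) : 0 < d ->
  open D -> (forall y, D y -> L @ y --> L y) ->
  (forall t, `[- d, d]%classic t -> D (v t x)) -> L (v (- d) x) < k < L (v d x) ->
  \forall y \near x, (forall t, `[- d, d]%classic t -> D (v t y)) /\ L (v (- d) y) < k < L (v d y).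
Proof.
move=> d0 oD cL Dx /andP[low high].
have [Id INd] : `[- d, d]%classic d /\ `[- d, d]%classic (- d).
  by rewrite /= !in_itv/=; lra.
have cLv t : `[- d, d]%classic t -> (L \o v t) @ x --> L (v t x).
  by move=> It N /(cL _ (Dx t It)); exact: (flow_near hv).
have near_D : \forall y \near x, forall t, `[- d, d]%classic t -> D (v t y).
  apply: compact_near_forall; first exact: segment_compact.
  by move=> t It; apply: (flow_near2 hv); apply: open_nbhs_nbhs; split => //; exact: Dx.
have near_low : \forall y \near x, L (v (- d) y) < k by have /cvgr_lt := cLv _ INd; exact.
have near_high : \forall y \near x, k < L (v d y) by have /cvgr_gt := cLv _ Id; exact.
by apply: filterS3 near_D near_low near_high => y Dy -> ->.
Qed.

Lemma ordered_section_exists x : ~ singular_pt v x ->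
  exists Z d lt, ordered_section x Z d lt.
Proof.
move=> nsx; have [f [g [r dc]]] := disc_chart_exists (hS.2 x).
pose D := chart_disc g (f x) r.
have oD : open D by exact: (chart_disc_open dc).
have Dx : D x by exact: (chart_disc_center dc (chart_radius_gt0 dc)).
have [e0 e00 De0] : exists2 e0, 0 < e0 & forall t, `|t| < e0 -> D (v t x).
  have /nbhs_ballP[e0 /= e00 ballD] : \forall t \near (0 : R), D (v t x).
    by apply: (flow_near_time hv); rewrite (flow0 hv); exact: open_nbhs_nbhs.
  by exists e0 => // t te; apply: ballD; rewrite -ball_normE /= sub0r normrN.
have [d /andP[d0 de0] sections] := local_section_exists hv hS hcpt nsx e00.
pose d' := d / 2; have d'0 : 0 < d' by rewrite divr_gt0.
have d'd : d' + d' = d by rewrite -splitr.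
have Dd t : `[- d', d']%classic t -> D (v t x).
  by rewrite /= in_itv/= => tI; apply: De0; rewrite ltr_norml; lra.
have [Id' INd'] : `[- d', d']%classic d' /\ `[- d', d']%classic (- d').
  by rewrite /= !in_itv/=; lra.
have x_moves : v d' x <> v (- d') x.
  move=> /(flow_eqB hv) E; have [Z1 [_ [ls _ _ _ _]]] := sections setT filterT.
  have := section_transverse ls (section_base ls) (section_base ls) _ E.
  by rewrite opprK ger0_norm; lra.
have [L [M [Lx cL cM LM_inj]]] := separating_coordinates dc (Dd _ Id') (Dd _ INd') x_moves.
pose k := (L (v d' x) + L (v (- d') x)) / 2.
have kx : L (v (- d') x) < k < L (v d' x) by rewrite /k; lra.
have [Z1 [Z2 [ls1 ls2 Z12 Z2M clZ]]] := sections _ (near_flow_strip d'0 oD cL Dd kx).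
pose lt := winding_lt v L M d'.
have so : separating_order Z2 lt.
  apply: (winding_separating_order hv hS.1 cL cM LM_inj d'0).
  - by move=> u t /Z2M[Du _]; exact: Du.
  - move=> u w t Zu Zw uw; rewrite /= in_itv/= => tI /(flow_eqB hv); rewrite opprK => E.
    have tt0 : t + t = 0 by apply: (section_transverse ls2 Zw Zu _ E); rewrite ltr_norml; lra.
    by apply: uw; rewrite -E tt0 (flow0 hv).
  - by move=> u w /Z2M[_ /andP[ku _]] /Z2M[_ /andP[_ kw]]; exact: lt_trans ku kw.
exists Z1, d, lt; split => //; first exact: (separating_orderS so Z12).
by move=> u w; exact: (seg_closed so (section_connected ls1) Z12 clZ).
Qed.

End OrderedSections.

(** * Coordinates near a section and return maps *)

Definition box_coord (R : realType) (S : topologicalType) (v : R -> S -> S) (Z : set S) (d : R)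
    (b : S) : S * R :=
  xget (b, 0) [set p | [/\ Z p.1, `|p.2| < d & v p.2 p.1 = b]].

Section SectionCoordinates.
Variables (R : realType) (S : topologicalType) (v : R -> S -> S).
Hypothesis hv : flow v.
Variables (x : S) (Z : set S) (d : R).
Hypothesis ls : local_section v x Z d.
Implicit Types (b u w : S) (s t e : R) (N C : set S).

Let d0 : 0 < d := section_radius_gt0 ls.

Definition box : set S := flow_box v Z setT d.
Definition box_proj b : S := (box_coord v Z d b).1.
Definition box_time b : R := (box_coord v Z d b).2.

Lemma box_open : open box.
Proof. by apply: (flow_box_open ls); [exact: openT|rewrite lexx d0]. Qed.

Lemma box_coordP b : box b ->
  [/\ Z (box_proj b), `|box_time b| < d & v (box_time b) (box_proj b) = b].
Proof.
move=> [u [t [Zu _ td ub]]]; suff coord : exists p : S * R,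
    [set p | [/\ Z p.1, `|p.2| < d & v p.2 p.1 = b]] p by exact: (xgetPex (b, 0) coord).
by exists (u, t).
Qed.

Lemma section_uniq u w s t : Z u -> Z w -> `|s - t| < 2 * d -> v s u = v t w ->
  u = w /\ s = t.
Proof.
move=> Zu Zw st /(flow_eqB hv) E; have st0 := section_transverse ls Zw Zu st E.
by rewrite -E st0 (flow0 hv); split => //; apply/eqP; rewrite -subr_eq0 st0.
Qed.

Lemma section_return_ge u t : Z u -> Z (v t u) -> t != 0 -> 2 * d <= `|t|.
Proof.
move=> Zu Zt t0; rewrite leNgt; apply/negP => td.
by rewrite (section_transverse ls Zt Zu td erefl) eqxx in t0.
Qed.

Lemma box_flow u t : Z u -> `|t| < d -> box (v t u).
Proof. by move=> Zu td; exists u, t. Qed.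

Lemma box_coord_flow u t : Z u -> `|t| < d -> box_proj (v t u) = u /\ box_time (v t u) = t.
Proof.
move=> Zu td; have [Zp pd E] := box_coordP (box_flow Zu td).
by apply: section_uniq E => //; rewrite (le_lt_trans (ler_normB _ _))//; lra.
Qed.

Lemma section_box u : Z u -> box u.
Proof. by move=> Zu; rewrite -(flow0 hv u); apply: box_flow; rewrite ?normr0. Qed.

Lemma section_coord u : Z u -> box_proj u = u /\ box_time u = 0.
Proof. by move=> Zu; rewrite -{1 3}(flow0 hv u); apply: box_coord_flow; rewrite ?normr0. Qed.

Lemma near_box b : box b -> \forall b' \near b, box b'.
Proof. by move=> Bb; exact: open_nbhs_nbhs (conj box_open Bb). Qed.

Lemma box_proj_near b N : box b -> nbhs (box_proj b) N ->
  \forall b' \near b, [/\ box b', Z (box_proj b') & N (box_proj b')].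
Proof.
move=> Bb; rewrite nbhsE => -[W [oW Wb] WN]; have [Zb tb E] := box_coordP Bb.
have : nbhs b (flow_box v Z W d).
  apply: open_nbhs_nbhs; split; first by apply: (flow_box_open ls) => //; rewrite lexx d0.
  by exists (box_proj b), (box_time b).
apply: filterS => b' [u [t [Zu Wu td <-]]].
by have [-> _] := box_coord_flow Zu td; split => //; [exact: box_flow|exact: WN].
Qed.

Lemma box_time_near b e : box b -> 0 < e ->
  \forall b' \near b, box b' /\ `|box_time b - box_time b'| < e.
Proof.
move=> Bb e0; have [Zb tb E] := box_coordP Bb.
pose r := Num.min e (d - `|box_time b|).
have r0 : 0 < r by rewrite lt_min e0 subr_gt0.
have rd : r <= d by rewrite ge_min gerBl normr_ge0 orbT.
have /(open_flow_image hv (box_time b)) oB : open (flow_box v Z setT r).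
  by apply: (flow_box_open ls); [exact: openT|rewrite r0].
have Bb' : [set v (box_time b) y | y in flow_box v Z setT r] b.
  by exists (box_proj b) => //; exists (box_proj b), 0; rewrite normr0 (flow0 hv).
apply: filterS (open_nbhs_nbhs (conj oB Bb')) => _ [_ [u [t [Zu _ td <-]]] <-].
move: td; rewrite lt_min => /andP[te td].
have sd : `|box_time b + t| < d by rewrite (le_lt_trans (ler_normD _ _))//; lra.
rewrite -(flowD hv); split; first exact: box_flow.
by have [_ ->] := box_coord_flow Zu sd; rewrite opprD addrA subrr sub0r normrN.
Qed.

Definition return_map s u : S := box_proj (v s u).
Definition return_delay s u : R := box_time (v s u).

Lemma return_mapP s u : box (v s u) ->
  [/\ Z (return_map s u), `|return_delay s u| < d &
      v s u = v (return_delay s u) (return_map s u)].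
Proof. by move=> /box_coordP[]. Qed.

Lemma return_mapE s u : box (v s u) -> return_map s u = v (s - return_delay s u) u.
Proof. by move=> /return_mapP[_ _ /(flow_eqB hv)]. Qed.

Lemma return_map_fixed s y : Z y -> v s y = y ->
  [/\ box (v s y), return_map s y = y & return_delay s y = 0].
Proof.
move=> Zy E; have [py ty] := section_coord Zy.
by rewrite /return_map /return_delay E; split => //; exact: section_box.
Qed.

Lemma return_map_near s u N : box (v s u) -> nbhs (return_map s u) N ->
  \forall w \near u, [/\ box (v s w), Z (return_map s w) & N (return_map s w)].
Proof. by move=> Bu Nu; exact: flow_near (box_proj_near Bu Nu). Qed.

Lemma return_delay_near s u e : box (v s u) -> 0 < e ->
  \forall w \near u, box (v s w) /\ `|return_delay s u - return_delay s w| < e.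
Proof. by move=> Bu e0; exact: flow_near (box_time_near Bu e0). Qed.

Lemma return_map_within s C : (forall u, C u -> box (v s u)) ->
  {within C, continuous (return_map s)}.
Proof.
move=> CB; apply: continuous_in_subspaceT => u /set_mem/CB Bu N Nu.
by apply: filterS (return_map_near Bu Nu) => w [].
Qed.

Lemma return_map_shift s t u : box (v s u) -> `|return_delay s u + t| < d ->
  return_map (s + t) u = return_map s u /\ return_delay (s + t) u = return_delay s u + t.
Proof.
move=> /return_mapP[Zr _ Eu] delay; have := box_coord_flow Zr delay.
suff <- : v (s + t) u = v (return_delay s u + t) (return_map s u) by [].
by rewrite addrC (flowD hv t) Eu -(flowD hv) addrC.
Qed.

Lemma return_mapD s t u : box (v s u) -> box (v t (return_map s u)) ->
  `|return_delay s u + return_delay t (return_map s u)| < d ->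
  box (v (s + t) u) /\ return_map (s + t) u = return_map t (return_map s u).
Proof.
move=> /return_mapP[_ _ Eu] /return_mapP[Zw _ Ew] delay.
have E : v (s + t) u = v (return_delay s u + return_delay t (return_map s u))
    (return_map t (return_map s u)).
  by rewrite addrC (flowD hv t) Eu (flowC hv) Ew -(flowD hv).
by rewrite /return_map E; have [] := box_coord_flow Zw delay; split => //; exact: box_flow.
Qed.

Lemma return_mapK s u : Z u -> box (v s u) ->
  box (v (- s) (return_map s u)) /\ return_map (- s) (return_map s u) = u.
Proof.
move=> Zu /return_mapP[_ sd Eu].
have E : v (- s) (return_map s u) = v (- return_delay s u) u.
  have /(congr1 (v (- s))) := Eu; rewrite (flowK hv) (flowC hv).
  move=> /(congr1 (v (- return_delay s u))).
  by rewrite (flowK hv).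
rewrite {2}/return_map E; have [|-> _] := @box_coord_flow u (- return_delay s u) Zu.
  by rewrite normrN.
by split => //; apply: box_flow; rewrite ?normrN.
Qed.

Lemma return_map_inj s u w : Z u -> Z w -> box (v s u) -> box (v s w) ->
  return_map s u = return_map s w -> u = w.
Proof.
move=> Zu Zw Bu Bw E.
by have [_ <-] := return_mapK Zu Bu; have [_ <-] := return_mapK Zw Bw; rewrite E.
Qed.

Lemma section_locally_connected w N : surface R S -> Z w -> nbhs w N ->
  exists C, [/\ connected C, C `<=` Z, C `<=` N, C w & \forall y \near w, Z y -> C y].
Proof.
move=> hS Zw Nw; have [pw _] := section_coord Zw.
have : \forall b \near w, [/\ box b, Z (box_proj b) & N (box_proj b)].
  by apply: box_proj_near; [exact: section_box|rewrite pw].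
move=> /(surface_locally_connected hS)[Q [oQ Qw cQ QN]].
exists (box_proj @` Q); split.
- apply: connected_continuous_connected => //.
  apply: continuous_in_subspaceT => b /set_mem/QN[Bb _ _] N' N'b.
  by apply: filterS (box_proj_near Bb N'b) => b' [].
- by move=> _ [b /QN[] ? ? ? <-].
- by move=> _ [b /QN[] ? ? ? <-].
- by exists w.
- apply: filterS (open_nbhs_nbhs (conj oQ Qw)) => y Qy Zy; exists y => //.
  by have [] := section_coord Zy.
Qed.

End SectionCoordinates.

Section SideNearSection.
Variables (R : realType) (S : topologicalType) (v : R -> S -> S).
Hypothesis hv : flow v.
Variables (x : S) (Z : set S) (d : R) (lt : rel S).
Hypothesis os : ordered_section v x Z d lt.

Lemma return_map_side_near (s : R) (u w : S) : box v Z d (v s u) -> Z w ->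
  return_map v Z d s u <> w ->
  \forall u' \near u, lt (return_map v Z d s u') w = lt (return_map v Z d s u) w.
Proof.
move=> Bu Zw ruw; have [Zr _ _] := return_mapP Bu.
have near_r := sep_nearl (ordered_order os) Zr Zw ruw.
by apply: filterS (return_map_near hv (ordered_local_section os) Bu near_r) => u' [_ Zr']; exact.
Qed.

Lemma box_proj_side_near (b w : S) : box v Z d b -> Z w -> box_proj v Z d b <> w ->
  \forall b' \near b, lt (box_proj v Z d b') w = lt (box_proj v Z d b) w.
Proof.
move=> Bb Zw pbw; have [Zp _ _] := box_coordP Bb.
have near_p := sep_nearl (ordered_order os) Zp Zw pbw.
by apply: filterS (box_proj_near hv (ordered_local_section os) Bb near_p) => b' [_ Zp']; exact.
Qed.

End SideNearSection.

Section SectionReversal.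
Variables (R : realType) (S : topologicalType) (v : R -> S -> S).
Hypothesis hv : flow v.
Variables (x : S) (Z : set S) (d : R).
Hypothesis ls : local_section v x Z d.

Lemma flow_box_rev U e : flow_box (fun t => v (- t)) Z U e = flow_box v Z U e.
Proof.
apply/seteqP; split => b [u [t [Zu Uu te ub]]]; exists u, (- t); split => //.
- by rewrite normrN.
- by rewrite normrN.
- by rewrite opprK.
Qed.

Lemma local_section_rev : local_section (fun t => v (- t)) x Z d.
Proof.
split; [exact: section_base ls|exact: section_connected ls|exact: section_radius_gt0 ls| |].
  move=> u w t Zu Zw td E; apply: oppr_inj; rewrite oppr0.
  by apply: (section_transverse ls Zu Zw _ E); rewrite normrN.
by move=> U e oU ed; rewrite flow_box_rev; exact: flow_box_open ls _ _ _ _.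
Qed.

Lemma return_map_rev s u : box v Z d (v s u) ->
  return_map (fun t => v (- t)) Z d (- s) u = return_map v Z d s u.
Proof.
rewrite /return_map opprK; move: (v s u) => b /box_coordP[Zp td E].
have := @box_coord_flow _ _ _ (flow_rev hv) _ _ _ local_section_rev _ (- box_time v Z d b) Zp.
by rewrite normrN opprK E => /(_ td)[].
Qed.

End SectionReversal.

Section OrderedSectionSymmetry.
Variables (R : realType) (S : topologicalType) (v : R -> S -> S).
Variables (x : S) (Z : set S) (d : R) (lt : rel S).
Hypothesis os : ordered_section v x Z d lt.

Lemma ordered_section_flip : ordered_section v x Z d (flip_rel lt).
Proof.
split; first exact: (ordered_local_section os).
  exact: separating_order_flip (ordered_order os).
by move=> u w Zu Zw; rewrite seg_flip; exact: (ordered_seg_closed os).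
Qed.

Lemma ordered_section_rev : ordered_section (fun t => v (- t)) x Z d lt.
Proof.
split; [exact: local_section_rev (ordered_local_section os)|exact: (ordered_order os)|].
exact: (ordered_seg_closed os).
Qed.

Lemma hull_closed u w : Z u -> Z w -> closed (hull Z lt u w).
Proof. by move=> Zu Zw; apply: closedU; exact: (ordered_seg_closed os). Qed.

End OrderedSectionSymmetry.

Lemma return_map_monotone (R : realType) (S : topologicalType) (v : R -> S -> S) x Z d lt
    (C : set S) (s : R) :
  flow v -> ordered_section v x Z d lt -> connected C -> C `<=` Z ->
  (forall u, C u -> box v Z d (v s u)) -> exists e : bool, forall u w, C u -> C w -> u <> w ->
    lt (return_map v Z d s u) (return_map v Z d s w) = lt u w (+) e.
Proof.
move=> hv os cC CZ boxC; have ls := ordered_local_section os.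
apply: (injective_monotone (ordered_order os) (ordered_order os) (section_connected ls) cC CZ).
- by move=> u /boxC/return_mapP[].
- exact: (return_map_within hv ls).
- by move=> u w Cu Cw; apply: (return_map_inj hv ls); [exact: CZ|exact: CZ|exact: boxC|exact: boxC].
Qed.

(** * Periodic orbits *)

Section ReturnMapDynamics.
Variables (R : realType) (S : topologicalType) (v : R -> S -> S).
Hypothesis hv : flow v.

Lemma flow_avoids_near (c p : S) (K : set R) : hausdorff_space S -> compact K ->
  (forall t, K t -> v t c <> p) ->
  exists Y U : set S, [/\ nbhs c Y, nbhs p U & forall u t, Y u -> K t -> ~ U (v t u)].
Proof.
move=> hT cK cp; have : \forall z \near (c, p), forall t, K t -> v t z.1 <> z.2.
  apply: (compact_near_forall (P := fun t z => v t z.1 <> z.2) cK) => t Kt.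
  have [A [B [Ac Bp AB]]] := hausdorff_separation hT (cp t Kt).
  have [[A1 Y] /= [A1t Yc] A1Y] := flow_near2 hv Ac.
  exists (A1, Y `*` B); first by split => //; exists (Y, B).
  move=> [s [u q]] /= [A1s [Yu Bq]] E; suff : set0 q by [].
  by rewrite -AB; split => //; rewrite -E; exact: (A1Y (s, u)).
move=> [[Y U] /= [Yc Up] YU]; exists Y, U; split => // u t Yu Kt Uv.
exact: (YU (u, v t u)) Kt erefl.
Qed.

Variables (x : S) (Z : set S) (d : R).
Hypothesis ls : local_section v x Z d.

Let d0 : 0 < d := section_radius_gt0 ls.

Lemma return_map_avoids (T : R) (A U : set S) : 2 * d <= T ->
  (forall u, A u -> box v Z d (v T u) /\ A (return_map v Z d T u)) ->
  (forall u t, A u -> 0 <= t <= T + d -> ~ U (v t u)) ->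
  forall u t, A u -> 0 <= t -> ~ U (v t u).
Proof.
move=> dT invA avoids.
have avoids_up_to (n : nat) : forall u t, A u -> 0 <= t -> t < n%:R * d -> ~ U (v t u).
  elim: n => [u t _ t0|n IH u t Au t0 tn]; first by rewrite mul0r ltNge t0.
  have [tT|tT] := leP t (T + d); first by apply: avoids => //; rewrite t0.
  have [Bu Ar] := invA u Au; have [_ rd _] := return_mapP Bu.
  have -> : v t u = v (t - (T - return_delay v Z d T u)) (return_map v Z d T u).
    by rewrite (return_mapE hv Bu) -(flowD hv) subrK.
  move: d0 dT rd tn; rewrite ltr_norml -natr1 mulrDl mul1r => d0' dT' rd tn.
  by apply: IH => //; lra.
move=> u t Au t0; apply: (avoids_up_to (Num.bound (t / d))) => //.
by rewrite -ltr_pdivrMr//; apply: archi_boundP; exact: divr_ge0 (ltW d0).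
Qed.

Lemma absorbed_not_returns (p : S) (s : R) (A U : set S) : Z (v s p) ->
  (\forall z \near v s p, Z z -> A z) -> nbhs p U ->
  (forall u t, A u -> 0 <= t -> ~ U (v t u)) -> ~ returns v p.
Proof.
move=> Zs nearA Up avoids rp.
have Bs : box v Z d (v s p) by exact: section_box hv _ _ _ ls _ Zs.
have near_A : nbhs (return_map v Z d s p) [set z | Z z -> A z].
  by rewrite /return_map; have [-> _] := section_coord hv ls Zs.
have : \forall w \near p, U w /\ forall t, s + d <= t -> ~ U (v t w).
  apply: filterS2 Up (return_map_near hv ls Bs near_A) => w Uw [Bw Zw Aw].
  split => // t st; have [_ rd Ew] := return_mapP Bw.
  have -> : v t w = v (t - s + return_delay v Z d s w) (return_map v Z d s w).
    by rewrite (flowD hv) -Ew -(flowD hv) subrK.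
  by apply: avoids; [exact: Aw|move: rd; rewrite ltr_norml; lra].
move=> nearU; have [t st [Ut avoid_t]] := rp (s + d) _ nearU.
have [t0|t0] := leP 0 t.
  by have [_ /(_ t)] := nbhs_singleton nearU; apply; rewrite // ltW// -(ger0_norm t0).
apply: (avoid_t (- t)); first by rewrite ltW// -(ltr0_norm t0).
by rewrite (flowK hv); exact: nbhs_singleton Up.
Qed.

End ReturnMapDynamics.

Section Trap.
Variables (R : realType) (S : topologicalType) (v : R -> S -> S).
Hypotheses (hv : flow v) (hS : surface R S) (hcpt : compact [set: S]).
Variables (x : S) (Z : set S) (d : R) (lt : rel S).
Hypothesis os : ordered_section v x Z d lt.
Variables (y p : S) (T : R).

Let ls := ordered_local_section os.
Let so := ordered_order os.
Let cZ := section_connected ls.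
Let h : S -> S := return_map v Z d T.
Let I : set S := seg Z lt y p.

Hypotheses (Zy : Z y) (Zp : Z p) (yp : lt y p) (dT : 2 * d <= T).
Hypothesis box_seg : forall u, I u -> box v Z d (v T u).
Hypotheses (hy : h y = y) (yhp : lt y (h p)) (hpp : lt (h p) p).
Hypothesis aperiodic : forall t, 0 < t -> v t p <> p.

Let Iy : I y. Proof. by apply: (segl so) => //; rewrite (sep_asym so Zy Zp yp). Qed.
Let Ip : I p. Proof. by apply: (segr so) => //; rewrite (sep_asym so Zy Zp yp). Qed.
Let IZ u : I u -> Z u. Proof. by case. Qed.
Let hZ u : I u -> Z (h u). Proof. by move=> /box_seg/return_mapP[]. Qed.

Lemma trap_increasing u w : I u -> I w -> lt (h u) (h w) = lt u w.
Proof.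
move=> Iu Iw; have cI : connected I by exact: (seg_connected so cZ Zy Zp).
have [e mono] := return_map_monotone hv os cI IZ box_seg.
have e0 : e = false.
  have := mono _ _ Iy Ip (sep_neq so Zy yp); rewrite -!/(h _) hy yhp yp.
  by case: (e).
have [->|uw] := pselect (u = w).
  by have [Zw Zhw] := (IZ Iw, hZ Iw); rewrite !(sep_irr so).
by rewrite mono// e0 addbF.
Qed.

Lemma trap_invariant u : I u -> I (h u).
Proof.
move=> Iu; have [Zu yu up] := Iu; split; first exact: hZ.
  by rewrite -[X in lt _ X]hy trap_increasing.
apply: (sep_le_trans so cZ (hZ Iu) (hZ Ip) Zp); first by rewrite trap_increasing.
by rewrite (sep_asym so (hZ Ip) Zp hpp).
Qed.

Let P n := iter n h p.

Let IP n : I (P n). Proof. by elim: n => //= n; exact: trap_invariant. Qed.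
Let ZP n : Z (P n). Proof. exact: IZ. Qed.

Lemma trap_decreasing n : lt (P n.+1) (P n).
Proof. by elim: n => [//|n]; rewrite -(trap_increasing (IP n.+1) (IP n)). Qed.

Lemma trap_nonincreasing m n : (m <= n)%N -> ~~ lt (P m) (P n).
Proof.
elim: n => [|n IH]; first by rewrite leqn0 => /eqP->; rewrite (sep_irr so).
rewrite leq_eqVlt => /orP[/eqP->|/IH mn]; first by rewrite (sep_irr so).
by apply: (sep_le_trans so cZ (ZP _) (ZP n)) => //; rewrite (sep_asym so _ _ (trap_decreasing n)).
Qed.

Lemma trap_orbit n : exists s, P n = v s p.
Proof.
elim: n => [|n [s E]]; first by exists 0; rewrite (flow0 hv).
exists (T - return_delay v Z d T (P n) + s).
by rewrite (flowD hv) -E -return_mapE//; exact: box_seg.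
Qed.

Lemma trap_limit : exists2 c, I c & (forall n, lt c (P n)) /\
  forall N : set S, nbhs c N -> exists n, seg Z lt c (P n) `<=` N.
Proof.
have [c [_ clP]] : exists c, [set: S] c /\ cluster (P @ \oo) c.
  by apply: hcpt; exact: filterT.
have below n : seg Z lt y (P n) c.
  rewrite ((closure_id _).1 (ordered_seg_closed os Zy (ZP n))) => N Nc.
  apply: clP => //; exists n => // m /= nm; split => //; first by case: (IP m).
  exact: trap_nonincreasing.
have Zc : Z c by case: (below 0%N).
have c_lt n : lt c (P n).
  have [_ _ cP] := below n.+1.
  exact: (sep_le_lt_trans so cZ Zc (ZP _) (ZP _) cP (trap_decreasing n)).
exists c; first exact: below 0%N.
split => // N Nc.
have [C [cC CZ CN Cc nearC]] := section_locally_connected hv ls hS Zc Nc.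
have [_ [[n _ <-] CP]] : (range P `&` [set z | Z z -> C z]) !=set0.
  by apply: clP => //; exists 0%N => // m _ /=; exists m.
exists n; apply: subset_trans CN.
exact: (connected_seg_sub so cC CZ Cc (CP (ZP n))).
Qed.

Lemma trap_limit_fixed c : I c -> (forall n, lt c (P n)) ->
  (forall N : set S, nbhs c N -> exists n, seg Z lt c (P n) `<=` N) -> h c = c.
Proof.
move=> Ic cP nested; have Zc := IZ Ic; apply: contrapT => hc.
have in_seg n : seg Z lt c (P n) (P n) by apply: (segr so) => //; rewrite (sep_asym so Zc _ (cP n)).
have [hcc|chc] := boolP (lt (h c) c).
  have [n segN] := nested _ (return_map_near hv ls (box_seg Ic) (sep_nearl so (hZ Ic) Zc hc)).
  have [_ _ /(_ (ZP n.+1))] := segN _ (in_seg n).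
  by rewrite -/(h _) -/(P n.+1) hcc (sep_asym so Zc _ (cP n.+1)).
have {}chc : lt c (h c) by apply: (sep_neq_le_lt so Zc (hZ Ic)) => //; exact/nesym.
have [n /(_ _ (in_seg n))/(_ (ZP n))] := nested _ (sep_nearl so Zc (hZ Ic) (nesym hc)).
rewrite chc => Phc; have := sep_trans so cZ (ZP n.+1) (ZP n) (hZ Ic) (trap_decreasing n) Phc.
by rewrite [P n.+1]/(h (P n)) trap_increasing// (sep_asym so Zc _ (cP n)).
Qed.

(* The iterates of p under the return map decrease to a periodic point c, and the
   orbits of all points near p end up close to the orbit of c, away from p. *)
Lemma trapped_not_returns : ~ returns v p.
Proof.
have [c Ic [cP nested]] := trap_limit; have Zc := IZ Ic.
have hc := trap_limit_fixed Ic cP nested.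
have d0 := section_radius_gt0 ls.
have [_ delay_c _] := return_mapP (box_seg Ic).
have := return_mapE hv (box_seg Ic); rewrite -/h [h c]hc; set per := T - _ => /esym vper.
have per0 : 0 < per by rewrite /per; move: d0 dT delay_c; rewrite ltr_norml; lra.
have cp r : v r c <> p.
  by move=> E; apply: (aperiodic per0); rewrite -E (flowC hv) vper.
have [Y [U [Yc Up YU]]] :=
  flow_avoids_near hv hS.1 (@segment_compact R 0 (T + d)) (fun t _ => cp t).
have [n segY] := nested _ Yc.
pose A := seg Z lt c (P n).
have AI u : A u -> I u.
  apply: (seg_subset so cZ Zc (ZP n) Zy Zp); first by case: Ic.
  by case: (IP n).
have invA u : A u -> box v Z d (v T u) /\ A (h u).
  move=> Au; have Iu := AI u Au; have [Zu cu uP] := Au; split; first exact: box_seg.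
  split; first exact: hZ.
    by rewrite -[X in lt _ X]hc trap_increasing.
  apply: (sep_le_trans so cZ (hZ Iu) (ZP n.+1) (ZP n)).
    by rewrite [P n.+1]/(h (P n)) trap_increasing.
  by rewrite (sep_asym so _ _ (trap_decreasing n)).
have avoids u t : A u -> 0 <= t -> ~ U (v t u).
  apply: (return_map_avoids hv ls dT invA) => w r Aw rT.
  by apply: YU; [exact: segY|rewrite /= in_itv].
have [s Ps] := trap_orbit n.+1.
apply: (absorbed_not_returns hv ls (s := s) _ _ Up avoids); rewrite -Ps //.
have c_near := sep_nearr so Zc (ZP n.+1) (sep_neq so Zc (cP n.+1)).
have P_near := sep_nearl so (ZP n.+1) (ZP n) (sep_neq so (ZP n.+1) (trap_decreasing n)).
apply: filterS2 c_near P_near => z cz zP Zz; split => //.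
  by rewrite (sep_asym so Zc)// cz.
by rewrite (sep_asym so _ (ZP n))// zP// trap_decreasing.
Qed.

End Trap.

Section PeriodicNeighbourhood.
Variables (R : realType) (S : topologicalType) (v : R -> S -> S).
Hypotheses (hv : flow v) (hS : surface R S) (hcpt : compact [set: S]).

Section NearPeriodicPoint.
Variables (y : S) (Z : set S) (d : R) (lt : rel S).
Hypothesis os : ordered_section v y Z d lt.

Let ls := ordered_local_section os.
Let so := ordered_order os.
Let d0 : 0 < d := section_radius_gt0 ls.
Let Zy : Z y := section_base ls.
Let ret := return_map v Z d.

Lemma near_return_map_fixed (T e : R) (N : set S) : v T y = y -> 0 < e -> nbhs y N ->
  \forall u \near y, [/\ box v Z d (v T u), N (ret T u) & `|return_delay v Z d T u| < e].
Proof.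
move=> vTy e0 Ny; have [By rety dely] := return_map_fixed hv ls Zy vTy.
have Nret : nbhs (ret T y) N by rewrite /ret rety.
apply: filterS2 (return_map_near hv ls By Nret) (return_delay_near hv ls By e0) => u.
by move=> [Bu _ Nu] [_]; rewrite dely sub0r normrN.
Qed.

Lemma near_double_return (T : R) : v T y = y -> \forall u \near y, Z u ->
  box v Z d (v (T + T) u) /\ lt y (ret (T + T) u) = lt y u.
Proof.
move=> vTy; have [By rety dely] := return_map_fixed hv ls Zy vTy.
have d20 : 0 < d / 2 by rewrite divr_gt0.
have near_T := near_return_map_fixed vTy d20 (@filterT _ _ (nbhs_filter y)).
have [C [cC CZ CN Cy nearC]] := section_locally_connected hv ls hS Zy near_T.
have boxC u : C u -> box v Z d (v T u) by move=> /CN[].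
have retZ u : C u -> Z (ret T u) by move=> /boxC/return_mapP[].
have [e mono] := return_map_monotone hv os cC CZ boxC.
have side u : C u -> u <> y -> lt y (ret T u) = lt y u (+) e.
  by move=> Cu uy; rewrite -[X in lt X (ret _ _)]rety; apply: mono => //; exact/nesym.
apply: filterS2 nearC (near_return_map_fixed vTy d20 nearC) => u Cu [Bu Cru _] Zu.
have {}Cu := Cu Zu; have {}Cru := Cru (retZ u Cu).
have [_ _ delay_u] := CN _ Cu; have [_ _ delay_ru] := CN _ Cru.
have [|BTT retTT] := return_mapD hv ls Bu (boxC _ Cru).
  by rewrite (le_lt_trans (ler_normD _ _))//; move: delay_u delay_ru; lra.
split => //; rewrite [ret _ u]retTT -/(ret T u) -/(ret T (ret T u)).
have [->|uy] := pselect (u = y); first by rewrite [ret T y]rety [ret T y]rety.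
have ruy : ret T u <> y.
  move=> E; apply: uy; apply: (return_map_inj hv ls Zu Zy Bu By).
  by rewrite -/(ret T u) E rety.
by rewrite side// side// -addbA addbb addbF.
Qed.

Lemma double_return_domain (T : R) : v T y = y -> exists C, [/\ connected C, C `<=` Z, C y,
  \forall u \near y, Z u -> C u & forall u t, C u -> t = T + T \/ t = - (T + T) ->
  box v Z d (v t u) /\ lt y (ret t u) = lt y u].
Proof.
move=> vTy; have vNTy : v (- T) y = y by rewrite -{1}vTy (flowK hv).
have near_back : \forall u \near y, Z u ->
    box v Z d (v (- (T + T)) u) /\ lt y (ret (- (T + T)) u) = lt y u.
  by rewrite opprD; exact: near_double_return.
have [C [cC CZ CN Cy nearC]] :=
  section_locally_connected hv ls hS Zy (filterI (near_double_return vTy) near_back).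
exists C; split => // u t Cu; have [forth back] := CN u Cu.
by move=> [->|->]; [apply: forth|apply: back]; exact: CZ.
Qed.

Lemma inverse_return_lt (T : R) (C : set S) (p : S) : v (- T) y = y -> connected C -> C `<=` Z ->
  C y -> (forall u, C u -> box v Z d (v (- T) u) /\ lt y (ret (- T) u) = lt y u) ->
  C p -> lt y p -> box v Z d (v T p) -> C (ret T p) -> lt p (ret T p) -> lt (ret (- T) p) p.
Proof.
move=> vNTy cC CZ Cy back Cp yp Bp Crp prp.
have boxC u : C u -> box v Z d (v (- T) u) by move=> /back[].
have [e mono] := return_map_monotone hv os cC CZ boxC.
have [_ rety _] := return_map_fixed hv ls Zy vNTy.
have [_ retK] := return_mapK hv ls (CZ _ Cp) Bp; have [_ yk] := back p Cp.
have e0 : e = false.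
  have := mono y p Cy Cp (sep_neq so Zy yp); rewrite rety [lt y _]yk yp.
  by case: (e).
by have := mono p _ Cp Crp (sep_neq so (CZ _ Cp) prp); rewrite retK prp e0.
Qed.

Lemma near_periodic_side (T : R) : 0 < T -> v T y = y ->
  \forall p \near y, Z p -> lt y p -> returns v p -> closed_pt v p.
Proof.
move=> T0 vTy; have vTTy : v (T + T) y = y by rewrite (flowD hv) !vTy.
have vNTTy : v (- (T + T)) y = y by rewrite -{1}vTTy (flowK hv).
have dT : 2 * d <= T + T.
  have := section_return_ge ls Zy (t := T); rewrite vTy gt_eqF// (gtr0_norm T0).
  by move=> /(_ Zy isT); move: T0; lra.
have [C [cC CZ Cy nearC double]] := double_return_domain vTy.
have forth u Cu := double u (T + T) Cu (or_introl erefl).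
have back u Cu := double u (- (T + T)) Cu (or_intror erefl).
have near_C := near_return_map_fixed vTTy d0 nearC.
apply: filterS2 nearC near_C => p Cp [_ Cgp _] Zp yp rp; have {}Cp := Cp Zp.
apply: contrapT => ncp.
have aperiodic t : t != 0 -> v t p <> p by move=> t0 /(period_closed_pt hv t0).
have segC : seg Z lt y p `<=` C by exact: (connected_seg_sub so).
have [Bp yg] := forth p Cp; have [Zg delay_p _] := return_mapP Bp.
have gp : ret (T + T) p <> p.
  rewrite /ret (return_mapE hv Bp); apply: aperiodic; rewrite subr_eq0.
  by apply/eqP => E; move: delay_p; rewrite -E ger0_norm; move: d0 dT; lra.
have [gpp|pgp] := boolP (lt (ret (T + T) p) p).
  apply: (trapped_not_returns hv hS hcpt os Zy Zp yp dT) rp => //.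
  - by move=> u /segC/forth[].
  - by have [_ ->] := return_map_fixed hv ls Zy vTTy.
  - by rewrite -/ret yg.
  - by move=> t t0; apply: aperiodic; rewrite gt_eqF.
have {}pgp : lt p (ret (T + T) p) by apply: (sep_neq_le_lt so) => //; exact/nesym.
have revE u : C u -> return_map (fun t => v (- t)) Z d (T + T) u = ret (- (T + T)) u.
  by move=> /back[Bu _]; rewrite -{1}[T + T]opprK (return_map_rev hv ls Bu).
have kpp : lt (ret (- (T + T)) p) p.
  exact: (inverse_return_lt vNTTy cC CZ Cy back Cp yp Bp (Cgp Zg) pgp).
apply: (trapped_not_returns (flow_rev hv) hS hcpt (ordered_section_rev os) Zy Zp yp dT).
- by move=> u /segC/back[Bu _]; rewrite /box flow_box_rev.
- by rewrite revE//; have [] := return_map_fixed hv ls Zy vNTTy.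
- by rewrite revE//; have [_ ->] := back p Cp.
- by rewrite revE.
- by move=> t t0; apply: aperiodic; rewrite oppr_eq0 gt_eqF.
- exact: returns_rev.
Qed.

End NearPeriodicPoint.

Lemma near_periodic_returns_closed (y : S) : periodic_pt v y ->
  \forall p \near y, returns v p -> closed_pt v p.
Proof.
move=> [nsy [T [T0 vTy]]].
have [Z [d [lt os]]] := ordered_section_exists hv hS hcpt nsy.
have ls := ordered_local_section os; have so := ordered_order os; have Zy := section_base ls.
have [By py _] : [/\ box v Z d y, box_proj v Z d y = y & True].
  by have [-> _] := section_coord hv ls Zy; split => //; exact: (section_box hv ls).
have near_y : \forall p \near y, Z p -> returns v p -> closed_pt v p.
  apply: filterS2 (near_periodic_side os T0 vTy)
    (near_periodic_side (ordered_section_flip os) T0 vTy) => p above below Zp rp.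
  have [<-|yp] := pselect (y = p); first by right; split => //; exists T.
  have [yp'|py'] := boolP (lt y p); first exact: above.
  apply: below => //; apply: (sep_neq_le_lt so) => //; exact/nesym.
rewrite -py in near_y; apply: filterS (box_proj_near hv ls By near_y) => q [Bq Zp closed_p] rq.
have [_ td E] := box_coordP Bq; rewrite -E; apply: (closed_pt_flow hv); apply: closed_p => //.
by have := returns_flow hv (s := - box_time v Z d q) rq; rewrite -{2}E (flowK hv).
Qed.

End PeriodicNeighbourhood.

(** * The torsor dual to a loop *)

Lemma dual_torsor (T : topologicalType) (L : set T) (F : set (set T * (T -> bool))) :
  closed L -> (forall c, F c -> open c.1) ->
  (forall a, L a -> exists2 c, F c & c.1 a) ->
  (forall c a, F c -> c.1 a -> ~ L a -> \forall b \near a, c.2 b = c.2 a) ->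
  (forall c c' a, F c -> F c' -> c.1 a -> c'.1 a -> L a ->
     \forall b \near a, c.2 b (+) c'.2 b = c.2 a (+) c'.2 a) ->
  torsor_on setT [set c | c = (~` L, fun=> false) \/ F c].
Proof.
move=> cL oF covL off_L on_L; split.
- move=> c a Fc _ ca; have oc : open c.1 by case: Fc => [->|/oF//]; exact: closed_openC.
  by apply: filterS (open_nbhs_nbhs (conj oc ca)).
- move=> a _; have [/covL[c Fc ca]|nLa] := pselect (L a); first by exists c => //; right.
  by exists (~` L, fun=> false) => //; left.
move=> c c' Fc Fc' a [[_ ca] c'a]; have [La|nLa] := pselect (L a).
  case: Fc ca => [->//|Fc] ca; case: Fc' c'a => [->//|Fc'] c'a.
  by apply: filterS (on_L c c' a Fc Fc' ca c'a La).
have off e : ([set c | c = (~` L, fun=> false) \/ F c] : set _) e -> e.1 a ->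
    \forall b \near a, e.2 b = e.2 a.
  by move=> [->|Fe] ea; [exact: nearW|exact: off_L].
by apply: filterS2 (off c Fc ca) (off c' Fc' c'a) => b -> ->.
Qed.

Section LoopTorsor.
Variables (R : realType) (S : topologicalType) (v : R -> S -> S).
Hypotheses (hv : flow v) (hS : surface R S).
Variables (x : S) (Z : set S) (d : R) (lt : rel S).
Hypothesis os : ordered_section v x Z d lt.
Variables (z : S) (s : R).

Let ls := ordered_local_section os.
Let so := ordered_order os.
Let d0 : 0 < d := section_radius_gt0 ls.
Let z' := v s z.
Let J : set S := hull Z lt z z'.
Let proj := box_proj v Z d.
Let time := box_time v Z d.
Let ret := return_map v Z d.
Let delay := return_delay v Z d.

Definition orbit_arc (a b : R) : set S := [set v q z | q in `[a, b]].

Definition section_loop : set S := orbit_arc 0 s `|` J.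

Hypotheses (Zz : Z z) (Zz' : Z z') (s0 : 0 < s).
Hypothesis simple : forall q, 0 < q < s -> ~ J (v q z).

Lemma orbit_arcP a b q : a <= q <= b -> orbit_arc a b (v q z).
Proof. by move=> qab; exists q => //=; rewrite in_itv. Qed.

Lemma orbit_arc_inv a b y : orbit_arc a b y -> exists2 q, a <= q <= b & v q z = y.
Proof. by move=> [q /=]; rewrite in_itv /= => qab <-; exists q. Qed.

Lemma orbit_arc_closed a b : closed (orbit_arc a b).
Proof. exact: (orbit_image_closed hv hS.1 (@segment_compact R a b)). Qed.

Lemma section_loop_closed : closed section_loop.
Proof. by apply: closedU; [exact: orbit_arc_closed|exact: (hull_closed os)]. Qed.

Let d2s : 2 * d <= s.
Proof. by rewrite -(gtr0_norm s0); apply: (section_return_ge ls Zz) => //; rewrite gt_eqF. Qed.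

Lemma orbit_arc_inj q q' : 0 < q < s -> 0 < q' < s -> v q z = v q' z -> q = q'.
Proof.
wlog: q q' / q < q'.
  move=> ordered qs q's E; have [qq'|q'q|//] := ltgtP q q'; first exact: ordered.
  by apply/esym; exact: ordered.
move=> qq' /andP[q0 _] /andP[_ q's] /esym/(flow_eqB hv) E.
by case: (simple (q := q' - q)); [lra|rewrite E; exact: (hulll so)].
Qed.

(* The charts around the loop: one around J, and one around each point v r z of the arc. *)
Definition section_chart : set S := box v Z d `&` ~` orbit_arc d (s - d).

Definition arc_radius (r : R) : R := Num.min d (Num.min r (s - r)).

Definition arc_chart (r : R) : set S :=
  [set a | flow_box v Z setT (arc_radius r) (v (- r) a)] `&`
  ~` (orbit_arc 0 (r - arc_radius r) `|` orbit_arc (r + arc_radius r) s `|` J).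

Definition arc_side (r : R) (a : S) : bool := lt (ret (- r) a) z.

(* [e] says whether the return map from z to z' reverses the sides of the section. *)
Definition return_side (e : bool) (w : S) : bool := if e then ~~ lt z' w else lt w z'.

Definition section_side (e : bool) (a : S) : bool :=
  if 0 <= time a then lt (proj a) z else return_side e (proj a).

Lemma arc_radiusP r : 0 < r < s ->
  [/\ 0 < arc_radius r, arc_radius r <= d, arc_radius r <= r & arc_radius r <= s - r].
Proof.
move=> /andP[r0 rs]; rewrite /arc_radius !lt_min !ge_min !lexx !orbT /= d0 r0 subr_gt0 rs.
by split.
Qed.

Lemma arc_chart_inv r a : 0 < r < s -> arc_chart r a ->
  [/\ box v Z d (v (- r) a), `|delay (- r) a| < arc_radius r &
      a = v (r + delay (- r) a) (ret (- r) a)].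
Proof.
move=> /arc_radiusP[_ rd _ _] [[u [t [Zu _ tr E]]] _].
have td := lt_le_trans tr rd.
have [pu tu] := box_coord_flow hv ls Zu td; rewrite E in pu tu.
rewrite /delay /ret /return_delay /return_map pu tu (flowD hv) E (flowNK hv).
by split => //; rewrite -E; exact: box_flow.
Qed.

Lemma arc_chart_open r : 0 < r < s -> open (arc_chart r).
Proof.
move=> /arc_radiusP[r0 rd _ _]; apply: openI.
  rewrite openE => a /= Ba; apply: (flow_near hv); apply: open_nbhs_nbhs; split => //.
  by apply: (flow_box_open ls); [exact: openT|rewrite r0].
apply: closed_openC; apply: closedU; last exact: (hull_closed os).
by apply: closedU; exact: orbit_arc_closed.
Qed.

Lemma section_chart_open : open section_chart.
Proof. by apply: openI; [exact: (box_open ls)|apply/closed_openC/orbit_arc_closed]. Qed.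

Lemma arc_chart_loop r a : 0 < r < s -> arc_chart r a -> section_loop a ->
  exists q, [/\ 0 < q < s, `|q - r| < arc_radius r, v q z = a &
    ret (- r) a = z /\ delay (- r) a = q - r].
Proof.
move=> rs [_ near_r] [/orbit_arc_inv[q /andP[q0 qs] E]|Ja]; last by case: near_r; right.
have [_ rd rr rsr] := arc_radiusP rs.
have qr : `|q - r| < arc_radius r.
  rewrite ltr_norml ltrBrDr ltrBlDr !ltNge; apply/andP; split; apply/negP => far; apply: near_r.
    by left; left; rewrite -E; apply: orbit_arcP; lra.
  by left; right; rewrite -E; apply: orbit_arcP; lra.
exists q; split => //; first by move: qr; rewrite ltr_norml; lra.
have := box_coord_flow hv ls Zz (lt_le_trans qr rd).
by rewrite addrC (flowD hv) E.
Qed.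

Lemma arc_side_off_loop r a : 0 < r < s -> arc_chart r a -> ~ section_loop a ->
  \forall b \near a, arc_side r b = arc_side r a.
Proof.
move=> rs ra nl; have [Ba tr E] := arc_chart_inv rs ra; have [_ _ rr rsr] := arc_radiusP rs.
apply: (return_map_side_near hv os Ba Zz) => retz; apply: nl; left.
rewrite E [ret _ a]retz; apply: orbit_arcP.
by move: tr rr rsr; rewrite ltr_norml; lra.
Qed.

Lemma arc_side_agree r r' a : 0 < r < s -> 0 < r' < s -> arc_chart r a -> arc_chart r' a ->
  section_loop a -> \forall b \near a, arc_side r b = arc_side r' b.
Proof.
move=> rs r's ra r'a la; have [Ba _ _] := arc_chart_inv rs ra.
have [q [qs _ qa [_ tq]]] := arc_chart_loop rs ra la.
have [q' [q's q'r' q'a _]] := arc_chart_loop r's r'a la.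
have qq' : q = q' by apply: orbit_arc_inj => //; rewrite qa q'a.
have [_ r'd _ _] := arc_radiusP r's.
have e0 : 0 < d - `|q - r'| by rewrite subr_gt0 qq' (lt_le_trans q'r').
apply: filterS (return_delay_near hv ls Ba e0) => b [Bb]; rewrite -/(delay _ _) tq => tb.
have [|shift _] := return_map_shift hv ls (t := r - r') Bb.
  have -> : return_delay v Z d (- r) b + (r - r') = (q - r') - (q - r - delay (- r) b).
    by rewrite /delay; lra.
  by rewrite (le_lt_trans (ler_normB _ _))//; lra.
by rewrite /arc_side /ret -shift addrA addNr add0r.
Qed.

Lemma return_side_near e a : box v Z d a -> proj a <> z' ->
  \forall b \near a, return_side e (proj b) = return_side e (proj a).
Proof.
move=> Ba pz'; case: e; last exact: (box_proj_side_near hv os).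
apply: filterS (box_proj_side_near hv (ordered_section_flip os) Ba Zz' pz') => b.
by rewrite /flip_rel /return_side /proj => ->.
Qed.

Lemma section_side_off_loop e a : section_chart a -> ~ section_loop a ->
  \forall b \near a, section_side e b = section_side e a.
Proof.
move=> [Ba _] nl; have [Zp pt E] := box_coordP Ba; rewrite -/(proj a) -/(time a) in Zp pt E.
have not_arc q w : 0 <= time a + q <= s -> proj a = w -> w <> v q z.
  move=> qs pw wq; apply: nl; left; rewrite -E pw wq -(flowD hv).
  exact: orbit_arcP.
move: pt; rewrite ltr_norml => pt.
have [t0|t0|t0] := ltgtP (time a) 0.
- have near_t := box_time_near hv ls Ba (e := - time a); rewrite oppr_gt0 in near_t.
  have pz' : proj a <> z' by move=> /(not_arc s); apply => //; move: d2s s0; lra.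
  apply: filterS2 (near_t t0) (return_side_near e Ba pz') => b [_ tb] side.
  rewrite -/(time a) -/(time b) ltr_norml in tb.
  have tb0 : (0 <= time b) = false by apply/negbTE; rewrite -ltNge; lra.
  by rewrite /section_side tb0 leNgt t0.
- have near_t := box_time_near hv ls Ba t0.
  have pz : proj a <> z by move=> /(not_arc 0); apply; rewrite ?(flow0 hv)//; move: d2s; lra.
  apply: filterS2 near_t (box_proj_side_near hv os Ba Zz pz) => b [_ tb] side.
  rewrite -/(time a) -/(time b) ltr_norml in tb.
  have tb0 : 0 <= time b by lra.
  by rewrite /section_side tb0 (ltW t0).
- have aE : proj a = a by rewrite -[RHS]E t0 (flow0 hv).
  have nJ : ~ J (proj a) by move=> Ja; apply: nl; right; rewrite -aE.
  have pz : proj a <> z by move=> pz; apply: nJ; rewrite pz; exact: (hulll so).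
  have pz' : proj a <> z' by move=> pz'; apply: nJ; rewrite pz'; exact: (hullr so).
  have sideE : return_side e (proj a) = lt (proj a) z.
    rewrite (hull_side so Zz Zz' Zp nJ) /return_side.
    by case: e; rewrite // (sep_neg so Zp Zz' pz') negbK.
  apply: filterS2 (box_proj_side_near hv os Ba Zz pz) (return_side_near e Ba pz') => b sidez sidez'.
  rewrite [RHS]/section_side t0 lexx /section_side.
  by case: ifP => _; [exact: sidez|rewrite sidez'].
Qed.

Lemma return_side_exists : exists e, \forall u \near z, Z u ->
  box v Z d (v s u) /\ return_side e (ret s u) = lt u z (+) e.
Proof.
have Bz : box v Z d (v s z) by exact: (section_box hv ls).
have rz : ret s z = z' by have [] := section_coord hv ls Zz'.
have [C [cC CZ CB Cz nearC]] :=
  section_locally_connected hv ls hS Zz (flow_near hv (near_box ls Bz)).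
have [e mono] := return_map_monotone hv os cC CZ CB.
exists e; apply: filterS nearC => u Cu Zu; have {}Cu := Cu Zu; have Bu := CB u Cu.
split => //; have [->|uz] := pselect (u = z).
  by rewrite rz /return_side !(sep_irr so)//; case: (e).
have ruz : ret s u <> z'.
  by rewrite -rz => E; apply: uz; exact: (return_map_inj hv ls Zu Zz Bu Bz).
have [Zr _ _] := return_mapP Bu.
have <- : lt (ret s u) z' = lt u z (+) e by rewrite -rz; exact: mono.
by rewrite /return_side; case: (e); rewrite // (sep_neg so Zr Zz' ruz) negbK.
Qed.

Lemma section_arc_agree_start e r q a : box v Z d (v (- r) a) -> delay (- r) a = q - r ->
  0 < q < d -> \forall b \near a, section_side e b = arc_side r b.
Proof.
move=> Ba delay_a /andP[q0 qd]; pose f := Num.min q (d - q).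
have f0 : 0 < f by rewrite lt_min q0 subr_gt0.
apply: filterS (return_delay_near hv ls Ba f0) => b [Bb].
rewrite -/(delay _ _) delay_a -/(delay _ _) lt_min !ltr_norml => tb.
have [|] := return_map_shift hv ls (t := r) Bb; first by rewrite -/(delay _ _) ltr_norml; lra.
rewrite addNr /return_map /return_delay (flow0 hv) -/(proj b) -/(time b) => shift tmb.
rewrite /section_side tmb shift ifT// -/(return_delay v Z d _ b) -/(delay _ b); lra.
Qed.

Lemma section_arc_agree_end e r q a :
  (\forall u \near z, Z u -> box v Z d (v s u) /\ return_side e (ret s u) = lt u z (+) e) ->
  box v Z d (v (- r) a) -> ret (- r) a = z -> delay (- r) a = q - r -> s - d < q < s ->
  \forall b \near a, section_side e b = arc_side r b (+) e.
Proof.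
move=> near_z Ba ret_a delay_a /andP[sdq qs].
pose f := Num.min (q - s + d) (s - q) / 2.
have f0 : 0 < f by rewrite divr_gt0// lt_min; lra.
have [f1 f2] : 2 * f <= q - s + d /\ 2 * f <= s - q.
  by rewrite /f mulrC divfK// !ge_min !lexx orbT.
have Bz : box v Z d (v s z) by exact: (section_box hv ls).
have delay_z : delay s z = 0 by have [] := section_coord hv ls Zz'.
have near_ret N : nbhs z N ->
    \forall b \near a, [/\ box v Z d (v (- r) b), Z (ret (- r) b) & N (ret (- r) b)].
  by rewrite -ret_a; exact: (return_map_near hv ls Ba).
have {}near_z := @filterI _ _ (nbhs_filter z) _ _ near_z (return_delay_near hv ls Bz f0).
apply: filterS2 (return_delay_near hv ls Ba f0) (near_ret _ near_z).
move=> b [_ +] [Bb Zu [/(_ Zu)[Bu side] [_]]].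
rewrite -!/(delay _ _) -!/(ret _ _) delay_a delay_z sub0r normrN !ltr_norml => tb tu.
set u := ret (- r) b in Zu Bu side tu *.
have [_ _ Eb] := return_mapP Bb; have [Zf _ Eu] := return_mapP Bu.
have bE : b = v (delay (- r) b + r - s + delay s u) (ret s u).
  rewrite (flowD hv) -Eu -(flowD hv) subrK addrC (flowD hv).
  by rewrite -[v _ u]Eb (flowNK hv).
have [|pb tmb] := box_coord_flow hv ls (t := delay (- r) b + r - s + delay s u) Zf.
  by rewrite ltr_norml; lra.
rewrite -bE -/(proj b) -/(time b) in pb tmb.
have tb0 : (0 <= time b) = false by apply/negbTE; rewrite -ltNge tmb; lra.
by rewrite /section_side tb0 pb side.
Qed.

Lemma section_arc_agree e r a :
  (\forall u \near z, Z u -> box v Z d (v s u) /\ return_side e (ret s u) = lt u z (+) e) ->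
  0 < r < s -> section_chart a -> arc_chart r a -> section_loop a ->
  \forall b \near a, section_side e b (+) arc_side r b = section_side e a (+) arc_side r a.
Proof.
move=> near_z rs [_ not_arc] ra la; have [Ba _ _] := arc_chart_inv rs ra.
have [q [/andP[q0 qs] _ qa [ret_a delay_a]]] := arc_chart_loop rs ra la.
suff [k near_k] : exists k, \forall b \near a, section_side e b (+) arc_side r b = k.
  by have at_a := nbhs_singleton near_k; apply: filterS near_k => b ->.
have [qd|dq] := ltP q d.
  have qI : 0 < q < d by rewrite q0.
  exists false; apply: filterS (section_arc_agree_start e Ba delay_a qI) => b ->.
  exact: addbb.
have qI : s - d < q < s.
  by rewrite qs andbT ltNge; apply/negP => qsd; apply: not_arc; rewrite -qa; apply: orbit_arcP; lra.
exists e; apply: filterS (section_arc_agree_end near_z Ba ret_a delay_a qI) => b ->.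
by rewrite addbC addKb.
Qed.

Lemma section_loop_cover a : section_loop a ->
  section_chart a \/ exists2 r, 0 < r < s & arc_chart r a.
Proof.
move=> la; have [Ja|nJa] := pselect (J a).
  left; split; first by apply: (section_box hv ls); exact: (hull_sub Ja).
  move=> /orbit_arc_inv[q qI E]; case: (simple (q := q)); last by rewrite E.
  by move: d0 d2s; lra.
have inner q : 0 <= q <= s -> v q z = a -> 0 < q < s.
  move=> /andP[q0 qs] E; rewrite !lt_neqAle q0 qs !andbT; apply/andP; split; apply/eqP => qE.
    by apply: nJa; rewrite -E -qE (flow0 hv); exact: (hulll so).
  by apply: nJa; rewrite -E qE; exact: (hullr so).
case: la => // /orbit_arc_inv[r r0s E]; have rs := inner r r0s E.
right; exists r => //; have [r0 _ _ _] := arc_radiusP rs; split.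
  by rewrite /= -E (flowK hv); exists z, 0; rewrite normr0 (flow0 hv).
have arc_far q : 0 <= q <= s -> q <> r -> v q z <> a.
  by move=> qI qr Eq; apply/qr/(orbit_arc_inj (inner q qI Eq) rs); rewrite Eq.
by move=> [[/orbit_arc_inv[q qI]|/orbit_arc_inv[q qI]]|//]; apply: arc_far; lra.
Qed.

Lemma section_loop_torsor : exists F : set (set S * (S -> bool)),
  [/\ torsor_on setT F, F (~` section_loop, fun=> false) &
      exists2 psi, F (section_chart, psi) & forall w, Z w -> psi w = lt w z].
Proof.
have [e near_z] := return_side_exists.
pose F : set (set S * (S -> bool)) := [set c | c = (section_chart, section_side e) \/
  exists2 r, 0 < r < s & c = (arc_chart r, arc_side r)].
exists [set c | c = (~` section_loop, fun=> false) \/ F c]; split; [|by left|].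
  apply: (dual_torsor section_loop_closed).
  - by move=> c [->|[r rs ->]]; [exact: section_chart_open|exact: arc_chart_open].
  - move=> a /section_loop_cover[sa|[r rs ra]].
      by exists (section_chart, section_side e) => //; left.
    by exists (arc_chart r, arc_side r) => //; right; exists r.
  - by move=> c a [->|[r rs ->]] /= ca nl; [exact: section_side_off_loop|exact: arc_side_off_loop].
  move=> c c' a [->|[r rs ->]] [->|[r' r's ->]] /= ca c'a la.
  - by apply: nearW => b; rewrite !addbb.
  - exact: section_arc_agree.
  - apply: filterS (section_arc_agree near_z rs c'a ca la) => b.
    by rewrite addbC => ->; rewrite addbC.
  - have agree := arc_side_agree rs r's ca c'a la; rewrite (nbhs_singleton agree) addbb.
    by apply: filterS agree => b ->; rewrite addbb.
exists (section_side e); first by right; left.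
move=> w Zw; have [pw tw] := section_coord hv ls Zw.
by rewrite /section_side /time tw lexx /proj pw.
Qed.

End LoopTorsor.

(** * Loops splitting an orbit *)

Definition gap (T : Type) (Z : set T) (lt : rel T) (K : set T) (z : T) : set T :=
  [set u | Z u /\ hull Z lt z u `<=` ~` K].

Section Gaps.
Variables (T : topologicalType) (Z : set T) (lt : rel T) (K : set T).
Hypotheses (so : separating_order Z lt) (cZ : connected Z).
Implicit Types u w k : T.

Lemma gap_flip z : gap Z (flip_rel lt) K z = gap Z lt K z.
Proof.
have hull_flip u : hull Z (flip_rel lt) z u = hull Z lt z u.
  by rewrite hullC /hull; congr (_ `|` _); exact: seg_flip.
by apply/seteqP; split => u [Zu]; rewrite ?hull_flip; split; rewrite ?hull_flip.
Qed.

Lemma gap_ends u w : Z u -> gap Z lt K u w -> ~ K u /\ ~ K w.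
Proof. by move=> Zu [Zw uwK]; split; apply: uwK; [exact: (hulll so)|exact: (hullr so)]. Qed.

Lemma gapC u w : Z u -> gap Z lt K u w -> gap Z lt K w u.
Proof. by move=> Zu [Zw]; rewrite hullC; split. Qed.

Lemma hull_sub_gap u w : Z u -> gap Z lt K u w -> hull Z lt u w `<=` gap Z lt K u.
Proof.
move=> Zu [Zw uwK] y uwy; split; first exact: hull_sub uwy.
exact: subset_trans (hull_subset so cZ Zu Zw uwy) uwK.
Qed.

Lemma gap_between u w k k' : Z u -> gap Z lt K u w -> Z k -> K k -> Z k' -> K k' ->
  lt k u -> lt u k' -> lt k w /\ lt w k'.
Proof.
move=> Zu ugw Zk Kk Zk' Kk' ku uk'; have [_ nKw] := gap_ends Zu ugw; have [Zw uwK] := ugw.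
have side c : Z c -> K c -> lt c u = lt c w.
  by move=> Zc Kc; apply: (hull_side so) => // /uwK.
split; first by rewrite -side.
apply: (sep_neq_le_lt so) => //; first by move=> wk'; apply: nKw; rewrite wk'.
by rewrite -side// (sep_asym so).
Qed.

End Gaps.

Section SectionReturns.
Variables (R : realType) (S : topologicalType) (v : R -> S -> S).
Hypotheses (hv : flow v) (hS : surface R S).
Variables (x : S) (Z : set S) (d : R).
Hypothesis ls : local_section v x Z d.
Implicit Types (y u k z : S) (s q t : R) (N G K : set S).

Lemma section_return u N : returns v u -> Z u -> nbhs u N ->
  exists t, [/\ t != 0, Z (v t u) & N (v t u)].
Proof.
move=> ru Zu Nu; have [pu _] := section_coord hv ls Zu.
have near_u : \forall b \near u,
    [/\ box v Z d b, Z (box_proj v Z d b) & N (box_proj v Z d b)].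
  by apply: (box_proj_near hv ls); [exact: (section_box hv ls)|rewrite pu].
have [t dt [Bt Zt Nt]] := ru d _ near_u; have [_ td _] := box_coordP Bt.
exists (t - return_delay v Z d t u); rewrite -(return_mapE hv Bt); split => //.
by rewrite subr_eq0; apply/eqP => tE; move: dt; rewrite tE ltNge (ltW td).
Qed.

Lemma section_orbit_near y k N : Z k -> closure (orbit v y) k -> nbhs k N ->
  exists w, [/\ Z w, N w & orbit v y w].
Proof.
move=> Zk yk Nk; have [pk _] := section_coord hv ls Zk.
have near_k : \forall b \near k,
    [/\ box v Z d b, Z (box_proj v Z d b) & N (box_proj v Z d b)].
  by apply: (box_proj_near hv ls); [exact: (section_box hv ls)|rewrite pk].
have [_ [[t _ <-] [Bt Zt Nt]]] := yk _ near_k.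
exists (return_map v Z d t y); split => //; rewrite (return_mapE hv Bt).
by exists (t - return_delay v Z d t y).
Qed.

Lemma section_nowhere_dense y u N : ~ interior (closure (orbit v y)) y -> Z u -> nbhs u N ->
  exists w, [/\ Z w, N w & ~ closure (orbit v y) w].
Proof.
move=> ny Zu; rewrite nbhsE => -[W [oW Wu] WN]; apply: contrapT => dense; apply: ny.
apply: (orbit_closure_interior hv); exists u.
have : nbhs u (flow_box v Z W d).
  apply: open_nbhs_nbhs; split.
    by apply: (flow_box_open ls) => //; rewrite lexx (section_radius_gt0 ls).
  by exists u, 0; rewrite normr0 (section_radius_gt0 ls) (flow0 hv).
apply: filterS => _ [w [t [Zw Ww td <-]]]; apply: (orbit_closure_flow hv).
by apply: contrapT => nyw; apply: dense; exists w; split => //; exact: WN.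
Qed.

Lemma section_first_return G z s1 : G `<=` Z -> 0 < s1 -> G (v s1 z) ->
  exists s, [/\ 0 < s, G (v s z) & forall q, 0 < q < s -> ~ G (v q z)].
Proof.
move=> GZ s10 Gs1; pose A := [set t | 0 < t /\ G (v t z)].
have hasA : has_inf A by split; [exists s1|exists 0 => t [/ltW]].
have [s [s0 Gs] sA] := inf_adherent (section_radius_gt0 ls) hasA.
exists s; split => // q /andP[q0 qs] Gq.
have qA : inf A <= q by apply: ge_inf; [case: hasA|].
suff : s - q = 0 by lra.
apply: (section_transverse ls (GZ _ Gs) (GZ _ Gq)); last by rewrite -(flowD hv) subrK.
by move: (section_radius_gt0 ls); rewrite ltr_norml; lra.
Qed.

Lemma gap_nbhs lt K u : separating_order Z lt -> closed K -> Z u -> ~ K u ->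
  \forall w \near u, Z w -> gap Z lt K u w.
Proof.
move=> so cK Zu nKu.
have nbhsK : nbhs u (~` K) by apply: open_nbhs_nbhs; split => //; exact: closed_openC.
have [C [cC CZ CK Cu nearC]] := section_locally_connected hv ls hS Zu nbhsK.
apply: filterS nearC => w Cw Zw; split => //.
exact: subset_trans (connected_hull_sub so cC CZ Cu (Cw Zw)) CK.
Qed.

Lemma first_point_after lt K z p : separating_order Z lt -> closed K ->
  Z z -> ~ K z -> Z p -> K p -> lt z p ->
  exists k, [/\ Z k, K k, ~~ lt p k & lt z k] /\
    forall y, Z y -> ~~ lt y z -> lt y k -> ~ K y.
Proof.
move=> so cK Zz nKz Zp Kp zp; apply: contrapT => no_first.
pose f y := `[< seg Z lt z y `<=` ~` K >].
have cZ := section_connected ls.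
have pz : ~~ lt p z by rewrite (sep_asym so Zz Zp zp).
have lf : locally_constant (seg Z lt z p) f.
  move=> y [Zy yz py]; case fy : (f y); rewrite /f in fy.
    have zyK := elimT (asboolP _) fy; have nKy : ~ K y by apply: zyK; exact: (segr so).
    apply: filterS (gap_nbhs so cK Zy nKy) => w near_w [Zw wz _]; apply/asboolP => u [Zu uz wu].
    have [yu|yu] := boolP (lt y u); last by apply: zyK.
    by apply: (near_w Zw).2; left; split => //; rewrite (sep_asym so Zy Zu yu).
  have [k [[Zk kz yk] Kk]] : exists k, seg Z lt z y k /\ K k.
    by have /existsNP[k /not_implyP[zyk /contrapT Kk]] := elimF (asboolP _) fy; exists k.
  have neq_z u : K u -> z <> u by move=> Ku zu; apply: nKz; rewrite zu.
  have [ky|ky] := pselect (exists2 k', K k' & seg Z lt z y k' /\ lt k' y).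
    have [k' Kk' [[Zk' k'z _] k'y]] := ky.
    apply: filterS (sep_nearr so Zk' Zy (sep_neq so Zk' k'y)) => w near_w [Zw _ _].
    apply/asboolP => zwK; apply: (zwK k') => //; split => //.
    by rewrite (sep_asym so)// near_w.
  case: no_first; exists y; have Ky : K y.
    apply: contrapT => nKy; apply: ky; exists k => //; split => //.
    by apply: (sep_neq_le_lt so) => // ky; apply: nKy; rewrite -ky.
  split; first by split => //; apply: (sep_neq_le_lt so) => //; exact: neq_z.
  by move=> u Zu uz uy Ku; apply: ky; exists u => //; split => //; split; rewrite // (sep_asym so).
have cS := seg_connected so cZ Zz Zp.
have /asboolP fp : f p.
  rewrite -(connected_locally_constant cS lf (segl so Zz pz) (segr so Zp pz)).
  apply/asboolP => u [Zu uz zu] Ku; apply: nKz.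
  by rewrite (sep_antisym so Zz Zu zu uz).
by apply: (fp p) => //; exact: (segr so).
Qed.

End SectionReturns.

(* A connected piece C of V crosses the loop L once between two points p and p' of the orbit of
   x, which L itself does not meet. *)
Record orbit_splitting_loop (R : realType) (S : topologicalType) (v : R -> S -> S) (x : S)
    (V : set S) (F : set (set S * (S -> bool))) (L : set S) : Prop := OrbitSplittingLoop {
  loop_torsor : torsor_on setT F;
  loop_complement : F (~` L, fun=> false);
  loop_closed : closed L;
  loop_avoids : L `<=` ~` closure (orbit v x);
  loop_crossed : exists C N psi p p', [/\ connected C, C `<=` V, F (N, psi), C `<=` N &
    [/\ C p, C p', orbit v x p, orbit v x p' & psi p <> psi p']] }.

Section SplittingLoops.
Variables (R : realType) (S : topologicalType) (v : R -> S -> S).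
Hypotheses (hv : flow v) (hS : surface R S).
Variable x : S.
Let K : set S := closure (orbit v x).
Implicit Types (V L C : set S) (p z : S) (q s t : R).

Lemma segment_before_return x0 Z d lt z s p0 : ordered_section v x0 Z d lt ->
  Z z -> ~ K z -> orbit v x p0 -> Z p0 -> lt z p0 ->
  (forall q, 0 < q < s -> ~ gap Z lt K z (v q z)) ->
  exists p, [/\ orbit v x p, Z p, lt z p, ~~ lt p0 p &
    forall q, 0 < q < s -> ~ seg Z lt z p (v q z)].
Proof.
move=> os Zz nKz op0 Zp0 zp0 no_gap.
have ls := ordered_local_section os; have so := ordered_order os.
have cZ := section_connected ls.
have Kp0 : K p0 by exact: subset_closure.
have [k [[Zk Kk kp0 zk] before_k]] :=
  first_point_after hv hS ls so (@closed_closure _ _) Zz nKz Zp0 Kp0 zp0.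
have nAk : ~ orbit_arc v z 0 s k.
  by move=> [q _ qk]; apply: (@orbit_closureN_flow _ _ _ hv x z q nKz); rewrite qk.
have near_k : \forall w \near k, ~ orbit_arc v z 0 s w /\ (Z w -> lt z w).
  apply: filterI.
    by apply: open_nbhs_nbhs; split => //; exact/closed_openC/orbit_arc_closed.
  by apply: filterS (sep_nearr so Zz Zk (sep_neq so Zz zk)) => w near_w /near_w ->.
have [C [cC CZ CN Ck nearC]] := section_locally_connected hv ls hS Zk near_k.
have [p1 [Zp1 Cp1 op1]] := section_orbit_near hv ls Zk Kk nearC; have {}Cp1 := Cp1 Zp1.
have [p [Cp op p0p]] : exists p, [/\ C p, orbit v x p & ~~ lt p0 p].
  have [p0p1|p0p1] := boolP (lt p0 p1); last by exists p1.
  exists p0; rewrite (sep_irr so Zp0); split => //.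
  by apply: (connected_seg_sub so cC CZ Ck Cp1); split; rewrite ?(sep_asym so Zp0 Zp1).
have [Zp zp] := (CZ p Cp, (CN p Cp).2 (CZ p Cp)).
exists p; split => // q qs [Zy yz py]; have [yk|yk] := boolP (lt (v q z) k).
  apply: (no_gap q qs); split => // u; rewrite (hullE so cZ)// => -[Zu uz yu].
  apply: before_k => //; exact: (sep_le_lt_trans so cZ Zu Zy Zk yu yk).
have [nAy _] : ~ orbit_arc v z 0 s (v q z) /\ (Z (v q z) -> lt z (v q z)).
  by apply: CN; apply: (connected_seg_sub so cC CZ Ck Cp).
by apply: nAy; apply: orbit_arcP; case/andP: qs => /ltW -> /ltW ->.
Qed.

Lemma gap_return_exists x0 Z d lt p0 p0' : (forall p, returns v p) -> ~ interior K x ->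
  ordered_section v x0 Z d lt -> orbit v x p0 -> orbit v x p0' -> Z p0 -> Z p0' -> lt p0 p0' ->
  exists z s, [/\ Z z, lt p0 z, lt z p0' & [/\ 0 < s, gap Z lt K z (v s z) &
    forall q, 0 < q < s -> ~ gap Z lt K z (v q z)]].
Proof.
move=> ret nKx os op0 op0' Zp0 Zp0' p0p0'.
have ls := ordered_local_section os; have so := ordered_order os.
have cZ := section_connected ls; have cK : closed K by exact: closed_closure.
have [Kp0 Kp0'] : K p0 /\ K p0' by split; exact: subset_closure.
have [w [Zw p0w wp0']] := sep_dense so cZ Zp0 Zp0' p0p0'.
have near_w : \forall u \near w, Z u -> lt p0 u /\ lt u p0'.
  apply: filterS2 (sep_nearr so Zp0 Zw (sep_neq so Zp0 p0w))
    (sep_nearl so Zw Zp0' (sep_neq so Zw wp0')) => u p0u up0' Zu.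
  by rewrite p0u// up0'.
have [u [Zu /(_ Zu)[p0u up0'] nKu]] := section_nowhere_dense hv ls nKx Zw near_w.
have [t [t0 Zt /(_ Zt) gt]] := section_return hv ls (ret u) Zu (gap_nbhs hv hS ls so cK Zu nKu).
suff [z [s1 [Zz p0z zp0' s10 gs1]]] : exists z s1,
    [/\ Z z, lt p0 z, lt z p0', 0 < s1 & gap Z lt K z (v s1 z)].
  have gapZ : gap Z lt K z `<=` Z by move=> y [].
  have [s [s0 gs no_gap]] := section_first_return hv ls gapZ s10 gs1.
  by exists z, s.
move: t0; rewrite neq_lt => /orP[t0|t0]; last by exists u, t.
have [p0t tp0'] := gap_between so Zu gt Zp0 Kp0 Zp0' Kp0' p0u up0'.
exists (v t u), (- t); rewrite oppr_gt0 (flowK hv); split => //.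
exact: gapC.
Qed.

Lemma orbit_section_pair x0 Z d lt V : ordered_section v x0 Z d lt -> returns v x ->
  ~ closed_pt v x -> Z x -> nbhs x V -> exists C p p', [/\ connected C, C `<=` Z, C `<=` V &
    [/\ C p, C p', orbit v x p, orbit v x p' & lt p p']].
Proof.
move=> os rx ncx Zx Vx; have ls := ordered_local_section os; have so := ordered_order os.
have [C [cC CZ CV Cx nearC]] := section_locally_connected hv ls hS Zx Vx.
have [t [t0 Zt /(_ Zt) Ct]] := section_return hv ls rx Zx nearC.
have [ox ot] : orbit v x x /\ orbit v x (v t x) by split; [exact: orbit_refl|exists t].
have xt : x <> v t x by move=> xt; apply/ncx/(period_closed_pt hv t0).
exists C; have [l|l] := boolP (lt x (v t x)); first by exists x, (v t x).
exists (v t x), x; split => //; split => //.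
by apply: (sep_neq_le_lt so) => //; exact: nesym.
Qed.

Lemma orbit_splitting_loop_exists x0 Z d lt V : ordered_section v x0 Z d lt ->
  (forall p, returns v p) -> ~ interior K x -> ~ closed_pt v x -> Z x -> nbhs x V ->
  exists F L, orbit_splitting_loop v x V F L.
Proof.
move=> os ret nKx ncx Zx Vx.
have ls := ordered_local_section os; have so := ordered_order os.
have cZ := section_connected ls; have d0 := section_radius_gt0 ls.
have [C [p0 [p0' [cC CZ CV [Cp0 Cp0' op0 op0' p0p0']]]]] :=
  orbit_section_pair os (ret x) ncx Zx Vx.
have [Zp0 Zp0'] := (CZ _ Cp0, CZ _ Cp0').
have [z [s [Zz p0z zp0' [s0 gs no_gap]]]] :=
  gap_return_exists ret nKx os op0 op0' Zp0 Zp0' p0p0'.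
have [Zz' _] := gs; have [nKz _] := gap_ends so Zz gs.
have [p' [op' Zp' zp' p'p0' after_z]] :=
  segment_before_return os Zz nKz op0' Zp0' zp0' no_gap.
have [|p [op Zp pz p0p before_z]] :=
    segment_before_return (ordered_section_flip os) Zz nKz op0 Zp0 p0z (s := s).
  by move=> q; rewrite gap_flip; exact: no_gap.
rewrite /flip_rel in pz p0p; have pp' := sep_trans so cZ Zp Zz Zp' pz zp'.
have simple q : 0 < q < s -> ~ hull Z lt z (v s z) (v q z).
  by move=> qs /(hull_sub_gap so cZ Zz gs); exact: no_gap.
have [F [torF F0 [psi Fpsi psiE]]] := section_loop_torsor hv hS os Zz Zz' s0 simple.
exists F, (section_loop v Z lt z s); split => //.
- exact: (section_loop_closed hv hS os).
- move=> y [[q _ <-]|/(hull_sub_gap so cZ Zz gs)/(gap_ends so Zz)[_]//].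
  exact: orbit_closureN_flow.
exists (seg Z lt p p'), (section_chart v Z d z s), psi, p, p'; split => //.
- exact: seg_connected.
- apply: subset_trans (seg_subset so cZ Zp Zp' Zp0 Zp0' _ _) _ => //.
  exact: subset_trans (connected_seg_sub so cC CZ Cp0 Cp0') CV.
- move=> y [Zy yp p'y]; split; first exact: (section_box hv ls).
  move=> /orbit_arc_inv[q qI qy]; have qs : 0 < q < s by move: d0; lra.
  have [yz|yz] := boolP (lt y z); last by apply: (after_z q qs); rewrite qy.
  by apply: (before_z q qs); rewrite qy seg_flip; split => //; rewrite (sep_asym so).
- by split; rewrite ?psiE ?(sep_asym so Zp Zp' pp')// ?pz ?(sep_asym so Zz Zp' zp')//;
    [apply: segl|apply: segr]; rewrite ?(sep_asym so Zp Zp' pp').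
Qed.

(* An isomorphism is constant along the orbit of x, which avoids both loops, and differs from
   psi by a constant along C, which avoids L. *)
Lemma splitting_loops_not_isomorphic V V' F F' L L' Phi :
  orbit_splitting_loop v x V F L -> orbit_splitting_loop v x V' F' L' -> V' `<=` ~` L ->
  ~ torsor_isomorphism F F' Phi.
Proof.
move=> loopL loopL' V'L iso.
have [C [N [psi [p [p' [cC CV' Fpsi CN [Cp Cp' op op' psi_pp']]]]]]] := loop_crossed loopL'.
have orbit_off : orbit v x `<=` ~` L `&` ~` L'.
  move=> y /subset_closure Ky.
  by split => [/(loop_avoids loopL)|/(loop_avoids loopL')]; exact.
have CLN : C `<=` ~` L `&` N by move=> y Cy; split; [exact/V'L/CV'|exact: CN].
have Phi_off := iso _ _ (loop_complement loopL) (loop_complement loopL').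
have Phi_C := iso _ _ (loop_complement loopL) Fpsi.
have := connected_locally_constant cC (locally_constantS CLN Phi_C) Cp Cp'.
have := connected_locally_constant (orbit_connected hv (x := x))
  (locally_constantS orbit_off Phi_off) op op'.
by rewrite /= !addbF => -> /addbI.
Qed.

End SplittingLoops.

Theorem recurrent_orbit_closure_nbhd (R : realType) (S : topologicalType) (v : R -> S -> S) x :
  flow v -> surface R S -> compact [set: S] -> (forall p, returns v p) -> ~ closed_pt v x ->
  interior (closure (orbit v x)) x.
Proof.
move=> hv hS hcpt ret ncx; apply: contrapT => nKx.
have [|Z [d [lt os]]] := ordered_section_exists hv hS hcpt (x := x).
  by move=> sx; apply: ncx; left.
have Zx := section_base (ordered_local_section os).
have /choice[FL loopP] (V : set S) : exists FL, nbhs x V -> orbit_splitting_loop v x V FL.1 FL.2.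
  have [Vx|nVx] := pselect (nbhs x V); last by exists (set0, set0).
  have [F [L loopL]] := orbit_splitting_loop_exists hv hS os ret nKx ncx Zx Vx.
  by exists (F, L).
pose V := fix V n := if n is n'.+1 then V n' `&` ~` (FL (V n')).2 else setT.
have Vx n : nbhs x (V n).
  elim: n => [|n Vx]; first exact: filterT.
  apply: filterI => //; apply: open_nbhs_nbhs; split.
    exact/closed_openC/(loop_closed (loopP _ Vx)).
  by move=> /(loop_avoids (loopP _ Vx)); apply; exact: orbit_closure_refl.
have V_off k l : (k < l)%N -> V l `<=` ~` (FL (V k)).2.
  elim: l => // l IH; rewrite ltnS leq_eqVlt => /orP[/eqP-> y []//|kl y [Vy _]].
  exact: IH.
have [k [l [kl [Phi iso]]]] :=
  torsor_finiteness hS hcpt (fun n => loop_torsor (loopP _ (Vx n))).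
exact: splitting_loops_not_isomorphic (loopP _ (Vx k)) (loopP _ (Vx l)) (V_off k l kl) iso.
Qed.

(** * Recurrence and orbit classes *)

Section NoInjectionIntoLine.
Variable R : realType.
Implicit Types (a b c p : R * R) (A : set (R * R)).

Lemma separating_order_real : separating_order [set: R] (fun s t => s < t).
Proof.
have near_lt (s t : R) : s != t ->
    (\forall s' \near s, (s' < t) = (s < t)) /\ (\forall t' \near t, (s < t') = (s < t)).
  rewrite neq_lt => /orP[st|ts]; rewrite ?st; split.
  - by apply: filterS (lt_nbhsl st) => s' /= ->.
  - by apply: filterS (lt_nbhsr st) => t' /= ->.
  - by apply: filterS (lt_nbhsr ts) => s' ts'; rewrite (lt_gtF ts) (lt_gtF ts').
  - by apply: filterS (lt_nbhsl ts) => t' t's; rewrite (lt_gtF ts) (lt_gtF t's).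
split=> [s|s t|s t|s t] _.
- exact: ltxx.
- by move=> _ /eqP st; rewrite ltNge le_eqVlt (negbTE st).
- by move=> _ /eqP/near_lt[near_s _]; apply: filterS near_s.
- by move=> _ /eqP/near_lt[_ near_t]; apply: filterS near_t.
Qed.

Lemma injective_line_segment_side A (k : R * R -> R) a b p :
  convex_set (A : set (convex_lmodType (R * R)%type)) -> {within A, continuous k} ->
  (forall q q', A q -> A q' -> k q = k q' -> q = q') ->
  A a -> A b -> A p -> ~ line_segment a b p -> (k a < k p) = (k b < k p).
Proof.
move=> cA ck k_inj Aa Ab Ap nabp; have abA := convex_line_segment cA Aa Ab.
apply: (connected_same_side separating_order_real (@line_segment_connected _ _ a b)) => //.
- exact: continuous_subspaceW ck.
- by move=> q abq kqp; apply: nabp; rewrite -(k_inj q p)//; exact: abA.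
- exact: line_segmentl.
- exact: line_segmentr.
Qed.

(* Each of three non-collinear points has the two others on the same side of it, so none of the
   three values of [k] is the middle one. *)
Lemma no_injection_half_disc c (r : R) (k : R * R -> R) : 0 < r -> @half_plane R c ->
  {within half_disc c r, continuous k} ->
  ~ (forall q q', half_disc c r q -> half_disc c r q' -> k q = k q' -> q = q').
Proof.
move=> r0 c0 ck k_inj; have side := injective_line_segment_side (@half_disc_convex _ c r) ck k_inj.
pose a : R * R := (c.1 + r, c.2); pose b : R * R := (c.1, c.2 + r).
have Dc : half_disc c r c by exact: half_disc_center (ltW r0).
have Da : half_disc c r a.
  split => //=; rewrite normB_pair_le /= subrr normr0 (ltW r0) andbT.
  by rewrite opprD addrA subrr sub0r normrN gtr0_norm.
have Db : half_disc c r b.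
  split; first by rewrite /half_plane /= addr_ge0// ltW.
  rewrite /= normB_pair_le /= subrr normr0 (ltW r0) /=.
  by rewrite opprD addrA subrr sub0r normrN gtr0_norm.
have coord p q q' : line_segment q q' p ->
    exists t : R, p.1 = (1 - t) * q.1 + t * q'.1 /\ p.2 = (1 - t) * q.2 + t * q'.2.
  by move=> [t _ <-]; exists t.
have kc := side a b c Da Db Dc; have ka := side c b a Dc Db Da; have kb := side c a b Dc Da Db.
have {}kc : (k a < k c) = (k b < k c) by apply: kc => /coord[t []]; rewrite /=; lra.
have {}ka : (k c < k a) = (k b < k a) by apply: ka => /coord[t []]; rewrite /=; lra.
have {}kb : (k c < k b) = (k a < k b) by apply: kb => /coord[t []]; rewrite /=; lra.
have ac : k a != k c by apply/eqP => /(k_inj _ _ Da Dc)/(congr1 fst) /=; lra.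
have bc : k b != k c by apply/eqP => /(k_inj _ _ Db Dc)/(congr1 snd) /=; lra.
have ab : k a != k b by apply/eqP => /(k_inj _ _ Da Db)/(congr1 fst) /=; lra.
move: ac bc ab kc ka kb.
by case: (ltgtP (k a) (k c)); case: (ltgtP (k b) (k c)); case: (ltgtP (k a) (k b)).
Qed.

Lemma surface_no_injection_into_line (S : topologicalType) (x : S) (U : set S) (h : S -> R) :
  has_chart R x -> nbhs x U -> (forall y, U y -> h @ y --> h y) ->
  ~ (forall y y', U y -> U y' -> h y = h y' -> y = y').
Proof.
move=> /disc_chart_exists[f [g [r dc]]] Ux ch h_inj.
have [r' /andP[r'0 r'r] r'U] := chart_disc_small dc Ux.
have discU q : half_disc (f x) r' q -> U (g q) by move=> r'q; apply: r'U; exists q.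
apply: (no_injection_half_disc (k := h \o g) r'0 (chart_center_half_plane dc)).
  have /subspace_continuousP cg :=
    continuous_subspaceW (half_discS r'r) (chart_inv_continuous dc).
  by apply/subspace_continuousP => q r'q; apply: cvg_comp (cg q r'q) (ch _ (discU q r'q)).
move=> q q' r'q r'q' /(h_inj _ _ (discU q r'q) (discU q' r'q'))/(congr1 f).
by rewrite !(chartK dc)//; exact: half_discS r'r _ _.
Qed.

End NoInjectionIntoLine.

Section ProperOrbits.
Variables (R : realType) (S : topologicalType) (v : R -> S -> S).
Hypotheses (hv : flow v) (hS : surface R S).
Implicit Types (x y : S).

Lemma proper_orbit_near_arc x (e : R) : proper_orbit v x -> 0 < e ->
  \forall y \near x, orbit v x y -> orbit_arc v x (- e) e y.
Proof.
move=> px e0; have [W] := px 0 e e0; rewrite (flow0 hv) => Wx W_arc.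
apply: filterS Wx => y Wy [t _ ty]; rewrite -ty in Wy *; have [s [<- se]] := W_arc t Wy.
by apply: orbit_arcP; move: se; rewrite subr0 ltr_norml => /andP[/ltW -> /ltW ->].
Qed.

Lemma proper_orbit_locally_closed x : proper_orbit v x ->
  \forall y \near x, closure (orbit v x) y -> orbit v x y.
Proof.
move=> px; apply: filterS (nbhs_interior (proper_orbit_near_arc px ltr01)) => y near_arc xy.
suff [t _ <-] : orbit_arc v x (-1) 1 y by exists t.
apply: contrapT => ny; have near_off : nbhs y (~` orbit_arc v x (-1) 1).
  by apply: open_nbhs_nbhs; split => //; exact/closed_openC/orbit_arc_closed.
by have [w [xw [w_arc nw]]] := xy _ (filterI near_arc near_off); exact/nw/w_arc.
Qed.

Lemma proper_orbit_not_nbhs x : compact [set: S] -> proper_orbit v x -> ~ singular_pt v x ->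
  ~ nbhs x (orbit v x).
Proof.
move=> hcpt px nsx ox; have [Z [d [lt os]]] := ordered_section_exists hv hS hcpt nsx.
have ls := ordered_local_section os; have Zx := section_base ls.
have d20 : 0 < d / 2 by rewrite divr_gt0// (section_radius_gt0 ls).
have arc_box y : orbit_arc v x (- (d / 2)) (d / 2) y -> box v Z d y /\ box_proj v Z d y = x.
  move=> /orbit_arc_inv[t td <-].
  have {}td : `|t| < d by move: td d20; rewrite ltr_norml; lra.
  by split; [exact: box_flow|have [] := box_coord_flow hv ls Zx td].
have near_arc : nbhs x (orbit_arc v x (- (d / 2)) (d / 2)).
  by apply: filterS2 (proper_orbit_near_arc px d20) ox => y; exact.
apply: (surface_no_injection_into_line (hS.2 x) near_arc (h := box_time v Z d)).
  move=> y /arc_box[By _]; apply/cvgrPdist_lt => e e0.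
  by apply: filterS (box_time_near hv ls By e0) => z [].
move=> y y' /arc_box[By py] /arc_box[By' py'] E.
have [_ _ <-] := box_coordP By; have [_ _ <-] := box_coordP By'.
by rewrite py py' E.
Qed.

End ProperOrbits.

Definition orbit_class (R : realType) (S : topologicalType) (v : R -> S -> S) (x : S) : set S :=
  [set y | closure (orbit v x) = closure (orbit v y)].

Section OrbitClasses.
Variables (R : realType) (S : topologicalType) (v : R -> S -> S).
Hypotheses (hv : flow v) (hS : surface R S) (hcpt : compact [set: S]).
Implicit Types (x y : S).

Lemma orbit_sub_class x : orbit v x `<=` orbit_class v x.
Proof. by move=> y /(orbit_eq hv) xy; rewrite /orbit_class /= xy. Qed.

Lemma closed_orbit_class x : closed (orbit v x) -> orbit_class v x = orbit v x.
Proof.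
move=> /closure_id clx; apply/seteqP; split; last exact: orbit_sub_class.
by move=> y xy; rewrite clx xy; exact: orbit_closure_refl.
Qed.

Lemma proper_orbit_class x : proper_orbit v x -> orbit_class v x = orbit v x.
Proof.
move=> px; apply/seteqP; split => [y xy|]; last exact: orbit_sub_class.
have yx : closure (orbit v y) x by rewrite -xy; exact: orbit_closure_refl.
have [_ [[t _ <-] near_t]] := yx _ (proper_orbit_locally_closed hv hS px).
have xty : closure (orbit v x) (v t y).
  by apply: (orbit_closure_flow hv); rewrite xy; exact: orbit_closure_refl.
by have := orbit_flow hv (- t) (near_t xty); rewrite (flowK hv).
Qed.

Lemma recurrent_iff_no_proper :
  recurrent_flow v <-> (forall x, proper_orbit v x -> closed_orbit v x).
Proof.
split=> [rv x px|proper_closed x].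
  by apply/(closed_orbitP hv)/(proper_returns_closed hv px)/recurrent_returns.
apply/recurrent_returns; apply: contrapT => nrx; apply: (nrx).
apply/(closed_pt_returns hv)/(closed_orbitP hv)/proper_closed.
exact: not_returns_proper hS.1 nrx.
Qed.

Lemma recurrent_near_class x : recurrent_flow v -> ~ closed_pt v x ->
  \forall y \near x, orbit_class v x y.
Proof.
move=> rv ncx; have ret p : returns v p by apply/recurrent_returns.
have dense y : ~ closed_pt v y -> interior (closure (orbit v y)) y.
  exact: recurrent_orbit_closure_nbhd.
have meets y z : ~ closed_pt v y -> closure (orbit v z) y ->
    closure (orbit v y) `<=` closure (orbit v z) /\ closure (orbit v y) z.
  move=> ncy zy; split; first exact: orbit_closure_sub.
  have [_ [[t _ <-] yt]] := zy _ (dense y ncy).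
  by rewrite -(flowK hv t z); exact: orbit_closure_flow.
have [T T0 vT] : exists2 T, 0 < T & v T x <> x.
  by apply: (nonsingular_time hv) => sx; apply: ncx; left.
have [A [B [AT Bx AB]]] := hausdorff_separation hS.1 vT.
apply: filterS2 (filterI (flow_near hv AT) Bx) (dense x ncx) => y [Ay By] xy.
have ncy : ~ closed_pt v y.
  move=> [sy|py].
    by rewrite sy in Ay; have : (A `&` B) y by []; rewrite AB.
  have [_ [[t _ <-] closed_t]] := xy _ (near_periodic_returns_closed hv hS hcpt py).
  by apply: ncx; rewrite -(flowK hv t x); apply/(closed_pt_flow hv)/closed_t.
have [yx_sub yx] := meets y x ncy xy.
by apply/seteqP; split => //; exact: orbit_closure_sub.
Qed.

Lemma recurrent_iff_locally_dense :
  recurrent_flow v <-> (forall x, closed_orbit v x \/ locally_dense v x).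
Proof.
split=> [rv x|closed_or_dense x].
  have [cx|ncx] := pselect (closed_pt v x); first by left; apply/(closed_orbitP hv).
  right; exists x; apply: filterS (recurrent_near_class rv ncx) => y ->.
  exact: orbit_closure_refl.
apply/recurrent_returns; apply: contrapT => nrx.
have [/(closed_orbitP hv)/(closed_pt_returns hv)//|/(orbit_closure_interior hv) ix] :=
  closed_or_dense x.
have px := not_returns_proper hv hS.1 nrx.
apply: (proper_orbit_not_nbhs hv hS hcpt px).
  by move=> sx; apply/nrx/(closed_pt_returns hv); left.
by apply: filterS2 (proper_orbit_locally_closed hv hS px) ix => y; exact.
Qed.

Lemma recurrent_iff_classes :
  recurrent_flow v <-> (forall x, closed (orbit_class v x) \/ open (orbit_class v x)).
Proof.
split=> [rv x|closed_or_open x].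
  have clo y := closed_pt_orbit_closed hv (x := y) hS.1.
  have [cx|ncx] := pselect (closed_pt v x).
    by left; rewrite closed_orbit_class; exact: clo.
  right; rewrite openE => y xy; apply: filterS (recurrent_near_class rv _).
    by move=> w; rewrite /orbit_class /= xy.
  move=> cy; apply: ncx; have : orbit_class v y x by rewrite /orbit_class /= xy.
  by rewrite closed_orbit_class; [move=> [t _ <-]; exact: closed_pt_flow|exact: clo].
apply/recurrent_returns; apply: contrapT => nrx.
have px := not_returns_proper hv hS.1 nrx.
have := closed_or_open x; rewrite proper_orbit_class// => -[cx|ox].
  exact: (not_returns_orbit_not_closed hv hcpt nrx cx).
apply: (proper_orbit_not_nbhs hv hS hcpt px).
  by move=> sx; apply/nrx/(closed_pt_returns hv); left.
by apply: open_nbhs_nbhs; split => //; exact: orbit_refl.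
Qed.

End OrbitClasses.

(** * Quotient spaces *)

Section KernelQuotients.
Variables (X : Defs.space) (U : Type) (phi : pts X -> U).

Definition kernel_quotient : Defs.space := quotient_space (fun x y => phi x = phi y).

Definition class_pt (x : pts X) : pts kernel_quotient :=
  exist _ (fun y => phi x = phi y) (ex_intro _ x erefl).

Lemma class_ptP (p : pts kernel_quotient) y : proj1_sig p y -> p = class_pt y.
Proof.
case: p => A Aclass /= Ay; have [x EA] := Aclass.
have Ay_class : A = (fun z => phi y = phi z) by rewrite EA in Ay *; rewrite Ay.
rewrite /class_pt; move: Aclass (ex_intro _ y _); rewrite Ay_class => Aclass yclass.
by congr (exist _ _ _); exact: Prop_irrelevance.
Qed.

Lemma class_pt_eq x y : class_pt x = class_pt y <-> phi x = phi y.
Proof.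
split=> [xy|]; last exact: (class_ptP (p := class_pt x)).
by have : proj1_sig (class_pt x) y by rewrite xy.
Qed.

Lemma class_pt_surj (p : pts kernel_quotient) : exists x, p = class_pt x.
Proof. by case: (proj2_sig p) => x px; exists x; apply: class_ptP; rewrite px. Qed.

Lemma opens_kernel_quotient (W : set (pts kernel_quotient)) :
  @opens kernel_quotient W = @opens X [set x | W (class_pt x)].
Proof.
congr (@opens X _); apply/seteqP; split => x; first by move=> [A WA /class_ptP AE]; rewrite /= -AE.
by move=> Wx; exists (class_pt x).
Qed.

Lemma T_half_kernel_quotient : T_half kernel_quotient <->
  forall x, sp_closed [set y | phi x = phi y] \/ @opens X [set y | phi x = phi y].
Proof.
have fiber x : [set y | [set class_pt x] (class_pt y)] = [set y | phi x = phi y].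
  by apply/seteqP; split => y; [move=> /esym/class_pt_eq|move=> /class_pt_eq].
have fiberC x : [set y | (~` [set class_pt x]) (class_pt y)] = ~` [set y | phi x = phi y].
  by rewrite -fiber.
split=> [half x|half p].
  by have := half (class_pt x); rewrite /sp_closed !opens_kernel_quotient fiber fiberC.
have [x ->] := class_pt_surj p.
by rewrite /sp_closed !opens_kernel_quotient fiber fiberC; exact: half.
Qed.

End KernelQuotients.

Section OrbitSpaces.
Variables (R : realType) (S : topologicalType) (v : R -> S -> S).
Hypothesis hv : flow v.
Implicit Types (x y : S).

Lemma T_half_orbit_class_space : T_half (orbit_class_space v) <->
  forall x, closed (orbit_class v x) \/ open (orbit_class v x).
Proof.
rewrite (T_half_kernel_quotient (X := top_space S) (fun x => closure (orbit v x))).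
by split=> half x; have := half x; rewrite /sp_closed /= openC.
Qed.

Let orbit_pt : S -> pts (orbit_space v) := class_pt (X := top_space S) (orbit v).

Lemma closure_orbit_pt x y : sp_closure [set orbit_pt x] (orbit_pt y) <-> closure (orbit v x) y.
Proof.
split=> [xy|xy W]; last first.
  rewrite [opens _]opens_kernel_quotient => oW Wy.
  have [w [xw Ww]] := xy _ (open_nbhs_nbhs (conj oW Wy)); exists (orbit_pt x); split => //.
  suff -> : orbit_pt x = orbit_pt w by [].
  by apply/class_pt_eq; exact: orbit_eq.
apply: contrapT => nxy.
pose W : set (pts (orbit_space v)) := [set p | proj1_sig p `<=` ~` closure (orbit v x)].
have WE w : W (orbit_pt w) <-> ~ closure (orbit v x) w.
  split=> [|nxw w' ww']; first by apply.
  have [t _ <-] : orbit v w w' by rewrite ww'; exact: orbit_refl.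
  exact: orbit_closureN_flow.
have oW : @opens (orbit_space v) W.
  rewrite [opens _]opens_kernel_quotient.
  have -> : [set w | W (orbit_pt w)] = ~` closure (orbit v x) by apply/seteqP; split => w /WE.
  exact/closed_openC/closed_closure.
have [p [Wp px]] := xy W oW ((WE y).2 nxy); rewrite /= in px.
by move: Wp; rewrite px => /WE; apply; exact: orbit_closure_refl.
Qed.

Lemma S_half_orbit_space : S_half (orbit_space v) <->
  forall x, closed (orbit_class v x) \/ open (orbit_class v x).
Proof.
pose cl (p : pts (orbit_space v)) := sp_closure [set p].
have clE x y : cl (orbit_pt x) = cl (orbit_pt y) <-> orbit_class v x y.
  split=> xy; apply/seteqP; split => w.
  - by move=> /closure_orbit_pt; rewrite -/(cl _) xy => /closure_orbit_pt.
  - by move=> /closure_orbit_pt; rewrite -/(cl _) -xy => /closure_orbit_pt.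
  - have [z ->] := class_pt_surj w; move=> /closure_orbit_pt xz; apply/closure_orbit_pt.
    by rewrite -xy.
  - have [z ->] := class_pt_surj w; move=> /closure_orbit_pt yz; apply/closure_orbit_pt.
    by rewrite xy.
have class_opens x : @opens (orbit_space v) [set q | cl (orbit_pt x) = cl q] =
    open (orbit_class v x).
  rewrite [opens _]opens_kernel_quotient; congr open.
  by apply/seteqP; split => y /clE.
have class_closed x : sp_closed [set q | cl (orbit_pt x) = cl q] = closed (orbit_class v x).
  rewrite -openC /sp_closed [opens _]opens_kernel_quotient; congr open.
  by apply/seteqP; split => y nxy /clE.
apply: iff_trans (T_half_kernel_quotient cl) _; split=> half x.
  by rewrite -class_opens -class_closed; exact: half.
have [y ->] := class_pt_surj x.
by rewrite [opens _]class_opens [sp_closed _]class_closed; exact: half.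
Qed.

End OrbitSpaces.

Theorem theorem3p2 (R : realType) (S : topologicalType)
    (hS : surface R S) (hcpt : compact [set: S]) (hconn : connected [set: S])
    (v : R -> S -> S) (hv : flow v) :
  [/\ recurrent_flow v <-> (forall x : S, proper_orbit v x -> closed_orbit v x),
      recurrent_flow v <-> (forall x : S, closed_orbit v x \/ locally_dense v x),
      recurrent_flow v <-> T_half (orbit_class_space v) &
      recurrent_flow v <-> S_half (orbit_space v)].
Proof.
split.
- exact: recurrent_iff_no_proper hv hS.
- exact: recurrent_iff_locally_dense hv hS hcpt.
- by rewrite T_half_orbit_class_space; exact: recurrent_iff_classes.
- by rewrite S_half_orbit_space//; exact: recurrent_iff_classes.
Qed.
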